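(* Let $\Bbbk$ be an algebraically closed field with $\operatorname{char}\Bbbk=p>2$, and let $\widetilde{\mathcal D}$ be the Hopf superalgebra defined in the context. Put $\zeta^{(p)}=\zeta^p-\zeta$ and let $Z\subseteq\widetilde{\mathcal D}$ be the subalgebra generated by $x_{21}^p,\ x_2^{2p},\ u_{21}^p,\ u_2^{2p},\ g^{\pm p},\ \zeta^{(p)}$. Then: (i) $Z$ is a central Hopf subalgebra of $\widetilde{\mathcal D}$. (ii) $\widetilde{\mathcal D}$ is a finitely generated free $Z$-module. (iii) $Z\simeq\Bbbk[T^{\pm1},X_1,\dots,X_5]$ as an algebra. In particular $Z$ is a domain. (iv) $Z\simeq\mathcal O(\mathbf B)$ as Hopf algebras, where $\mathbf B=\big((\mathbf G_a\times\mathbf G_a)\rtimes\mathbf G_m\big)\times\mathbf H_3$, with $\mathbf G_m$ acting on $\mathbf G_a\times\mathbf G_a$ by $\lambda\cdot(r_1,r_2)=(\lambda^2r_1,\lambda^2r_2)$, and $\mathbf H_3$ the Heisenberg group of $3\times3$ upper triangular matrices with ones on the diagonal.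
   Context: $\widetilde{\mathcal D}$ is the Hopf superalgebra generated by odd elements $x_1,x_2,u_1,u_2$ and even elements $g^{\pm1},\zeta$ with relations (writing $x_{21}=x_2x_1+x_1x_2$, $u_{21}=u_1u_2+u_2u_1$): $x_1^2=0$, $x_2x_{21}=x_{21}x_2+x_1x_{21}$, $u_1^2=0$, $u_2u_{21}=u_{21}u_2+u_1u_{21}$, $u_i\zeta=\zeta u_i+u_i$, $\zeta x_i=x_i\zeta+x_i$ ($i=1,2$), $g^{\pm1}g^{\mp1}=1$, $\zeta g=g\zeta$, $gx_1=x_1g$, $gx_2=x_2g-x_1g$, $u_1g=gu_1$, $u_2g=gu_2-gu_1$, $u_1x_1=-x_1u_1$, $u_1x_2=-x_2u_1+(1-g)$, $u_2x_1=-x_1u_2+(1-g)+x_1u_1$, $u_2x_2=-x_2u_2+g\zeta+x_2u_1$. Comultiplication: $g$ group-like, $\zeta,u_1$ primitive, $\Delta(x_i)=x_i\otimes1+g\otimes x_i$, $\Delta(u_2)=u_2\otimes1+1\otimes u_2-\zeta\otimes u_1$. $\mathbf G_a=(\Bbbk,+)$ and $\mathbf G_m=(\Bbbk^\times,\cdot)$ as algebraic groups; $\mathcal O(\cdot)$ denotes the Hopf algebra of regular functions. *)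

(* Defs.v *)
From HB Require Import structures.
From mathcomp Require Import all_boot all_order all_algebra.
From mathcomp Require Import finmap generic_quotient ring_quotient fraction.
From mathcomp Require Import boolp classical_sets functions.
From mathcomp Require Import mpoly monalg.

Set Implicit Arguments.
Unset Strict Implicit.
Unset Printing Implicit Defensive.

Import GRing.Theory.

Local Open Scope ring_scope.
Local Open Scope quotient_scope.

Section LinearQuotient.
Variables (k : fieldType) (V : lmodType k) (R : V -> Prop).

Inductive in_span : V -> Prop :=
| in_span_gen v of R v : in_span v
| in_span0 : in_span 0
| in_spanD v w of in_span v & in_span w : in_span (v + w)
| in_spanZ (c : k) v of in_span v : in_span (c *: v).

Definition span_of : {pred V} := fun v => `[< in_span v >].

Lemma span_ofP v : reflect (in_span v) (v \in span_of).
Proof. exact: asboolP. Qed.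

Lemma span_of_zmod_closed : zmod_closed span_of.
Proof.
split; first exact/span_ofP/in_span0.
move=> v w /span_ofP Hv /span_ofP Hw; apply/span_ofP.
by apply: in_spanD => //; rewrite -scaleN1r; apply: in_spanZ.
Qed.

HB.instance Definition _ :=
  GRing.isZmodClosed.Build V span_of span_of_zmod_closed.

Definition lquot := (Quotient.quot span_of).

HB.instance Definition _ := GRing.Zmodule.on lquot.
HB.instance Definition _ : EqQuotient V (Quotient.equiv span_of) lquot :=
  EqQuotient.on lquot.

Definition lpi (v : V) : lquot := \pi_lquot v.

Lemma lpiE v w : lpi v = lpi w <-> in_span (v - w).
Proof.
rewrite /lpi; split=> [/eqP|h].
  by rewrite -Quotient.idealrBE => /span_ofP.
by apply/eqP; rewrite -Quotient.idealrBE; apply/span_ofP.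
Qed.

Lemma lpi_repr (q : lquot) : lpi (repr q) = q.
Proof. exact: reprK. Qed.

Lemma lpi_surj (q : lquot) : {v | lpi v = q}.
Proof. by exists (repr q); exact: lpi_repr. Qed.

Lemma lpiD v w : lpi (v + w) = lpi v + lpi w.
Proof. exact: (@raddfD _ _ (\pi_(Quotient.quot span_of))). Qed.

Definition lquot_scale (c : k) (q : lquot) : lquot := lpi (c *: repr q).

Lemma lquot_scale_pi c v : lquot_scale c (lpi v) = lpi (c *: v).
Proof.
apply/lpiE; rewrite -scalerBr; apply: in_spanZ.
by apply/lpiE; exact: lpi_repr.
Qed.

Fact lquot_scaleA a b q :
  lquot_scale a (lquot_scale b q) = lquot_scale (a * b) q.
Proof. by case: (lpi_surj q) => v <-; rewrite !lquot_scale_pi scalerA. Qed.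

Fact lquot_scale1 : left_id 1 lquot_scale.
Proof. by move=> q; case: (lpi_surj q) => v <-; rewrite lquot_scale_pi scale1r. Qed.

Fact lquot_scaleDr : right_distributive lquot_scale +%R.
Proof.
move=> a q r; case: (lpi_surj q) => v <-; case: (lpi_surj r) => w <-.
by rewrite -lpiD !lquot_scale_pi scalerDr lpiD.
Qed.

Fact lquot_scaleDl q : {morph lquot_scale^~ q : a b / a + b}.
Proof.
by move=> a b; case: (lpi_surj q) => v <-; rewrite !lquot_scale_pi scalerDl lpiD.
Qed.

HB.instance Definition _ := GRing.Zmodule_isLmodule.Build k lquot
  lquot_scaleA lquot_scale1 lquot_scaleDr lquot_scaleDl.

Fact lpi_is_linear : linear lpi.
Proof. by move=> c v w; rewrite lpiD -lquot_scale_pi. Qed.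

HB.instance Definition _ :=
  GRing.isLinear.Build k V lquot *:%R lpi lpi_is_linear.

End LinearQuotient.

Section AlgebraQuotient.
Variables (k : fieldType) (A : algType k) (R : A -> Prop).

Definition two_sided (v : A) : Prop :=
  exists a r b, R r /\ v = a * r * b.

(* The quotient of [A] by the two-sided ideal generated by [R]. *)
Definition aquot := lquot two_sided.

HB.instance Definition _ := GRing.Lmodule.on aquot.

Definition api : A -> aquot := @lpi k A two_sided.

Lemma in_ideal_mull a v : in_span two_sided v -> in_span two_sided (a * v).
Proof.
elim=> [w [b [r [c [Rr ->]]]] | | v1 v2 _ h1 _ h2 | c w _ h].
- by apply: in_span_gen; exists (a * b), r, c; rewrite !mulrA.
- by rewrite mulr0; exact: in_span0.
- by rewrite mulrDr; exact: in_spanD.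
- by rewrite -scalerAr; exact: in_spanZ.
Qed.

Lemma in_ideal_mulr a v : in_span two_sided v -> in_span two_sided (v * a).
Proof.
elim=> [w [b [r [c [Rr ->]]]] | | v1 v2 _ h1 _ h2 | c w _ h].
- by apply: in_span_gen; exists b, r, (c * a); rewrite !mulrA.
- by rewrite mul0r; exact: in_span0.
- by rewrite mulrDl; exact: in_spanD.
- by rewrite -scalerAl; exact: in_spanZ.
Qed.

Definition aquot_mul (q r : aquot) : aquot := api (repr q * repr r).

Lemma aquot_mul_pi v w : aquot_mul (api v) (api w) = api (v * w).
Proof.
apply/lpiE; set v' := repr _; set w' := repr _.
have -> : v' * w' - v * w = (v' - v) * w' + v * (w' - w).
  by rewrite mulrBl mulrBr addrA subrK.
apply: in_spanD.
  by apply: in_ideal_mulr; apply/lpiE; exact: lpi_repr.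
by apply: in_ideal_mull; apply/lpiE; exact: lpi_repr.
Qed.

Lemma api_surj (q : aquot) : {v | api v = q}.
Proof. exact: lpi_surj. Qed.

Lemma apiD v w : api (v + w) = api v + api w.
Proof. exact: lpiD. Qed.

Fact aquot_mulA : associative aquot_mul.
Proof.
move=> q r s; case: (api_surj q) => x <-; case: (api_surj r) => y <-.
by case: (api_surj s) => z <-; rewrite !aquot_mul_pi mulrA.
Qed.

Fact aquot_mul1 : left_id (api 1) aquot_mul.
Proof. by move=> q; case: (api_surj q) => x <-; rewrite aquot_mul_pi mul1r. Qed.

Fact aquot_1mul : right_id (api 1) aquot_mul.
Proof. by move=> q; case: (api_surj q) => x <-; rewrite aquot_mul_pi mulr1. Qed.

Fact aquot_mulDl : left_distributive aquot_mul +%R.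
Proof.
move=> q r s; case: (api_surj q) => x <-; case: (api_surj r) => y <-.
by case: (api_surj s) => z <-; rewrite -apiD !aquot_mul_pi mulrDl apiD.
Qed.

Fact aquot_mulDr : right_distributive aquot_mul +%R.
Proof.
move=> q r s; case: (api_surj q) => x <-; case: (api_surj r) => y <-.
by case: (api_surj s) => z <-; rewrite -apiD !aquot_mul_pi mulrDr apiD.
Qed.

HB.instance Definition _ := GRing.Zmodule_isPzRing.Build aquot
  aquot_mulA aquot_mul1 aquot_1mul aquot_mulDl aquot_mulDr.

Lemma apiM v w : api (v * w) = api v * api w.
Proof. by rewrite -aquot_mul_pi. Qed.

Lemma api1 : api 1 = 1. Proof. by []. Qed.

Lemma apiZ c v : api (c *: v) = c *: api v.
Proof. exact: linearZ. Qed.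

Lemma apiE v w : api v = api w <-> in_span two_sided (v - w).
Proof. exact: lpiE. Qed.

Fact aquot_scaleAl (c : k) (q r : aquot) : c *: (q * r) = (c *: q) * r.
Proof.
case: (api_surj q) => x <-; case: (api_surj r) => y <-.
by rewrite -apiM -!apiZ -apiM scalerAl.
Qed.

Fact aquot_scaleAr (c : k) (q r : aquot) : c *: (q * r) = q * (c *: r).
Proof.
case: (api_surj q) => x <-; case: (api_surj r) => y <-.
by rewrite -apiM -!apiZ -apiM scalerAr.
Qed.

(* A character of [A] killing the relators shows that the quotient is not
   the zero ring. *)
Lemma aquot_neq0 (S : nzRingType) (f : {rmorphism A -> S})
    (fZ : forall c v, f v = 0 -> f (c *: v) = 0) :
  (forall r, R r -> f r = 0) -> (1 : aquot) != 0.
Proof.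
move=> fR; apply/eqP; rewrite -api1 -(linear0 (@lpi k A two_sided)).
move/lpiE; rewrite subr0 => h.
have : f 1 = 0.
  elim: h => [v [a [r [b [Rr ->]]]] | | v w _ h1 _ h2 | c v _ h].
  - by rewrite !rmorphM (fR r Rr) mulr0 mul0r.
  - exact: rmorph0.
  - by rewrite rmorphD h1 h2 addr0.
  - exact: fZ.
by apply/eqP; rewrite rmorph1 oner_eq0.
Qed.

End AlgebraQuotient.

Section TensorProduct.
Variables (k : fieldType) (A B : lmodType k).

Inductive bilinear_relator : {malg k[(A * B)%type]} -> Prop :=
| bilinearDl a a' b :
    bilinear_relator (<< (a + a', b) >> - << (a, b) >> - << (a', b) >>)
| bilinearDr a b b' :
    bilinear_relator (<< (a, b + b') >> - << (a, b) >> - << (a, b') >>)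
| bilinearZl (c : k) a b : bilinear_relator (<< (c *: a, b) >> - c *: << (a, b) >>)
| bilinearZr (c : k) a b : bilinear_relator (<< (a, c *: b) >> - c *: << (a, b) >>).

Definition tensor := lquot bilinear_relator.

HB.instance Definition _ := GRing.Lmodule.on tensor.

Definition pure (a : A) (b : B) : tensor := lpi bilinear_relator << (a, b) >>.

Lemma pureDl a a' b : pure (a + a') b = pure a b + pure a' b.
Proof.
rewrite /pure -lpiD; apply/lpiE; rewrite opprD addrA.
exact/in_span_gen/bilinearDl.
Qed.

Lemma pureDr a b b' : pure a (b + b') = pure a b + pure a b'.
Proof.
rewrite /pure -lpiD; apply/lpiE; rewrite opprD addrA.
exact/in_span_gen/bilinearDr.
Qed.

Lemma pureZl c a b : pure (c *: a) b = c *: pure a b.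
Proof. by rewrite /pure -linearZ; apply/lpiE/in_span_gen/bilinearZl. Qed.

Lemma pureZr c a b : pure a (c *: b) = c *: pure a b.
Proof. by rewrite /pure -linearZ; apply/lpiE/in_span_gen/bilinearZr. Qed.

Section Lift.
Variables (W : lmodType k) (f : A -> B -> W).

Definition free_ext (w : {malg k[(A * B)%type]}) : W :=
  \sum_(ab <- monalg.msupp w) monalg.mcoeff ab w *: f ab.1 ab.2.

(* The linear map [a (x) b |-> f a b]; meaningful only for bilinear [f], see
   [tlift_pure]. *)
Definition tlift (t : tensor) : W := free_ext (repr t).

Lemma free_extE (d : {fset (A * B)%type}) w : (monalg.msupp w `<=` d)%fset ->
  free_ext w = \sum_(ab <- d) monalg.mcoeff ab w *: f ab.1 ab.2.
Proof.
move=> le; rewrite /free_ext (big_fset_incl _ le) // => x xd /mcoeff_outdom ->.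
by rewrite scale0r.
Qed.

Lemma free_ext_linear : linear free_ext.
Proof.
move=> c v w;
  set d := (monalg.msupp (c *: v + w) `|` (monalg.msupp v `|` monalg.msupp w))%fset.
rewrite (@free_extE d) ?fsubsetUl // (@free_extE d v); last first.
  by rewrite /d fsetUCA fsubsetUl.
rewrite (@free_extE d w); last by rewrite /d fsetUA fsubsetUr.
rewrite scaler_sumr -big_split /=; apply: eq_bigr => ab _.
by rewrite mcoeffD mcoeffZ scalerDl scalerA.
Qed.

Lemma free_extU a b : free_ext << (a, b) >> = f a b.
Proof. by rewrite (free_extE msuppU_le) big_seq_fset1 mcoeffUU scale1r. Qed.

Hypothesis fl : forall b, linear (f^~ b).
Hypothesis fr : forall a, linear (f a).

Lemma free_ext_span v : in_span bilinear_relator v -> free_ext v = 0.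
Proof.
pose F : {linear {malg k[(A * B)%type]} -> W} :=
  HB.pack free_ext (GRing.isLinear.Build k _ W *:%R free_ext free_ext_linear).
rewrite -[free_ext]/(F : _ -> _).
have flD a a' b : f (a + a') b = f a b + f a' b.
  by have := fl b 1 a a'; rewrite !scale1r.
have frD a b b' : f a (b + b') = f a b + f a b'.
  by have := fr a 1 b b'; rewrite !scale1r.
have fl0 b : f 0 b = 0 by apply: (addrI (f 0 b)); rewrite -flD !addr0.
have fr0 a : f a 0 = 0 by apply: (addrI (f a 0)); rewrite -frD !addr0.
elim=> [w [a a' b|a b b'|c a b|c a b] | | v1 v2 _ h1 _ h2 | c w _ h].
- by rewrite !linearB /= !free_extU flD addrAC addrK subrr.
- by rewrite !linearB /= !free_extU frD addrAC addrK subrr.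
- by rewrite linearB linearZ /= !free_extU -[c *: a]addr0 fl fl0 addr0 subrr.
- by rewrite linearB linearZ /= !free_extU -[c *: b]addr0 fr fr0 addr0 subrr.
- exact: linear0.
- by rewrite linearD h1 h2 addr0.
- by rewrite linearZ h; apply: scaler0.
Qed.

Lemma tlift_lpi v : tlift (lpi bilinear_relator v) = free_ext v.
Proof.
apply/eqP; rewrite -subr_eq0; apply/eqP.
rewrite -scaleN1r addrC -free_ext_linear scaleN1r addrC.
by apply: free_ext_span; apply/lpiE; exact: lpi_repr.
Qed.

Lemma tlift_pure a b : tlift (pure a b) = f a b.
Proof. by rewrite tlift_lpi free_extU. Qed.

Lemma tlift_linear : linear tlift.
Proof.
move=> c s t; case: (lpi_surj s) => v <-; case: (lpi_surj t) => w <-.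
by rewrite -linearP !tlift_lpi free_ext_linear.
Qed.

End Lift.
End TensorProduct.

Section Subalgebra.
Variables (k : fieldType) (A : algType k) (S : A -> Prop).

Inductive in_subalg : A -> Prop :=
| in_subalg_gen a of S a : in_subalg a
| in_subalg1 : in_subalg 1
| in_subalgZ (c : k) a of in_subalg a : in_subalg (c *: a)
| in_subalgD a b of in_subalg a & in_subalg b : in_subalg (a + b)
| in_subalgM a b of in_subalg a & in_subalg b : in_subalg (a * b).

Definition subalg_of : {pred A} := fun a => `[< in_subalg a >].

Lemma subalg_ofP a : reflect (in_subalg a) (a \in subalg_of).
Proof. exact: asboolP. Qed.

Fact subalg_of_closed : GRing.subsemialg_closed subalg_of.
Proof.
split; first exact/subalg_ofP/in_subalg1.
- split; first by apply/subalg_ofP; rewrite -(scale0r 1); exact/in_subalgZ/in_subalg1.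
  by move=> a b /subalg_ofP ha /subalg_ofP hb; apply/subalg_ofP/in_subalgD.
- by move=> c a /subalg_ofP ha; apply/subalg_ofP/in_subalgZ.
- by move=> a b /subalg_ofP ha /subalg_ofP hb; apply/subalg_ofP/in_subalgM.
Qed.

HB.instance Definition _ := GRing.isSubalgClosed.Build k A subalg_of
  subalg_of_closed.

(* The subalgebra of [A] generated by [S], as an algebra in its own right. *)
Record subalg := Subalg { subalg_val : A; _ : subalg_val \in subalg_of }.

HB.instance Definition _ := [isSub for subalg_val].
HB.instance Definition _ := [Choice of subalg by <:].
HB.instance Definition _ := [SubChoice_isSubAlgebra of subalg by <:].

Definition subalg_incl (a : subalg) : A := val a.

Fact subalg_incl_linear : linear subalg_incl.
Proof. by []. Qed.

Fact subalg_incl_monoid : monoid_morphism subalg_incl.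
Proof. by []. Qed.

HB.instance Definition _ :=
  GRing.isLinear.Build k subalg A *:%R subalg_incl subalg_incl_linear.
HB.instance Definition _ :=
  GRing.isMonoidMorphism.Build subalg A subalg_incl subalg_incl_monoid.

End Subalgebra.

Arguments subalg_incl {k A} S a.

Section HopfSuperalgebras.
Variable k : fieldType.

Definition tmap (A A' B B' : lmodType k) (f : A -> A') (g : B -> B') :
    tensor A B -> tensor A' B' :=
  tlift (fun a b => pure (f a) (g b)).

Definition tassoc (A B C : lmodType k) :
    tensor (tensor A B) C -> tensor A (tensor B C) :=
  tlift (fun t c => tlift (fun a b => pure a (pure b c)) t).

(* The product of the tensor square of a superalgebra, [parity_part i a] being the
   component of parity [i] of [a]: for homogeneous [b] and [c],
   (a (x) b) (c (x) d) = (-1)^(|b||c|) ac (x) bd. *)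
Definition super_mul (A : algType k) (parity_part : bool -> A -> A)
    (s t : tensor A A) : tensor A A :=
  tlift (fun a b => tlift (fun c d =>
    \sum_(i : bool) \sum_(j : bool)
      (-1) ^+ (i && j) *: pure (a * parity_part j c) (parity_part i b * d)) t) s.

Definition tensor_parity_part (A : lmodType k)
    (parity_part : bool -> A -> A) (i : bool) (t : tensor A A) : tensor A A :=
  \sum_(j : bool) tmap (parity_part j) (parity_part (i (+) j)) t.

(* A Z/2-grading is given by its two component projections, [false] being the
   even part. *)
Record hopf_superalgebra (A : algType k) := HopfSuperalgebra {
  parity_part : bool -> {linear A -> A};
  comul : {linear A -> tensor A A};
  counit : {scalar A};
  antipode : {linear A -> A};
  parity_part_sum : forall a, parity_part false a + parity_part true a = a;
  parity_part_proj : forall i j a,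
    parity_part i (parity_part j a) = if i == j then parity_part j a else 0;
  parity_part_one : parity_part false 1 = 1;
  parity_part_mul : forall i j a b,
    parity_part (i (+) j) (parity_part i a * parity_part j b)
    = parity_part i a * parity_part j b;
  comul_parity_part : forall i a,
    comul (parity_part i a) = tensor_parity_part parity_part i (comul a);
  counit_odd : forall a, counit (parity_part true a) = 0;
  antipode_parity_part : forall i a,
    antipode (parity_part i a) = parity_part i (antipode a);
  comul_one : comul 1 = pure 1 1;
  comul_mul : forall a b,
    comul (a * b) = super_mul parity_part (comul a) (comul b);
  counit_one : counit 1 = 1;
  counit_mul : forall a b, counit (a * b) = counit a * counit b;
  comul_assoc : forall a,
    tassoc (tmap comul idfun (comul a)) = tmap idfun comul (comul a);
  counit_left : forall a, tlift (fun b c => counit b *: c) (comul a) = a;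
  counit_right : forall a, tlift (fun b c => counit c *: b) (comul a) = a;
  antipode_left : forall a,
    tlift (fun b c => antipode b * c) (comul a) = counit a *: 1;
  antipode_right : forall a,
    tlift (fun b c => b * antipode c) (comul a) = counit a *: 1
}.

(* An ordinary Hopf algebra is a Hopf superalgebra concentrated in degree 0. *)
Definition purely_even (A : algType k) (HA : hopf_superalgebra A) : Prop :=
  forall a, parity_part HA false a = a.

Definition hopf_morphism (A B : algType k) (HA : hopf_superalgebra A)
    (HB : hopf_superalgebra B) (f : {lrmorphism A -> B}) : Prop :=
  [/\ forall i a, f (parity_part HA i a) = parity_part HB i (f a),
      forall a, comul HB (f a) = tmap f f (comul HA a),
      forall a, counit HB (f a) = counit HA a
    & forall a, antipode HB (f a) = f (antipode HA a)].

Definition hopf_subalgebra (A : algType k) (HA : hopf_superalgebra A)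
    (S : A -> Prop) : Prop :=
  [/\ forall i z, z \in subalg_of S -> parity_part HA i z \in subalg_of S,
      forall z, z \in subalg_of S ->
        exists t : tensor (subalg S) (subalg S), comul HA z = tmap val val t
    & forall z, z \in subalg_of S -> antipode HA z \in subalg_of S].

End HopfSuperalgebras.

Section FunctionAlgebra.
Variables (k : fieldType) (G : groupType).

Definition fun_algebra := G -> k.

HB.instance Definition _ := GRing.PzRing.on fun_algebra.

Fact fun_algebra_neq0 : (1 : fun_algebra) != 0.
Proof.
by apply/eqP => /(congr1 (fun f : fun_algebra => f 1%g)) /eqP; rewrite oner_eq0.
Qed.

HB.instance Definition _ :=
  GRing.PzSemiRing_isNonZero.Build fun_algebra fun_algebra_neq0.

HB.instance Definition _ := GRing.Lmodule.copy fun_algebra (G -> k^o).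

Fact fun_algebra_scaleAl (c : k) (f g : fun_algebra) :
  c *: (f * g) = (c *: f) * g.
Proof. by apply/funext => x; exact: mulrA. Qed.

HB.instance Definition _ :=
  GRing.LSemiModule_isLSemiAlgebra.Build k fun_algebra fun_algebra_scaleAl.

Fact fun_algebra_scaleAr (c : k) (f g : fun_algebra) :
  c *: (f * g) = f * (c *: g).
Proof. by apply/funext => x; exact: mulrCA. Qed.

HB.instance Definition _ :=
  GRing.LSemiAlgebra_isSemiAlgebra.Build k fun_algebra fun_algebra_scaleAr.

Variable coord : fun_algebra -> Prop.

(* The regular functions on an affine variety over an algebraically closed
   field: the polynomials in the given coordinate functions. *)
Definition regular := subalg coord.

HB.instance Definition _ := GRing.Algebra.on regular.

Definition eval2 (g h : G) (t : tensor regular regular) : k :=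
  tlift (W := k^o) (fun u v : regular => val u g * val v h) t.

(* The Hopf algebra structure dual to the group law, O(G) (x) O(G) being
   identified with the regular functions on G x G. *)
Definition coordinate_hopf (H : hopf_superalgebra regular) : Prop :=
  [/\ purely_even H,
      forall f g h, eval2 g h (comul H f) = val f (g * h)%g,
      forall f, counit H f = val f 1%g
    & forall f g, val (antipode H f) g = val f (g^-1)%g].

End FunctionAlgebra.

Section SemidirectProduct.
Variables (V : zmodType) (G : groupType) (act : G -> V -> V).

Definition linear_action : Prop :=
  [/\ forall v, act 1%g v = v,
      forall g h v, act (g * h)%g v = act g (act h v)
    & forall g v w, act g (v + w) = act g v + act g w].

Definition semidirect of linear_action := (V * G)%type.

Variable actP : linear_action.
Local Notation T := (semidirect actP).

HB.instance Definition _ := Choice.on T.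

Definition sd_one : T := (0, 1%g).
Definition sd_mul (x y : T) : T := (x.1 + act x.2 y.1, (x.2 * y.2)%g).
Definition sd_inv (x : T) : T := (act (x.2^-1)%g (- x.1), (x.2^-1)%g).

Let act0 g : act g 0 = 0.
Proof. by have [_ _ D] := actP; apply: (addrI (act g 0)); rewrite -D !addr0. Qed.

Fact sd_mulA : associative sd_mul.
Proof.
have [_ M D] := actP => x y z.
by rewrite /sd_mul /= D M addrA mulgA.
Qed.

Fact sd_mul1 : left_id sd_one sd_mul.
Proof. have [h _ _] := actP => -[v g]; by rewrite /sd_mul /= h add0r mul1g. Qed.

Fact sd_1mul : right_id sd_one sd_mul.
Proof. by case=> v g; rewrite /sd_mul /= act0 addr0 mulg1. Qed.

Fact sd_mulV : left_inverse sd_one sd_inv sd_mul.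
Proof.
have [_ _ D] := actP => -[v g]; by rewrite /sd_mul /= -D addNr act0 mulVg.
Qed.

Fact sd_Vmul : right_inverse sd_one sd_inv sd_mul.
Proof.
have [h M _] := actP => -[v g]; by rewrite /sd_mul /= -M mulgV h addrN.
Qed.

HB.instance Definition _ :=
  isGroup.Build T sd_mulA sd_mul1 sd_1mul sd_mulV sd_Vmul.

End SemidirectProduct.

Section GroupB.
Variable k : fieldType.

Record Gm := MkGm { gm_val : k; _ : gm_val != 0 }.

HB.instance Definition _ := [isSub for gm_val].
HB.instance Definition _ := [Choice of Gm by <:].

Definition gm_one : Gm := MkGm (oner_neq0 k).
Definition gm_mul (x y : Gm) : Gm := MkGm (mulf_neq0 (valP x) (valP y)).
Definition gm_inv (x : Gm) : Gm := MkGm (invr_neq0 (valP x)).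

Fact gm_mulA : associative gm_mul.
Proof. by move=> x y z; apply: val_inj; exact: mulrA. Qed.
Fact gm_mul1 : left_id gm_one gm_mul.
Proof. by move=> x; apply: val_inj; exact: mul1r. Qed.
Fact gm_1mul : right_id gm_one gm_mul.
Proof. by move=> x; apply: val_inj; exact: mulr1. Qed.
Fact gm_mulV : left_inverse gm_one gm_inv gm_mul.
Proof. by move=> x; apply: val_inj; exact: (mulVf (valP x)). Qed.
Fact gm_Vmul : right_inverse gm_one gm_inv gm_mul.
Proof. by move=> x; apply: val_inj; exact: (mulfV (valP x)). Qed.

HB.instance Definition _ :=
  isGroup.Build Gm gm_mulA gm_mul1 gm_1mul gm_mulV gm_Vmul.

Definition gm_act (l : Gm) (r : k * k) : k * k :=
  (gm_val l ^+ 2 * r.1, gm_val l ^+ 2 * r.2).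

Fact gm_actP : linear_action gm_act.
Proof.
split=> [[r1 r2]|l m [r1 r2]|l [r1 r2] [s1 s2]]; rewrite /gm_act /=.
- by rewrite expr1n !mul1r.
- by rewrite exprMn !mulrA.
- by congr (_, _); exact: mulrDr.
Qed.

Definition unitriangular (M : 'M[k]_3) : bool :=
  [forall i : 'I_3, forall j : 'I_3, (j <= i)%N ==> (M i j == (i == j)%:R)].

Record H3 := MkH3 { h3_val : 'M[k]_3; _ : unitriangular h3_val }.

HB.instance Definition _ := [isSub for h3_val].
HB.instance Definition _ := [Choice of H3 by <:].

Lemma unitriangularP (M : 'M[k]_3) :
  reflect (forall i j : 'I_3, (j <= i)%N -> M i j = (i == j)%:R) (unitriangular M).
Proof.
apply: (iffP forallP) => [h i j le|h i].
  by move/forallP: (h i) => /(_ j) /implyP /(_ le) /eqP.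
by apply/forallP => j; apply/implyP => le; apply/eqP; exact: h.
Qed.

Fact unitriangular1 : unitriangular 1%:M.
Proof. by apply/unitriangularP => i j _; rewrite mxE. Qed.

Fact unitriangularM (M N : 'M[k]_3) :
  unitriangular M -> unitriangular N -> unitriangular (M *m N).
Proof.
move=> /unitriangularP hM /unitriangularP hN; apply/unitriangularP => i j le.
rewrite mxE (bigD1 i) //= hM // eqxx mul1r big1 ?addr0 ?hN // => l nli.
have [lt|lt|/val_inj e] := ltngtP l i.
- by rewrite hM 1?ltnW // eq_sym (negbTE nli) mul0r.
- have jl : (j < l)%N := leq_ltn_trans le lt.
  by rewrite (hN l j (ltnW jl)) -val_eqE /= gtn_eqF // mulr0.
- by rewrite e eqxx in nli.
Qed.

(* (1 + N)^-1 = 1 - N + N^2 since N^3 = 0. *)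
Definition unitriangular_inv (M : 'M[k]_3) : 'M[k]_3 :=
  1%:M - (M - 1%:M) + (M - 1%:M) *m (M - 1%:M).

Fact nilpotent_mulV (A : 'M[k]_3) : A *m A *m A = 0 ->
  (1%:M - A + A *m A) *m (1%:M + A) = 1%:M.
Proof.
move=> A3; rewrite mulmxDr mulmx1 !mulmxDl A3 mul1mx mulNmx addr0.
by rewrite addrACA addrN addr0 subrK.
Qed.

Fact nilpotent_Vmul (A : 'M[k]_3) : A *m A *m A = 0 ->
  (1%:M + A) *m (1%:M - A + A *m A) = 1%:M.
Proof.
move=> A3; rewrite mulmxDl mul1mx !mulmxDr mulmxA A3 mulmx1 mulmxN addr0.
by rewrite addrACA addrN addr0 subrK.
Qed.

Section Unipotent.
Variable M : 'M[k]_3.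
Hypothesis hM : unitriangular M.
Let N : 'M[k]_3 := M - 1%:M.

Let N0 (i j : 'I_3) : (j <= i)%N -> N i j = 0.
Proof. by move=> le; rewrite !mxE (unitriangularP _ hM) // subrr. Qed.

Fact unitriangularV : unitriangular (unitriangular_inv M).
Proof.
apply/unitriangularP => i j le.
rewrite /unitriangular_inv -/N 3!mxE [X in _ + X + _]mxE N0 // subr0.
rewrite [X in _ + X]mxE big1 ?addr0 ?mxE // => l _.
have [lt|lt] := leqP l i; first by rewrite N0 // mul0r.
by rewrite [N l j]N0 ?mulr0 // (leq_trans le) // ltnW.
Qed.

Let N3 : N *m N *m N = 0.
Proof.
apply/matrixP => i j; rewrite !mxE big1 // => l _.
have [le|lt] := leqP j l; first by rewrite [N l j]N0 // mulr0.
rewrite mxE big1 ?mul0r // => m _.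
have [le|lt'] := leqP l m; first by rewrite [N m l]N0 // mulr0.
have [le|lt''] := leqP m i; first by rewrite N0 // mul0r.
by have := ltn_ord j; rewrite ltnNge (leq_trans _ lt) // ltnS
  (leq_trans _ lt') // ltnS (leq_trans _ lt'').
Qed.

Let MN : M = 1%:M + N. Proof. by rewrite addrC subrK. Qed.

Fact unitriangular_mulV : unitriangular_inv M *m M = 1%:M.
Proof. by rewrite {2}MN; exact: nilpotent_mulV. Qed.

Fact unitriangular_Vmul : M *m unitriangular_inv M = 1%:M.
Proof. by rewrite {1}MN; exact: nilpotent_Vmul. Qed.

End Unipotent.

Definition h3_one : H3 := MkH3 unitriangular1.
Definition h3_mul (x y : H3) : H3 := MkH3 (unitriangularM (valP x) (valP y)).
Definition h3_inv (x : H3) : H3 := MkH3 (unitriangularV (valP x)).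

Fact h3_mulA : associative h3_mul.
Proof. by move=> x y z; apply: val_inj; exact: mulmxA. Qed.
Fact h3_mul1 : left_id h3_one h3_mul.
Proof. by move=> x; apply: val_inj; exact: mul1mx. Qed.
Fact h3_1mul : right_id h3_one h3_mul.
Proof. by move=> x; apply: val_inj; exact: mulmx1. Qed.
Fact h3_mulV : left_inverse h3_one h3_inv h3_mul.
Proof. by move=> x; apply: val_inj; exact: unitriangular_mulV (valP x). Qed.
Fact h3_Vmul : right_inverse h3_one h3_inv h3_mul.
Proof. by move=> x; apply: val_inj; exact: unitriangular_Vmul (valP x). Qed.

HB.instance Definition _ :=
  isGroup.Build H3 h3_mulA h3_mul1 h3_1mul h3_mulV h3_Vmul.

Definition groupB := (semidirect gm_actP * H3)%type.

HB.instance Definition _ := Group.on groupB.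

Inductive coordB : fun_algebra k groupB -> Prop :=
| coordB_r1 : coordB (fun b => b.1.1.1)
| coordB_r2 : coordB (fun b => b.1.1.2)
| coordB_l : coordB (fun b => val b.1.2)
| coordB_linv : coordB (fun b => (val b.1.2)^-1)
| coordB_h (i j : 'I_3) : coordB (fun b => val b.2 i j).

End GroupB.

Arguments coordB k _ : clear implicits.

Section LaurentPolynomials.
Variable k : fieldType.

Definition rational_functions := {fraction mpoly 6 k}.

HB.instance Definition _ := GRing.Field.on rational_functions.

Definition rf_poly (p : mpoly 6 k) : rational_functions := tofrac p.

Definition rf_scale (c : k) (q : rational_functions) : rational_functions :=
  rf_poly (mpoly.mpolyC 6 c) * q.

Fact rf_scaleA a b q : rf_scale a (rf_scale b q) = rf_scale (a * b) q.
Proof. by rewrite /rf_scale /rf_poly mulrA -tofracM -mpoly.mpolyCM. Qed.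
Fact rf_scale1 : left_id 1 rf_scale.
Proof. by move=> q; rewrite /rf_scale /rf_poly mpoly.mpolyC1 tofrac1 mul1r. Qed.
Fact rf_scaleDr : right_distributive rf_scale +%R.
Proof. by move=> a q r; exact: mulrDr. Qed.
Fact rf_scaleDl q : {morph rf_scale^~ q : a b / a + b}.
Proof. by move=> a b; rewrite /rf_scale /rf_poly mpoly.mpolyCD tofracD mulrDl. Qed.

HB.instance Definition _ := GRing.Zmodule_isLmodule.Build k rational_functions
  rf_scaleA rf_scale1 rf_scaleDr rf_scaleDl.

Fact rf_scaleAl (c : k) (q r : rational_functions) : c *: (q * r) = (c *: q) * r.
Proof. exact: mulrA. Qed.

HB.instance Definition _ :=
  GRing.LSemiModule_isLSemiAlgebra.Build k rational_functions rf_scaleAl.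

Fact rf_scaleAr (c : k) (q r : rational_functions) : c *: (q * r) = q * (c *: r).
Proof. exact: mulrCA. Qed.

HB.instance Definition _ :=
  GRing.LSemiAlgebra_isSemiAlgebra.Build k rational_functions rf_scaleAr.

(* The variable of index 0 is T, the others are X_1, ..., X_5. *)
Definition rf_var (i : 'I_6) : rational_functions := rf_poly (mpolyX k (mnm1 i)).

Inductive laurent_gen : rational_functions -> Prop :=
| laurent_var i : laurent_gen (rf_var i)
| laurent_inv : laurent_gen (rf_var ord0)^-1.

(* k[T^(+-1), X_1, ..., X_5] inside k(T, X_1, ..., X_5). *)
Definition laurent := subalg laurent_gen.

HB.instance Definition _ := GRing.Algebra.on laurent.

End LaurentPolynomials.

Inductive generator :=
  Gen_x1 | Gen_x2 | Gen_u1 | Gen_u2 | Gen_g | Gen_ginv | Gen_zeta.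

HB.instance Definition _ := gen_eqMixin generator.
HB.instance Definition _ := gen_choiceMixin generator.

Definition generator_odd (x : generator) : bool :=
  if x is (Gen_x1 | Gen_x2 | Gen_u1 | Gen_u2) then true else false.

Section FreeAlgebra.
Variables (k : fieldType) (I : choiceType).

Definition free_algebra := {malg k[{fmonom I}]}.

HB.instance Definition _ := GRing.Lalgebra.on free_algebra.

Fact free_algebra_scaleAr (c : k) (v w : free_algebra) :
  c *: (v * w) = v * (c *: w).
Proof.
suff comm : v * malgC c = malgC c * v by rewrite -!mul_malgC !mulrA comm.
rewrite !malgM_def fgmulgU fgmulUg; apply: eq_bigr => m _.
by rewrite mul1m mulm1 mulrC.
Qed.

HB.instance Definition _ :=
  GRing.LSemiAlgebra_isSemiAlgebra.Build k free_algebra free_algebra_scaleAr.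

Definition free_var (i : I) : free_algebra := << fmu i >>.

Section Eval.
Variable e : I -> k.

Definition monomial_eval (w : {fmonom I}) : k := \prod_(i <- fmonom_val w) e i.

Fact monomial_eval_morph : mmorphism monomial_eval.
Proof.
split=> [v w|]; last by rewrite /monomial_eval fm1 big_nil.
by rewrite /monomial_eval fmM big_cat.
Qed.

HB.instance Definition _ :=
  isMultiplicative.Build {fmonom I} k monomial_eval monomial_eval_morph.

Definition free_eval : {rmorphism free_algebra -> k} :=
  monalg.mmap idfun monomial_eval.

Lemma free_evalZ c (v : free_algebra) : free_eval (c *: v) = c * free_eval v.
Proof. exact: mmapZ. Qed.

Lemma free_eval_var i : free_eval (free_var i) = e i.
Proof.
by rewrite /free_eval /= mmapU mul1r /monomial_eval fmU big_seq1.
Qed.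

End Eval.
End FreeAlgebra.

Section Relations.
Variables (A : nzRingType) (x1 x2 u1 u2 g g' zeta : A).
Local Notation x21 := (x2 * x1 + x1 * x2).
Local Notation u21 := (u1 * u2 + u2 * u1).

Inductive relation : A -> A -> Prop :=
| rel_x1x1 : relation (x1 ^+ 2) 0
| rel_x2x21 : relation (x2 * x21) (x21 * x2 + x1 * x21)
| rel_u1u1 : relation (u1 ^+ 2) 0
| rel_u2u21 : relation (u2 * u21) (u21 * u2 + u1 * u21)
| rel_u1zeta : relation (u1 * zeta) (zeta * u1 + u1)
| rel_u2zeta : relation (u2 * zeta) (zeta * u2 + u2)
| rel_zetax1 : relation (zeta * x1) (x1 * zeta + x1)
| rel_zetax2 : relation (zeta * x2) (x2 * zeta + x2)
| rel_gg' : relation (g * g') 1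
| rel_g'g : relation (g' * g) 1
| rel_zetag : relation (zeta * g) (g * zeta)
| rel_gx1 : relation (g * x1) (x1 * g)
| rel_gx2 : relation (g * x2) (x2 * g - x1 * g)
| rel_u1g : relation (u1 * g) (g * u1)
| rel_u2g : relation (u2 * g) (g * u2 - g * u1)
| rel_u1x1 : relation (u1 * x1) (- (x1 * u1))
| rel_u1x2 : relation (u1 * x2) (- (x2 * u1) + (1 - g))
| rel_u2x1 : relation (u2 * x1) (- (x1 * u2) + (1 - g) + x1 * u1)
| rel_u2x2 : relation (u2 * x2) (- (x2 * u2) + g * zeta + x2 * u1).

Lemma relation_eval (S : comNzRingType) (f : {rmorphism A -> S}) l r :
  f x1 = 0 -> f x2 = 0 -> f u1 = 0 -> f u2 = 0 ->
  f g = 1 -> f g' = 1 -> f zeta = 0 -> relation l r -> f l = f r.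
Proof.
move=> f1 f2 f3 f4 f5 f6 f7.
by case; rewrite ?(rmorphB, rmorphD, rmorphN, expr2, rmorphM, rmorph1,
  rmorph0, f1, f2, f3, f4, f5, f6, f7)
  ?(mul0r, mulr0, mul1r, mulr1, addr0, subr0, oppr0, subrr).
Qed.

End Relations.

Section Dtilde.
Variable k : fieldType.

Let F := free_algebra k generator.
Let v : generator -> F := @free_var k generator.

Inductive relator : F -> Prop :=
| relator_of l r of relation (v Gen_x1) (v Gen_x2) (v Gen_u1) (v Gen_u2)
                             (v Gen_g) (v Gen_ginv) (v Gen_zeta) l r :
    relator (l - r).

Definition Dtilde := aquot relator.

HB.instance Definition _ := GRing.PzRing.on Dtilde.
HB.instance Definition _ := GRing.Lmodule.on Dtilde.

Fact Dtilde_neq0 : (1 : Dtilde) != 0.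
Proof.
pose e x : k := if x is (Gen_g | Gen_ginv) then 1 else 0.
apply: (@aquot_neq0 _ _ _ _ (free_eval e)) => [c w h|_ [l r lr]].
  by rewrite free_evalZ h mulr0.
apply/eqP; rewrite rmorphB subr_eq0; apply/eqP.
by apply: relation_eval lr; exact: free_eval_var.
Qed.

HB.instance Definition _ := GRing.PzSemiRing_isNonZero.Build Dtilde Dtilde_neq0.
HB.instance Definition _ :=
  GRing.LSemiModule_isLSemiAlgebra.Build k Dtilde (@aquot_scaleAl _ _ relator).
HB.instance Definition _ :=
  GRing.LSemiAlgebra_isSemiAlgebra.Build k Dtilde (@aquot_scaleAr _ _ relator).

Definition Dgen (x : generator) : Dtilde := api relator (v x).

Local Notation x1 := (Dgen Gen_x1).
Local Notation x2 := (Dgen Gen_x2).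
Local Notation u1 := (Dgen Gen_u1).
Local Notation u2 := (Dgen Gen_u2).
Local Notation g := (Dgen Gen_g).
Local Notation zeta := (Dgen Gen_zeta).

(* As [Dtilde] is generated by these elements, their parities and coproducts
   determine the Hopf superalgebra structure. *)
Definition Dtilde_hopf (H : hopf_superalgebra Dtilde) : Prop :=
  [/\ forall x, parity_part H (generator_odd x) (Dgen x) = Dgen x,
      comul H g = pure g g,
      comul H zeta = pure zeta 1 + pure 1 zeta
        /\ comul H u1 = pure u1 1 + pure 1 u1,
      comul H x1 = pure x1 1 + pure g x1
        /\ comul H x2 = pure x2 1 + pure g x2
    & comul H u2 = pure u2 1 + pure 1 u2 - pure zeta u1].

Variable p : nat.

Inductive Z_gen : Dtilde -> Prop :=
| Z_gen_x21 : Z_gen ((x2 * x1 + x1 * x2) ^+ p)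
| Z_gen_x2 : Z_gen (x2 ^+ (2 * p))
| Z_gen_u21 : Z_gen ((u1 * u2 + u2 * u1) ^+ p)
| Z_gen_u2 : Z_gen (u2 ^+ (2 * p))
| Z_gen_g : Z_gen (g ^+ p)
| Z_gen_ginv : Z_gen (Dgen Gen_ginv ^+ p)
| Z_gen_zeta : Z_gen (zeta ^+ p - zeta).

End Dtilde.

Arguments Z_gen k p _ : clear implicits.

(* Main.v *)
Require Import Defs.
From HB Require Import structures.
From mathcomp Require Import all_boot all_order all_algebra.
From mathcomp Require Import finmap boolp fraction monalg.
From mathcomp Require Import ring zify.

Set Implicit Arguments.
Unset Strict Implicit.
Unset Printing Implicit Defensive.

Import GRing.Theory Num.Theory Order.TTheory.
Local Open Scope ring_scope.

(** The algebra has a basis of ordered monomials in x1, x21, x2, g, zeta, u1, u21, u2 (with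
    x1 and u1 occurring at most once and g with integral exponent).  Indeed, once x21 and
    u21 are added to the generators, the relations become quadratic rewriting rules that
    terminate and whose overlaps resolve; the diamond lemma for such rules is proved in
    general and yields the basis [irr_word_basis].

    In characteristic p the generators of Z are central.  For an element a,
    bracketing with a ^ p is the p-th iterate of bracketing with a, and the iterated
    brackets with x21, u21, g, x2 ^ 2 and u2 ^ 2 vanish, either after two or three steps, or
    because they are multiplied by a product of p consecutive integers; for zeta one uses
    that z ^ p - z is invariant under z -> z + 1.  Dividing the exponents of the basis by
    those of the central elements (for zeta, dividing polynomials by z ^ p - z) shows that
    the central monomials are linearly independent and that the algebra is free over their
    span, with the remainders as a finite module basis [free_over_center].  The Laurent
    polynomials and the regular functions on the group have bases of monomials that multiply
    in the same way, since monomials are independent as functions over an infinite field;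
    this gives the two isomorphisms of algebras ([monomial_basis_iso]).

    It remains to compute coproducts.  In the graded tensor square, the coproducts of x21 and
    u21 are sums of commuting terms, one of which squares to zero, so that their p-th powers
    are clear.  Those of x2 ^ 2 and u2 ^ 2 are sums of noncommuting terms, which obey
    [a, T] = T ^ 2 and [a, B] = 2 T B; the coefficients that arise in (a + B) ^ p are Lah
    numbers, all divisible by p except the last ([expp_add_homogeneous]).  For
    u2 ^ 2 there is a further term zeta (x) u21, whose contribution to the p-th power is
    (zeta ^ p - zeta) (x) u21 ^ p because the product of zeta - i over i < p is
    zeta ^ p - zeta ([expp_sub_falling]).  The resulting formulas are the group law of the
    semidirect product and of the Heisenberg group in coordinates ([comul_Zgen],
    [comul_coordinate]).

    A Hopf algebra structure on an algebra of functions on a group is determined by values at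
    points ([hopf_of_points]), and is thus carried to Z by the isomorphism with the
    regular functions.  The inclusion of Z respects coproducts on generators, hence
    everywhere; that it respects counits and antipodes then follows from its injectivity and
    from the uniqueness of convolution inverses ([hopf_morphism_of_comul]). *)

(** * Linear extension from a basis *)

Section LinearExtension.
Variables (k : fieldType) (I : choiceType) (W : lmodType k) (F : I -> W).

Definition lin_ext_def (v : {malg k[I]}) : W :=
  \sum_(i <- monalg.msupp v) v@_i *: F i.

Fact lin_ext_key : unit. Proof. exact: tt. Qed.

(** Locked, as conversion would otherwise unfold the sum in the large quotient types below. *)
Definition lin_ext := locked_with lin_ext_key lin_ext_def.

Lemma lin_extE v : lin_ext v = \sum_(i <- monalg.msupp v) v@_i *: F i.
Proof. by rewrite /lin_ext unlock. Qed.

Lemma lin_extEw (d : {fset I}) v : (monalg.msupp v `<=` d)%fset ->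
  lin_ext v = \sum_(i <- d) v@_i *: F i.
Proof.
move=> le; rewrite lin_extE (big_fset_incl _ le) // => x xd /mcoeff_outdom ->.
by rewrite scale0r.
Qed.

Fact lin_ext_linear : linear lin_ext.
Proof.
move=> c v w.
pose d := (monalg.msupp (c *: v + w) `|` (monalg.msupp v `|` monalg.msupp w))%fset.
rewrite (@lin_extEw d) ?fsubsetUl // (@lin_extEw d v) ?(@lin_extEw d w);
  last 2 first.
- by rewrite /d fsetUA fsubsetUr.
- by rewrite /d fsetUCA fsubsetUl.
rewrite scaler_sumr -big_split /=; apply: eq_bigr => i _.
by rewrite mcoeffD mcoeffZ scalerDl scalerA.
Qed.

HB.instance Definition _ :=
  GRing.isLinear.Build k {malg k[I]} W *:%R lin_ext lin_ext_linear.

Lemma lin_extU i : lin_ext << i >> = F i.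
Proof. by rewrite (lin_extEw msuppU_le) big_seq_fset1 mcoeffUU scale1r. Qed.

End LinearExtension.

Section MalgTheory.
Variables (k : fieldType) (I : choiceType) (W : lmodType k).

Lemma malg_sum (v : {malg k[I]}) :
  v = \sum_(i <- monalg.msupp v) v@_i *: << i >>.
Proof.
rewrite [LHS]monalgE; apply: eq_bigr => i _; apply/malgP => j.
by rewrite mcoeffZ !mcoeffU mulr_natr.
Qed.

Lemma eq_linear_msupp (f g : {linear {malg k[I]} -> W}) v :
  (forall i, i \in monalg.msupp v -> f << i >> = g << i >>) -> f v = g v.
Proof.
move=> fg; rewrite [v]malg_sum !linear_sum; apply: eq_big_seq => i iv.
by rewrite !linearZ fg.
Qed.

Lemma eq_linear_malg (f g : {linear {malg k[I]} -> W}) :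
  (forall i, f << i >> = g << i >>) -> f =1 g.
Proof. by move=> fg v; apply: eq_linear_msupp => i _; exact: fg. Qed.

End MalgTheory.

(** * Rewriting of words and the diamond lemma *)

Section Words.
Variable I : choiceType.

(** A formal integral combination of words; integers, because the rules are integral and
    must be evaluated by computation. *)
Definition combination := seq (int * seq I).

Definition comb_sub (c d : combination) : combination :=
  c ++ [seq (- x.1, x.2) | x <- d].

Section Action.
Variables (k : fieldType) (V : lmodType k) (op : I -> {linear V -> V}).

Definition word_act (w : seq I) (v : V) : V := foldr (fun a => op a) v w.

Definition comb_act (c : combination) (v : V) : V :=
  \sum_(x <- c) word_act x.2 v *~ x.1.

Fact word_act_linear w : linear (word_act w).
Proof. by move=> c u v; elim: w => //= a w ->; rewrite linearP. Qed.

HB.instance Definition _ w :=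
  GRing.isLinear.Build k V V *:%R (word_act w) (word_act_linear w).

Fact comb_act_linear c : linear (comb_act c).
Proof.
move=> d u v; rewrite /comb_act scaler_sumr -big_split; apply: eq_bigr => x _.
by rewrite linearP mulrzDl -scalerMzr.
Qed.

HB.instance Definition _ c :=
  GRing.isLinear.Build k V V *:%R (comb_act c) (comb_act_linear c).

Lemma word_act_cat w w' v : word_act (w ++ w') v = word_act w (word_act w' v).
Proof. by rewrite /word_act foldr_cat. Qed.

Lemma comb_act_cat c d v : comb_act (c ++ d) v = comb_act c v + comb_act d v.
Proof. by rewrite /comb_act big_cat. Qed.

Lemma comb_act_cons x c v :
  comb_act (x :: c) v = word_act x.2 v *~ x.1 + comb_act c v.
Proof. by rewrite /comb_act big_cons. Qed.

Lemma comb_act_nil v : comb_act [::] v = 0.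
Proof. by rewrite /comb_act big_nil. Qed.

Lemma comb_act_map_catr c w v :
  comb_act [seq (x.1, x.2 ++ w) | x <- c] v = comb_act c (word_act w v).
Proof. by rewrite /comb_act big_map; apply: eq_bigr => x _; rewrite word_act_cat. Qed.

Lemma comb_act_map_cons a c v :
  comb_act [seq (x.1, a :: x.2) | x <- c] v = op a (comb_act c v).
Proof.
by rewrite /comb_act big_map linear_sum; apply: eq_bigr => x _; rewrite raddfMz.
Qed.

Lemma comb_act_sub c d v : comb_act (comb_sub c d) v = comb_act c v - comb_act d v.
Proof.
rewrite comb_act_cat /comb_act big_map -sumrN; congr (_ + _).
by apply: eq_bigr => x _; rewrite mulrNz.
Qed.

Lemma comb_act_mull (z : int) (c : combination) v :
  comb_act [seq (z * x.1, x.2) | x <- c] v = comb_act c v *~ z.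
Proof.
by rewrite /comb_act big_map mulrz_suml; apply: eq_bigr => x _; rewrite mulrC mulrzA.
Qed.

End Action.

Variable rule : I -> I -> option combination.

Fixpoint rewrite1 (w : seq I) : option combination :=
  if w is a :: w1 then
    if w1 is b :: w' then
      if rule a b is Some c then Some [seq (x.1, x.2 ++ w') | x <- c]
      else omap (map (fun x => (x.1, a :: x.2))) (rewrite1 w1)
    else None
  else None.

Lemma rewrite1_cons2 a b w : rewrite1 (a :: b :: w) =
  if rule a b is Some c then Some [seq (x.1, x.2 ++ w) | x <- c]
  else omap (map (fun x => (x.1, a :: x.2))) (rewrite1 (b :: w)).
Proof. by []. Qed.

Definition rewrite_step (c : combination) : combination :=
  flatten [seq if rewrite1 x.2 is Some c' then [seq (x.1 * y.1, y.2) | y <- c']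
               else [:: x] | x <- c].

Fixpoint add_term (x : int * seq I) (c : combination) : combination :=
  if c is y :: c' then
    if x.2 == y.2 then (x.1 + y.1, y.2) :: c' else y :: add_term x c'
  else [:: x].

Definition collect (c : combination) : combination :=
  [seq x <- foldr add_term [::] c | x.1 != 0].

Definition reduce (n : nat) (c : combination) : combination :=
  iter n (fun c => collect (rewrite_step c)) c.

Section Soundness.
Variables (k : fieldType) (V : lmodType k) (op : I -> {linear V -> V}) (v : V).

Lemma add_term_act x c :
  comb_act op (add_term x c) v = word_act op x.2 v *~ x.1 + comb_act op c v.
Proof.
elim: c => [|y c IH] /=; first by rewrite comb_act_cons comb_act_nil.
case: eqP => [e|_]; rewrite !comb_act_cons /=; last by rewrite IH addrCA.
by rewrite e mulrzDr addrA.
Qed.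

Lemma collect_act c : comb_act op (collect c) v = comb_act op c v.
Proof.
rewrite /collect; set d := foldr _ _ _.
have -> : comb_act op c v = comb_act op d v.
  by rewrite /d; elim: c {d} => //= x c IH; rewrite add_term_act comb_act_cons IH.
rewrite /comb_act big_filter big_mkcond; apply: eq_bigr => x _.
by case: eqP => //= ->.
Qed.

Lemma collect_mem (P : pred (seq I)) c :
  all (fun x => P x.2) c -> all (fun x => P x.2) (collect c).
Proof.
move=> Pc; suff : all (fun x => P x.2) (foldr add_term [::] c).
  by move/allP=> h; apply/allP => x; rewrite mem_filter => /andP[_ /h].
elim: c Pc => //= x c IH /andP[Px /IH]; elim: (foldr _ _ _) => //= [_|y d IHd].
  by rewrite Px.
by case/andP=> Py Pd; case: ifP => _ /=; rewrite Py //= IHd.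
Qed.

(** The rules are only required to be valid on a set of words stable under
    rewriting: in a proof by induction on a termination order the rules are known
    to hold on small words only. *)
Variable ok : pred (seq I).
Hypothesis ok_rewrite : forall w c, ok w -> rewrite1 w = Some c ->
  word_act op w v = comb_act op c v /\ all (fun x => ok x.2) c.

Lemma rewrite_step_act c : all (fun x => ok x.2) c ->
  comb_act op (rewrite_step c) v = comb_act op c v
  /\ all (fun x => ok x.2) (rewrite_step c).
Proof.
rewrite /rewrite_step; elim: c => //= x c IH /andP[okx /IH[IH1 IH2]].
rewrite comb_act_cat IH1 all_cat IH2 comb_act_cons andbT.
case E: (rewrite1 _) => [c'|] /=; last by rewrite comb_act_cons comb_act_nil addr0 okx.
have [-> okc'] := ok_rewrite okx E; split; last by rewrite all_map.
by rewrite comb_act_mull.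
Qed.

Lemma reduce_act n c : all (fun x => ok x.2) c ->
  comb_act op (reduce n c) v = comb_act op c v.
Proof.
move=> okc; suff [] : comb_act op (reduce n c) v = comb_act op c v
  /\ all (fun x => ok x.2) (reduce n c) by [].
elim: n => //= n [IH1 IH2]; rewrite collect_act.
by have [-> okr] := rewrite_step_act IH2; split=> //; apply: collect_mem.
Qed.

End Soundness.

Section Diamond.
Variable f : I -> nat -> nat.
Hypothesis f_mono : forall a, {homo f a : m n / (m < n)%N}.

Definition height (w : seq I) : nat := foldr f 0%N w.

Hypothesis rule_decr : forall a b c x, rule a b = Some c -> x \in c ->
  forall n, (foldr f n x.2 < f a (f b n))%N.

Hypothesis rule_confluent : forall a b d c c',
  rule a b = Some c -> rule b d = Some c' ->
  exists n, reduce n (comb_sub [seq (x.1, a :: x.2) | x <- c']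
                               [seq (x.1, x.2 ++ [:: d]) | x <- c]) = [::].

Definition irreducible (w : seq I) : bool := rewrite1 w == None.

Lemma irreducible_cons a b w :
  irreducible (a :: b :: w) = (rule a b == None) && irreducible (b :: w).
Proof.
by rewrite /irreducible rewrite1_cons2; case: (rule a b); case: (rewrite1 _).
Qed.

Lemma irreducible_behead a w : irreducible (a :: w) -> irreducible w.
Proof. by case: w => // b w; rewrite irreducible_cons => /andP[]. Qed.

Lemma f_homo a : {homo f a : m n / (m <= n)%N}.
Proof.
by move=> m n; rewrite leq_eqVlt => /predU1P[->//|/(@f_mono a)/ltnW].
Qed.

Lemma f_ge a n : (n <= f a n)%N.
Proof. by elim: n => // n IH; apply: leq_ltn_trans IH _; exact: f_mono. Qed.

Lemma height_cat w w' : height (w ++ w') = foldr f (height w') w.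
Proof. exact: foldr_cat. Qed.

Lemma rule_height a b c x w : rule a b = Some c -> x \in c ->
  (height (x.2 ++ w) < height (a :: b :: w))%N.
Proof. by move=> r xc; rewrite height_cat; exact: rule_decr r xc _. Qed.

Lemma rewrite1_height w w' c x : rewrite1 w = Some c -> x \in c ->
  (height (x.2 ++ w') < height (w ++ w'))%N.
Proof.
elim: w c x => // a [|b w] // IH c x.
rewrite rewrite1_cons2; case R: (rule a b) => [c1|].
  case=> <- /mapP[y yc ->] /=; rewrite -catA; exact: rule_height R yc.
case E: (rewrite1 (b :: w)) => [c1|//].
case=> <- /mapP[y yc ->] /=.
by apply: f_mono; exact: IH E yc.
Qed.

Variable k : fieldType.

Definition irr_word := {w : seq I | irreducible w}.
Local Notation V := {malg k[irr_word]}.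

Definition irr_mon (w : seq I) : V := if insub w is Some u then << u >> else 0.

Lemma irr_monE (u : irr_word) : irr_mon (val u) = << u >>.
Proof. by rewrite /irr_mon valK. Qed.

(** Normalizing does not increase heights; this is what lets the induction hypothesis of the
    diamond lemma be applied to vectors and not only to words. *)
Definition bounded (v : V) (m : nat) : Prop :=
  forall u, u \in monalg.msupp v -> (height (val u) <= m)%N.

Lemma bounded_le v m n : bounded v m -> (m <= n)%N -> bounded v n.
Proof. by move=> bv mn u /bv /leq_trans; apply. Qed.

Lemma bounded0 m : bounded 0 m.
Proof. by move=> u; rewrite msupp0. Qed.

Lemma boundedD v w m : bounded v m -> bounded w m -> bounded (v + w) m.
Proof.
by move=> bv bw u /(fsubsetP (msuppD_le _ _)); rewrite inE => /orP[/bv|/bw].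
Qed.

Lemma boundedZ c v m : bounded v m -> bounded (c *: v) m.
Proof. by move=> bv u /(fsubsetP (msuppZ_le _ _)) /bv. Qed.

Lemma bounded_sum (J : Type) (r : seq J) (P : pred J) F m :
  (forall i, P i -> bounded (F i) m) -> bounded (\sum_(i <- r | P i) F i) m.
Proof.
by move=> h; elim/big_rec: _ => [|i v Pi bv]; [exact: bounded0|apply/boundedD/bv/h].
Qed.

Lemma bounded_mon w : bounded (irr_mon w) (height w).
Proof.
rewrite /irr_mon; case: insubP => [u _ <-|_]; last exact: bounded0.
by move=> v; rewrite msuppU oner_eq0 inE => /eqP ->.
Qed.

Definition lin_op (F : I -> seq I -> V) (a : I) : {linear V -> V} :=
  lin_ext (fun u : irr_word => F a (val u)).

(** Left multiplication by a letter, in normal form: [irr_op_fuel n a w] is the normal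
    form of [a :: w] when [height (a :: w) < n]. *)
Fixpoint irr_op_fuel (n : nat) (a : I) (w : seq I) : V :=
  if n is n'.+1 then
    if w is b :: w' then
      if rule a b is Some c then
        comb_act (lin_op (irr_op_fuel n')) c (irr_mon w')
      else irr_mon (a :: w)
    else irr_mon [:: a]
  else 0.

Definition irr_op : I -> {linear V -> V} :=
  lin_op (fun a w => irr_op_fuel (height (a :: w)).+1 a w).

Lemma lin_op_mon F a (u : irr_word) : lin_op F a << u >> = F a (val u).
Proof. exact: lin_extU. Qed.

Lemma lin_op_bounded F a v m :
  (forall u, u \in monalg.msupp v -> bounded (F a (val u)) m) ->
  bounded (lin_op F a v) m.
Proof.
move=> bF; rewrite /lin_op /= lin_extE big_seq.
by apply: bounded_sum => u us; apply/boundedZ/bF.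
Qed.

(** The recursive calls are made on words of smaller height, so that any fuel above the
    height gives the same result. *)
Lemma irr_op_fuel_stable n m a w : (height (a :: w) < n <= m)%N ->
  irr_op_fuel n a w = irr_op_fuel m a w /\ bounded (irr_op_fuel n a w) (height (a :: w)).
Proof.
elim: n m a w => // n IH [|m] a w; first by rewrite ltn0 andbF.
rewrite !ltnS => /andP[hn nm] /=; case: w hn => [|b w] hn.
  by split=> //; exact: bounded_mon.
case R: (rule a b) => [c|]; last by split=> //; exact: bounded_mon.
set on := lin_op (irr_op_fuel n); set om := lin_op (irr_op_fuel m).
have act_r r : (height (r ++ w) < height (a :: b :: w))%N ->
    word_act on r (irr_mon w) = word_act om r (irr_mon w)
    /\ bounded (word_act on r (irr_mon w)) (height (r ++ w)).
  elim: r => [|l r IHr] hr; first by split=> //; exact: bounded_mon.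
  have [eq_r bd_r] := IHr (leq_ltn_trans (f_ge l _) hr).
  have hl u : u \in monalg.msupp (word_act on r (irr_mon w)) ->
      (height (l :: val u) <= height ((l :: r) ++ w))%N.
    by move=> /bd_r hu; apply: f_homo.
  have small u : u \in monalg.msupp (word_act on r (irr_mon w)) ->
      (height (l :: val u) < n <= m)%N.
    move=> /hl hu; rewrite nm andbT; apply: leq_ltn_trans hu _.
    exact: leq_trans hr hn.
  split=> /=.
    rewrite -eq_r; apply: eq_linear_msupp => u /small hu.
    by rewrite !lin_op_mon; case: (IH _ _ _ hu).
  apply: lin_op_bounded => u us.
  by have [_ bu] := IH _ _ _ (small _ us); apply: bounded_le bu (hl _ us).
have rh x : x \in c -> (height (x.2 ++ w) < height (a :: b :: w))%N.
  by move=> xc; exact: rule_height R xc.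
split.
  by apply: eq_big_seq => x /rh xc; have [-> _] := act_r _ xc.
rewrite /comb_act big_seq; apply: bounded_sum => x /rh xc; rewrite -scaler_int; apply: boundedZ.
by have [_ bx] := act_r _ xc; apply: bounded_le bx (ltnW xc).
Qed.

Lemma irr_op_fuel_redex n a b c w : rule a b = Some c ->
  irr_op_fuel n.+1 a (b :: w) = comb_act (lin_op (irr_op_fuel n)) c (irr_mon w).
Proof. by move=> /= ->. Qed.

Lemma irr_opU a (u : irr_word) :
  irr_op a << u >> = irr_op_fuel (height (a :: val u)).+1 a (val u).
Proof. exact: lin_op_mon. Qed.

Lemma irr_op_mon a w : irreducible w ->
  irr_op a (irr_mon w) = irr_op_fuel (height (a :: w)).+1 a w.
Proof. by move=> iw; rewrite -[w]/(val (exist irreducible w iw)) irr_monE irr_opU. Qed.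

Lemma irr_op_irr a w : irreducible (a :: w) -> irr_op a (irr_mon w) = irr_mon (a :: w).
Proof.
move=> iw; rewrite irr_op_mon ?(irreducible_behead iw) //=.
by case: w iw => // b w; rewrite irreducible_cons => /andP[/eqP -> _].
Qed.

Lemma word_act_irr w w' : irreducible (w ++ w') ->
  word_act irr_op w (irr_mon w') = irr_mon (w ++ w').
Proof.
by elim: w => //= a w IH iw; rewrite IH ?irr_op_irr // (irreducible_behead iw).
Qed.

Lemma irr_op_bounded a v m : bounded v m -> bounded (irr_op a v) (f a m).
Proof.
move=> bv; apply: lin_op_bounded => u us.
have h : (height (a :: val u) < (height (a :: val u)).+1 <=
          (height (a :: val u)).+1)%N by rewrite !ltnSn.
have [_ bu] := irr_op_fuel_stable h.
by apply: bounded_le bu _; apply: f_homo; exact: bv.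
Qed.

Lemma word_act_bounded w v m : bounded v m -> bounded (word_act irr_op w v) (foldr f m w).
Proof. by move=> bv; elim: w => //= a w; exact: irr_op_bounded. Qed.

Lemma irr_op_redex a b c w : rule a b = Some c -> irreducible (b :: w) ->
  irr_op a (irr_mon (b :: w)) = comb_act irr_op c (irr_mon w).
Proof.
move=> R ibw; rewrite (irr_op_mon a ibw) (irr_op_fuel_redex _ _ R) /comb_act.
suff act_r r : (height (r ++ w) < height (a :: b :: w))%N ->
    word_act (lin_op (irr_op_fuel (height (a :: b :: w)))) r (irr_mon w)
    = word_act irr_op r (irr_mon w).
  by apply: eq_big_seq => x /(rule_height w R)/act_r ->.
elim: r => [//|l r IHr] hr; have hr' := leq_ltn_trans (f_ge l _) hr.
transitivity (lin_op (irr_op_fuel (height (a :: b :: w))) l (word_act irr_op r (irr_mon w))).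
  by rewrite -(IHr hr').
transitivity (irr_op l (word_act irr_op r (irr_mon w))); last by [].
apply: eq_linear_msupp => u us.
have hu : (height (l :: val u) <= height ((l :: r) ++ w))%N.
  by apply: f_homo; have := word_act_bounded (@bounded_mon w) us; rewrite -height_cat.
have h : (height (l :: val u) < (height (l :: val u)).+1
          <= height (a :: b :: w))%N.
  by rewrite ltnSn; exact: leq_ltn_trans hu hr.
by rewrite irr_opU lin_op_mon; have [-> _] := irr_op_fuel_stable h.
Qed.

Lemma rule_on_msupp a b c v :
  (forall u, u \in monalg.msupp v ->
     irr_op a (irr_op b (irr_mon (val u))) = comb_act irr_op c (irr_mon (val u))) ->
  irr_op a (irr_op b v) = comb_act irr_op c v.
Proof.
move=> h; have := @eq_linear_msupp _ _ _ (irr_op a \o irr_op b) (comb_act irr_op c) v.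
by apply=> u /h; rewrite (irr_monE u).
Qed.

(** The heart of the diamond lemma.  If [b :: w] is irreducible, the rule for
    [a b] holds at [w] by construction.  Otherwise [w] starts with a [d] such that
    [a b d] is an overlap, and the two ways of reducing it agree because all the
    rules hold at smaller words, where the reductions that resolve the overlap
    take place. *)
Lemma irr_op_rule_mon a b c w : rule a b = Some c -> irreducible w ->
  irr_op a (irr_op b (irr_mon w)) = comb_act irr_op c (irr_mon w).
Proof.
have [n] := ubnP (height (a :: b :: w)); elim: n => // n IH in a b c w *.
rewrite ltnS => hn R iw.
case: w iw hn => [|d w] iw hn; first by rewrite irr_op_irr // (irr_op_redex R).
case S: (rule b d) => [c'|]; last first.
  have ibw : irreducible (b :: d :: w) by rewrite irreducible_cons S.
  by rewrite irr_op_irr // (irr_op_redex R).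
rewrite (irr_op_redex S iw).
have iw' := irreducible_behead iw.
pose ok r := (height (r ++ w) < height [:: a, b, d & w])%N.
have ok_rewrite r e : ok r -> rewrite1 r = Some e ->
    word_act irr_op r (irr_mon w) = comb_act irr_op e (irr_mon w)
    /\ all (fun x => ok x.2) e.
  move=> okr rw; split; last first.
    by apply/allP => x xe; apply: ltn_trans (rewrite1_height w rw xe) okr.
  elim: r e okr rw => // a' [|b' r] // IHr e okr.
  rewrite rewrite1_cons2; case R': (rule a' b') => [c1|].
    case=> <-; rewrite comb_act_map_catr.
    set v := word_act irr_op r _.
    have bv : bounded v (height (r ++ w)).
      by rewrite height_cat; exact: (word_act_bounded (@bounded_mon w)).
    apply: rule_on_msupp => u /bv hu; apply: IH R' (valP u).
    apply: leq_trans (_ : (height (a' :: b' :: r ++ w)).+1 <= _)%N.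
      by rewrite ltnS; do 2!apply: f_homo.
    by apply: leq_trans okr hn.
  case E: (rewrite1 _) => [e'|//].
  case=> <-; rewrite comb_act_map_cons; congr (irr_op a' _); apply: IHr E.
  exact: leq_ltn_trans (f_ge a' _) okr.
have [m res] := rule_confluent R S.
have ok_overlap : all (fun x => ok x.2)
    (comb_sub [seq (x.1, a :: x.2) | x <- c'] [seq (x.1, x.2 ++ [:: d]) | x <- c]).
  rewrite all_cat !all_map; apply/andP; split; apply/allP => x xc; rewrite /= /ok.
    by apply: f_mono; exact: rule_height S xc.
  by rewrite -catA; exact: rule_height R xc.
have := reduce_act ok_rewrite m ok_overlap; rewrite {}res comb_act_nil comb_act_sub.
rewrite comb_act_map_cons comb_act_map_catr => /esym/eqP; rewrite subr_eq0 => /eqP.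
by rewrite /= irr_op_irr.
Qed.

Theorem irr_op_rule a b c v : rule a b = Some c -> irr_op a (irr_op b v) = comb_act irr_op c v.
Proof.
by move=> R; apply: rule_on_msupp => u _; apply: irr_op_rule_mon R (valP u).
Qed.

(** By induction on the height, which every rewriting step lowers. *)
Lemma irr_word_span (A : algType k) (e : I -> A) (P : A -> Prop) :
  (forall a b c, rule a b = Some c ->
     e a * e b = \sum_(x <- c) (\prod_(i <- x.2) e i) *~ x.1) ->
  P 0 -> (forall x y, P x -> P y -> P (x + y)) ->
  (forall x (n : int), P x -> P (x *~ n)) ->
  (forall w, irreducible w -> P (\prod_(i <- w) e i)) ->
  forall w, P (\prod_(i <- w) e i).
Proof.
move=> eR P0 PD PZ Pirr w; have [n] := ubnP (height w); elim: n => // n IH in w *.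
rewrite ltnS => hw; case E: (rewrite1 w) => [c|]; last by apply: Pirr; apply/eqP.
have -> : \prod_(i <- w) e i = \sum_(x <- c) (\prod_(i <- x.2) e i) *~ x.1.
  elim: w c E {hw} => // a [|b w] // IHw c; rewrite rewrite1_cons2.
  case R: (rule a b) => [c1|].
    case=> <-; rewrite big_map !big_cons mulrA (eR _ _ _ R) mulr_suml.
    by apply: eq_bigr => x _; rewrite big_cat mulrzAl.
  case E: (rewrite1 _) => [c1|//]; case=> <-; rewrite big_map big_cons (IHw _ E).
  by rewrite mulr_sumr; apply: eq_bigr => x _; rewrite big_cons mulrzAr.
rewrite big_seq; elim/big_rec: _ => // x y xc Py; apply: PD => //; apply/PZ/IH.
have := rewrite1_height [::] E xc; rewrite !cats0 => /leq_trans; exact.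
Qed.
End Diamond.
End Words.

(** * Noncommutative polynomial identities by computation *)

Section NoncommutativeExpressions.
Variable I : choiceType.

(** Identities between noncommutative polynomials in elements that satisfy quadratic rules
    are proved by rewriting both sides to normal form inside the kernel. *)
Inductive nexpr :=
| NVar of I | NOne | NZero | NAdd of nexpr & nexpr | NOpp of nexpr
| NMul of nexpr & nexpr | NMuln of nexpr & nat.

Fixpoint ncomb (e : nexpr) : combination I :=
  match e with
  | NVar a => [:: (1, [:: a])]
  | NOne => [:: (1, [::])]
  | NZero => [::]
  | NAdd e1 e2 => ncomb e1 ++ ncomb e2
  | NOpp e1 => [seq (- x.1, x.2) | x <- ncomb e1]
  | NMul e1 e2 => [seq (x.1 * y.1, x.2 ++ y.2) | x <- ncomb e1, y <- ncomb e2]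
  | NMuln e1 n => [seq (x.1 *+ n, x.2) | x <- ncomb e1]
  end.

Section Act.
Variables (k : fieldType) (V : lmodType k) (op : I -> {linear V -> V}).

Fixpoint nact (e : nexpr) (v : V) : V :=
  match e with
  | NVar a => op a v
  | NOne => v
  | NZero => 0
  | NAdd e1 e2 => nact e1 v + nact e2 v
  | NOpp e1 => - nact e1 v
  | NMul e1 e2 => nact e1 (nact e2 v)
  | NMuln e1 n => nact e1 v *+ n
  end.

Lemma ncomb_act e v : comb_act op (ncomb e) v = nact e v.
Proof.
elim: e v => [a||  |e1 IH1 e2 IH2|e1 IH1|e1 IH1 e2 IH2|e1 IH1 n] v /=.
- by rewrite comb_act_cons comb_act_nil addr0.
- by rewrite comb_act_cons comb_act_nil addr0.
- exact: comb_act_nil.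
- by rewrite comb_act_cat IH1 IH2.
- rewrite -IH1 /comb_act big_map -sumrN.
  by apply: eq_bigr => x _; rewrite mulrNz.
- rewrite -IH1 -IH2 /comb_act big_allpairs_dep; apply: eq_bigr => x _ /=.
  rewrite linear_sum mulrz_suml; apply: eq_bigr => y _ /=.
  by rewrite word_act_cat raddfMz mulrC mulrzA.
- rewrite -IH1 /comb_act big_map -sumrMnl; apply: eq_bigr => x _ /=.
  by rewrite -mulr_natr mulrzA natz -pmulrn.
Qed.

Variable rule : I -> I -> option (combination I).
Hypothesis op_rule : forall a b c, rule a b = Some c ->
  forall v, op a (op b v) = comb_act op c v.

Lemma rewrite1_act w c v : rewrite1 rule w = Some c ->
  word_act op w v = comb_act op c v.
Proof.
elim: w c => // a [|b w] // IH c; rewrite rewrite1_cons2.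
case R: (rule a b) => [c1|].
  by case=> <-; rewrite comb_act_map_catr -(op_rule R).
case E: (rewrite1 _ _) => [c1|//]; case=> <-.
by rewrite comb_act_map_cons -(IH _ E).
Qed.

Lemma nact_check n e1 e2 v :
  reduce rule n (comb_sub (ncomb e1) (ncomb e2)) = [::] -> nact e1 v = nact e2 v.
Proof.
move=> h; apply/eqP; rewrite -subr_eq0 -!ncomb_act -comb_act_sub.
have := @reduce_act _ rule _ _ op v predT _ n (comb_sub (ncomb e1) (ncomb e2)).
rewrite h comb_act_nil => <- //; last by apply/allP.
by move=> w c _ E; rewrite (rewrite1_act v E); split=> //; apply/allP.
Qed.

End Act.

Section Eval.
Variables (k : fieldType) (A : algType k) (val : I -> A).

Fixpoint neval (e : nexpr) : A :=
  match e with
  | NVar a => val a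
  | NOne => 1
  | NZero => 0
  | NAdd e1 e2 => neval e1 + neval e2
  | NOpp e1 => - neval e1
  | NMul e1 e2 => neval e1 * neval e2
  | NMuln e1 n => neval e1 *+ n
  end.

Definition lmul (a : A) : {linear A -> A} := a \*o idfun.

Lemma nact_lmul e v : nact (fun a => lmul (val a)) e v = neval e * v.
Proof.
elim: e v => [a||  |e1 IH1 e2 IH2|e1 IH1|e1 IH1 e2 IH2|e1 IH1 n] v //=.
- by rewrite mul1r.
- by rewrite mul0r.
- by rewrite IH1 IH2 mulrDl.
- by rewrite IH1 mulNr.
- by rewrite IH1 IH2 mulrA.
- by rewrite IH1 mulrnAl.
Qed.

Lemma word_act_lmul w v :
  word_act (fun a => lmul (val a)) w v = (\prod_(i <- w) val i) * v.
Proof.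
elim: w => [|a w IH] /=; first by rewrite big_nil mul1r.
by rewrite IH big_cons mulrA.
Qed.

Lemma comb_act_lmul c v : comb_act (fun a => lmul (val a)) c v
  = (\sum_(x <- c) (\prod_(i <- x.2) val i) *~ x.1) * v.
Proof.
rewrite /comb_act mulr_suml; apply: eq_bigr => x _.
by rewrite word_act_lmul mulrzAl.
Qed.

Definition rules_hold (rule : I -> I -> option (combination I)) : Prop :=
  forall a b c, rule a b = Some c ->
    val a * val b = \sum_(x <- c) (\prod_(i <- x.2) val i) *~ x.1.

(** Evaluation at elements is the action of left multiplications on 1. *)
Lemma neval_check rule n e1 e2 : rules_hold rule ->
  reduce rule n (comb_sub (ncomb e1) (ncomb e2)) = [::] -> neval e1 = neval e2.
Proof.
move=> hr h; rewrite -[LHS]mulr1 -[RHS]mulr1 -!nact_lmul.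
apply: nact_check h => a b c R v.
by rewrite comb_act_lmul -(hr _ _ _ R) /= mulrA.
Qed.

End Eval.
End NoncommutativeExpressions.

Arguments NOne {I}.
Arguments NZero {I}.

(** * The rewriting system of the algebra *)

(** The generators together with the two elements x21 and u21; with these added, the
    relations become a finite confluent system of quadratic rules. *)
Inductive letter := X1 | X21 | X2 | G | G' | Zt | U1 | U21 | U2.

Definition letter_code (a : letter) : nat :=
  match a with
  | X1 => 0 | X21 => 1 | X2 => 2 | G => 3 | G' => 4 | Zt => 5 | U1 => 6 | U21 => 7
  | U2 => 8
  end.

Definition letters := [:: X1; X21; X2; G; G'; Zt; U1; U21; U2].

Fact letter_codeK : cancel letter_code (nth X1 letters). Proof. by case. Qed.

HB.instance Definition _ := Choice.copy letter (can_type letter_codeK).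

Lemma mem_letters a : a \in letters. Proof. by case: a. Qed.

Definition Drule (a b : letter) : option (combination letter) :=
  match a, b with
  | X1, X1 | U1, U1 => Some [::]
  | G, G' | G', G => Some [:: (1, [::])]
  | X21, X1 | G, (X1 | X21) | G', (X1 | X21) | Zt, (G | G') | U1, (X21 | G | G')
  | U21, (X1 | X21 | G | G' | U1) =>
      Some [:: (1, [:: b; a])]
  | Zt, (X1 | X2) => Some [:: (1, [:: b; a]); (1, [:: b])]
  | Zt, X21 => Some [:: (1, [:: b; a]); (2, [:: b])]
  | (U1 | U2), Zt => Some [:: (1, [:: b; a]); (1, [:: a])]
  | U21, Zt => Some [:: (1, [:: b; a]); (2, [:: a])]
  | X2, X1 => Some [:: (-1, [:: X1; X2]); (1, [:: X21])]
  | X2, X21 => Some [:: (1, [:: X21; X2]); (1, [:: X1; X21])]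
  | G, X2 => Some [:: (1, [:: X2; G]); (-1, [:: X1; G])]
  | G', X2 => Some [:: (1, [:: X2; G']); (1, [:: X1; G'])]
  | U1, X1 => Some [:: (-1, [:: X1; U1])]
  | U1, X2 => Some [:: (-1, [:: X2; U1]); (1, [::]); (-1, [:: G])]
  | U21, X2 => Some [:: (1, [:: X2; U21]); (1, [:: U1]); (1, [:: G; U1])]
  | U2, X1 =>
      Some [:: (-1, [:: X1; U2]); (1, [::]); (-1, [:: G]); (1, [:: X1; U1])]
  | U2, X21 => Some [:: (1, [:: X21; U2]); (-2, [:: X21; U1]); (1, [:: X1]);
                        (1, [:: X1; G])]
  | U2, X2 => Some [:: (-1, [:: X2; U2]); (1, [:: G; Zt]); (1, [:: X2; U1])]
  | U2, G => Some [:: (1, [:: G; U2]); (-1, [:: G; U1])]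
  | U2, G' => Some [:: (1, [:: G'; U2]); (1, [:: G'; U1])]
  | U2, U1 => Some [:: (-1, [:: U1; U2]); (1, [:: U21])]
  | U2, U21 => Some [:: (1, [:: U21; U2]); (1, [:: U1; U21])]
  | _, _ => None
  end.

(** Termination of the rewriting system: read as a composite of these affine maps,
    the left-hand side of each rule is larger than the words on the right. *)
Definition affine_weight (a : letter) : nat * nat :=
  match a with
  | X1 => (1, 1) | X21 => (2, 4) | X2 => (3, 4) | G | G' => (3, 3) | Zt => (3, 2)
  | U1 => (5, 1) | U21 => (6, 1) | U2 => (7, 0)
  end%N.

Definition weight (a : letter) (n : nat) : nat :=
  ((affine_weight a).1 * n + (affine_weight a).2)%N.

Fact weight_mono a : {homo weight a : m n / (m < n)%N}.
Proof. by move=> m n mn; rewrite /weight ltn_add2r ltn_pmul2l //; case: a. Qed.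

Definition all_rules (P : letter -> letter -> combination letter -> bool) : bool :=
  all (fun a => all (fun b => if Drule a b is Some c then P a b c else true) letters)
    letters.

Lemma all_rulesP P a b c : all_rules P -> Drule a b = Some c -> P a b c.
Proof.
by move/allP/(_ a (mem_letters a))/allP/(_ b (mem_letters b)) => + R; rewrite R.
Qed.

Definition affine_word (w : seq letter) : nat * nat :=
  foldr (fun a cd => let: (c, d) := affine_weight a in
                     (c * cd.1, c * cd.2 + d)%N) (1, 0)%N w.

Lemma affine_wordE w n :
  foldr weight n w = ((affine_word w).1 * n + (affine_word w).2)%N.
Proof.
elim: w => [|a w /= ->]; first by rewrite /= mul1n addn0.
by rewrite /weight; case: (affine_weight a) => c d /=; rewrite mulnDr mulnA addnA.
Qed.

Fact Drule_decr a b c x : Drule a b = Some c -> x \in c ->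
  forall n, (foldr weight n x.2 < weight a (weight b n))%N.
Proof.
pose P a b (c : combination letter) := all (fun x =>
  ((affine_word x.2).1 <= (affine_word [:: a; b]).1)%N
  && ((affine_word x.2).2 < (affine_word [:: a; b]).2)%N) c.
have okP : all_rules P by vm_compute.
move=> R xc n; have /allP/(_ x xc)/andP[le1 lt2] := all_rulesP okP R.
rewrite -[weight a _]/(foldr weight n [:: a; b]) !affine_wordE -addnS.
by apply: leq_add lt2; rewrite leq_mul2r le1 orbT.
Qed.

(** The 111 overlaps of the rules resolve; this is the consistency of the relations
    defining the algebra. *)
Fact Drule_confluent a b d c c' : Drule a b = Some c -> Drule b d = Some c' ->
  exists n, reduce Drule n (comb_sub [seq (x.1, a :: x.2) | x <- c']
                                     [seq (x.1, x.2 ++ [:: d]) | x <- c]) = [::].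
Proof.
pose P a b c := all (fun d => if Drule b d is Some c' then
  nilp (reduce Drule 16 (comb_sub [seq (x.1, a :: x.2) | x <- c']
                                  [seq (x.1, x.2 ++ [:: d]) | x <- c])) else true)
  letters.
have okP : all_rules P by vm_compute.
move=> R R'; exists 16.
by have /allP/(_ d (mem_letters d)) := all_rulesP okP R; rewrite R' => /nilP.
Qed.

Lemma relation_image (A B : nzRingType) (f : {rmorphism A -> B})
    (x1 x2 u1 u2 g g' z : A) :
  (forall l r, relation x1 x2 u1 u2 g g' z l r -> f l = f r) ->
  forall l r, relation (f x1) (f x2) (f u1) (f u2) (f g) (f g') (f z) l r -> l = r.
Proof.
move=> rel l r.
have {}rel l' r' H := rel l' r' H.
Ltac push H := rewrite ?expr2 ?(rmorphB, rmorphD, rmorphN, rmorphM, rmorph1, rmorph0)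
  in H; by rewrite ?expr2.
case.
- have H := rel _ _ (rel_x1x1 _ _ _ _ _ _ _); push H.
- have H := rel _ _ (rel_x2x21 _ _ _ _ _ _ _); push H.
- have H := rel _ _ (rel_u1u1 _ _ _ _ _ _ _); push H.
- have H := rel _ _ (rel_u2u21 _ _ _ _ _ _ _); push H.
- have H := rel _ _ (rel_u1zeta _ _ _ _ _ _ _); push H.
- have H := rel _ _ (rel_u2zeta _ _ _ _ _ _ _); push H.
- have H := rel _ _ (rel_zetax1 _ _ _ _ _ _ _); push H.
- have H := rel _ _ (rel_zetax2 _ _ _ _ _ _ _); push H.
- have H := rel _ _ (rel_gg' _ _ _ _ _ _ _); push H.
- have H := rel _ _ (rel_g'g _ _ _ _ _ _ _); push H.
- have H := rel _ _ (rel_zetag _ _ _ _ _ _ _); push H.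
- have H := rel _ _ (rel_gx1 _ _ _ _ _ _ _); push H.
- have H := rel _ _ (rel_gx2 _ _ _ _ _ _ _); push H.
- have H := rel _ _ (rel_u1g _ _ _ _ _ _ _); push H.
- have H := rel _ _ (rel_u2g _ _ _ _ _ _ _); push H.
- have H := rel _ _ (rel_u1x1 _ _ _ _ _ _ _); push H.
- have H := rel _ _ (rel_u1x2 _ _ _ _ _ _ _); push H.
- have H := rel _ _ (rel_u2x1 _ _ _ _ _ _ _); push H.
- have H := rel _ _ (rel_u2x2 _ _ _ _ _ _ _); push H.
Qed.

Section Generators.
Variable k : fieldType.
Local Notation D := (Dtilde k).
Local Notation v := (@free_var k generator).

Definition Dproj : free_algebra k generator -> D := api (@relator k).

Fact Dproj_linear : linear Dproj.
Proof. by move=> c x y; rewrite /Dproj apiD apiZ. Qed.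

Fact Dproj_monoid_morphism : monoid_morphism Dproj.
Proof. by split; [exact: api1 | exact: apiM]. Qed.

HB.instance Definition _ :=
  GRing.isLinear.Build k (free_algebra k generator) D *:%R Dproj Dproj_linear.
HB.instance Definition _ :=
  GRing.isMonoidMorphism.Build (free_algebra k generator) D Dproj
    Dproj_monoid_morphism.

Lemma Dproj_relation l r :
  relation (v Gen_x1) (v Gen_x2) (v Gen_u1) (v Gen_u2) (v Gen_g) (v Gen_ginv)
    (v Gen_zeta) l r -> Dproj l = Dproj r.
Proof.
move=> lr; apply/apiE/in_span_gen; exists 1, (l - r), 1.
by rewrite mul1r mulr1; split.
Qed.

Lemma Dgen_relation l r :
  relation (Dgen k Gen_x1) (Dgen k Gen_x2) (Dgen k Gen_u1) (Dgen k Gen_u2)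
    (Dgen k Gen_g) (Dgen k Gen_ginv) (Dgen k Gen_zeta) l r -> l = r.
Proof. exact: (@relation_image _ _ Dproj _ _ _ _ _ _ _ Dproj_relation). Qed.

End Generators.

(** * The rules as consequences of the relations *)

Section Representation.
Variables (k : fieldType) (A : algType k) (e : generator -> A).

Definition letter_val (a : letter) : A :=
  match a with
  | X1 => e Gen_x1 | X2 => e Gen_x2 | G => e Gen_g | G' => e Gen_ginv
  | Zt => e Gen_zeta | U1 => e Gen_u1 | U2 => e Gen_u2
  | X21 => e Gen_x2 * e Gen_x1 + e Gen_x1 * e Gen_x2
  | U21 => e Gen_u1 * e Gen_u2 + e Gen_u2 * e Gen_u1
  end.

Definition satisfies_relations : Prop := forall l r,
  relation (e Gen_x1) (e Gen_x2) (e Gen_u1) (e Gen_u2) (e Gen_g) (e Gen_ginv)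
    (e Gen_zeta) l r -> l = r.

Hypothesis rel : satisfies_relations.

(** The rules that follow from the relations without any computation in the algebra;
    the commutation of x21 and u21 with the other letters is derived from them. *)
Definition basic_rule (a b : letter) : option (combination letter) :=
  match a, b with
  | X21, _ | U21, _ | (G | G' | Zt | U1 | U2), X21 => None
  | X2, X1 | U2, U1 => None
  | _, _ => Drule a b
  end.

Definition unfold_letter (a : letter) : nexpr letter :=
  match a with
  | X21 => NAdd (NMul (NVar X2) (NVar X1)) (NMul (NVar X1) (NVar X2))
  | U21 => NAdd (NMul (NVar U1) (NVar U2)) (NMul (NVar U2) (NVar U1))
  | _ => NVar a
  end.

Definition unfold_word (w : seq letter) : nexpr letter :=
  foldr (fun a => NMul (unfold_letter a)) NOne w.

Lemma neval_unfold a : neval letter_val (unfold_letter a) = letter_val a.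
Proof. by case: a. Qed.

Lemma neval_unfold_word w :
  neval letter_val (unfold_word w) = \prod_(a <- w) letter_val a.
Proof.
elim: w => [|a w /= ->]; first by rewrite big_nil.
by rewrite neval_unfold big_cons.
Qed.

Fact basic_rules_hold : rules_hold letter_val basic_rule.
Proof.
have r l s h := @rel l s h.
have gg' : e Gen_g * e Gen_ginv = 1 by apply/r/rel_gg'.
have g'g : e Gen_ginv * e Gen_g = 1 by apply/r/rel_g'g.
have conj a b c : e Gen_g * b = a * e Gen_g + e Gen_g * c ->
    e Gen_ginv * a = b * e Gen_ginv - c * e Gen_ginv.
  move=> h; rewrite -[LHS]mulr1 -gg' !mulrA -[_ * a * _]mulrA.
  have -> : a * e Gen_g = e Gen_g * b - e Gen_g * c by rewrite h addrK.
  by rewrite mulrBr !mulrA g'g !mul1r mulrBl.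
have x1x1 := r _ _ (rel_x1x1 _ _ _ _ _ _ _).
have u1u1 := r _ _ (rel_u1u1 _ _ _ _ _ _ _).
have gx1 := r _ _ (rel_gx1 _ _ _ _ _ _ _).
have gx2 := r _ _ (rel_gx2 _ _ _ _ _ _ _).
have u1g := r _ _ (rel_u1g _ _ _ _ _ _ _).
have u2g := r _ _ (rel_u2g _ _ _ _ _ _ _).
have zg := r _ _ (rel_zetag _ _ _ _ _ _ _).
have zx1 := r _ _ (rel_zetax1 _ _ _ _ _ _ _).
have zx2 := r _ _ (rel_zetax2 _ _ _ _ _ _ _).
have u1z := r _ _ (rel_u1zeta _ _ _ _ _ _ _).
have u2z := r _ _ (rel_u2zeta _ _ _ _ _ _ _).
have u1x1 := r _ _ (rel_u1x1 _ _ _ _ _ _ _).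
have u1x2 := r _ _ (rel_u1x2 _ _ _ _ _ _ _).
have u2x1 := r _ _ (rel_u2x1 _ _ _ _ _ _ _).
have u2x2 := r _ _ (rel_u2x2 _ _ _ _ _ _ _).
have x2x21 := r _ _ (rel_x2x21 _ _ _ _ _ _ _).
have u2u21 := r _ _ (rel_u2u21 _ _ _ _ _ _ _).
have g'x1 : e Gen_ginv * e Gen_x1 = e Gen_x1 * e Gen_ginv.
  by rewrite (conj _ (e Gen_x1) 0) ?mulr0 ?addr0 ?mul0r ?subr0.
have zg' : e Gen_zeta * e Gen_ginv = e Gen_ginv * e Gen_zeta.
  by rewrite (conj _ (e Gen_zeta) 0) ?mulr0 ?addr0 ?mul0r ?subr0.
have u1g' : e Gen_u1 * e Gen_ginv = e Gen_ginv * e Gen_u1.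
  by rewrite (conj _ (e Gen_u1) 0) ?mulr0 ?addr0 ?mul0r ?subr0.
have g'x2 : e Gen_ginv * e Gen_x2
    = e Gen_x2 * e Gen_ginv + e Gen_x1 * e Gen_ginv.
  by rewrite (conj _ (e Gen_x2) (- e Gen_x1)) ?mulNr ?opprK // mulrN gx1 gx2.
have u2g' : e Gen_u2 * e Gen_ginv
    = e Gen_ginv * e Gen_u2 + e Gen_ginv * e Gen_u1.
  rewrite -u1g' (conj _ (e Gen_u2) (e Gen_u1)) ?subrK //.
  by rewrite u2g subrK.
rewrite expr2 in x1x1; rewrite expr2 in u1u1.
rewrite ?addrA in u1x2; rewrite ?addrA in u2x1; rewrite ?addrA in u2x2.
move=> a b c; case: a; case: b => //= -[<-];
  by rewrite ?big_cons ?big_nil /= ?mulr1z ?mulrN1z ?(mulr1, addr0) ?addrA.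
Qed.

(** The remaining rules only involve x21 and u21, hence become identities in the other
    letters once these are unfolded; the basic rules then decide them. *)
Fact Drules_hold : rules_hold letter_val Drule.
Proof.
move=> a b c R.
case B: (basic_rule a b) => [c'|].
  have -> : c = c'.
    by apply: Some_inj; rewrite -R -B; case: a b R B => -[].
  exact: basic_rules_hold.
pose rhs := foldr (fun x => NAdd (if x.1 is Negz n then
    NOpp (NMuln (unfold_word x.2) n.+1) else NMuln (unfold_word x.2) (absz x.1))) NZero c.
transitivity (neval letter_val rhs); last first.
  rewrite /rhs; elim: (c) => [|[n w] c1 /= ->]; first by rewrite big_nil.
  rewrite big_cons; congr (_ + _); case: n => n /=; by rewrite neval_unfold_word.
rewrite -[letter_val a]neval_unfold -[letter_val b]neval_unfold.
rewrite -[LHS]/(neval letter_val (NMul (unfold_letter a) (unfold_letter b))).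
apply: (neval_check (n := 8) basic_rules_hold).
apply/nilP; move: R B; rewrite {}/rhs; case: a; case: b => //= -[<-] _;
  by vm_compute.
Qed.

End Representation.

(** * The Poincare-Birkhoff-Witt theorem *)

(** Turns a ring expression in the generators into an expression on which rewriting can be
    computed. *)
Ltac quote_letters e t :=
  lazymatch t with
  | letter_val e ?a => constr:(NVar a)
  | e Gen_x1 => constr:(NVar X1)
  | e Gen_x2 => constr:(NVar X2)
  | e Gen_u1 => constr:(NVar U1)
  | e Gen_u2 => constr:(NVar U2)
  | e Gen_g => constr:(NVar G)
  | e Gen_ginv => constr:(NVar G')
  | e Gen_zeta => constr:(NVar Zt)
  | ?a + ?b => let x := quote_letters e a in let y := quote_letters e b in
               constr:(NAdd x y)
  | - ?a => let x := quote_letters e a in constr:(NOpp x)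
  | ?a ^+ 2 => let x := quote_letters e a in constr:(NMul x x)
  | ?a *+ ?n => let x := quote_letters e a in constr:(NMuln x n)
  | ?a * ?b => let x := quote_letters e a in let y := quote_letters e b in
               constr:(NMul x y)
  | 1 => constr:(@NOne letter)
  | 0 => constr:(@NZero letter)
  end.

Section FreeAction.
Variables (k : fieldType) (I : choiceType) (V : lmodType k).
Variable op : I -> {linear V -> V}.
Local Notation F := (free_algebra k I).

Definition free_act (v : V) : {linear {malg k[{fmonom I}]} -> V} :=
  lin_ext (fun w : {fmonom I} => word_act op (fmonom_val w) v).

Lemma free_actU v w : free_act v << w >> = word_act op (fmonom_val w) v.
Proof. exact: lin_extU. Qed.

Lemma free_act1 v : free_act v (1 : F) = v.
Proof. by rewrite [LHS]free_actU fm1. Qed.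

Lemma free_actM v (a b : F) : free_act v (a * b) = free_act (free_act v b) a.
Proof.
have key w w' : free_act v ((<< w >> : F) * << w' >>) = free_act (free_act v << w' >>) << w >>.
  rewrite malgM_def fgmulUU mulr1 !free_actU -word_act_cat.
  by rewrite fmM.
have linr w : free_act v (<< w >> * b) = free_act (free_act v b) << w >>.
  pose f1 (x : {malg k[{fmonom I}]}) := free_act v ((<< w >> : F) * (x : F)).
  pose f2 (x : {malg k[{fmonom I}]}) := word_act op (fmonom_val w) (free_act v x).
  rewrite [RHS]free_actU -/(f1 b) -/(f2 b).
  have f1l : linear f1.
    by move=> c x y; rewrite /f1 mulrDr -(@free_algebra_scaleAr _ _ c << w >> x) linearP.
  have f2l : linear f2 by move=> c x y; rewrite /f2 !linearP.
  pose g1 : {linear _ -> _} := HB.pack f1 (GRing.isLinear.Build k _ _ *:%R f1 f1l).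
  pose g2 : {linear _ -> _} := HB.pack f2 (GRing.isLinear.Build k _ _ *:%R f2 f2l).
  apply: (@eq_linear_malg _ _ _ g1 g2) => w'; rewrite /g1 /g2 /= /f1 /f2 key.
  by rewrite free_actU.
pose f1 (x : {malg k[{fmonom I}]}) := free_act v ((x : F) * b).
have f1l : linear f1.
  by move=> c x y; rewrite /f1 mulrDl -scalerAl linearP.
pose g1 : {linear _ -> _} := HB.pack f1 (GRing.isLinear.Build k _ _ *:%R f1 f1l).
exact: (@eq_linear_malg _ _ _ g1 (free_act (free_act v b)) linr).
Qed.

Lemma free_act_var v i : free_act v (free_var k i) = op i v.
Proof. by rewrite [LHS]free_actU fmU. Qed.

Lemma free_act0 a : free_act 0 a = 0.
Proof.
rewrite /free_act /= lin_extE big1 // => w _.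
by rewrite linear0 scaler0.
Qed.

End FreeAction.

Section RelationWords.
Variables (k : fieldType) (A : algType k) (e : generator -> A).

(** Checking the relations on normal forms is what makes an action of the letters that
    obeys the rules descend from the free algebra to the algebra with the relations. *)
Lemma relation_reduce l r :
  relation (e Gen_x1) (e Gen_x2) (e Gen_u1) (e Gen_u2) (e Gen_g) (e Gen_ginv)
    (e Gen_zeta) l r ->
  exists el er, [/\ l = neval (letter_val e) el, r = neval (letter_val e) er
    & reduce Drule 8 (comb_sub (ncomb el) (ncomb er)) = [::]].
Proof.
case; match goal with |- exists el er, [/\ ?l = _, ?r = _ & _] =>
  let el := quote_letters e l in let er := quote_letters e r in
  exists el, er end; by split.
Qed.

End RelationWords.

Section Morphisms.
Variables (k : fieldType) (A B : algType k) (f : {rmorphism A -> B}).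
Variable e : generator -> A.

Lemma letter_val_morph a : letter_val (fun x => f (e x)) a = f (letter_val e a).
Proof. by case: a => //=; rewrite rmorphD !rmorphM. Qed.

Lemma prod_letter_morph u : \prod_(a <- u) letter_val (fun x => f (e x)) a
  = f (\prod_(a <- u) letter_val e a).
Proof. by rewrite rmorph_prod; apply: eq_bigr => a _; exact: letter_val_morph. Qed.

End Morphisms.

Lemma neval_prod (k : fieldType) (A : algType k) (e : letter -> A) u :
  neval e (foldr (fun a => NMul (NVar a)) NOne u) = \prod_(a <- u) e a.
Proof. by elim: u => [|a u /= ->]; rewrite ?big_nil ?big_cons. Qed.

Lemma nact_prod (k : fieldType) (W : lmodType k) (op : letter -> {linear W -> W}) u w :
  nact op (foldr (fun a => NMul (NVar a)) NOne u) w = word_act op u w.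
Proof. by elim: u => //= a u ->. Qed.

Section PBW.
Variable k : fieldType.
Local Notation F := (free_algebra k generator).
Local Notation v := (@free_var k generator).
Local Notation V := {malg k[irr_word Drule]}.

(** The left regular representation on normal forms; it obeys the rules because they
    are confluent. *)
Definition Dop : letter -> {linear V -> V} := @irr_op letter Drule weight k.

Fact Dop_rule a b c : Drule a b = Some c ->
  forall w, Dop a (Dop b w) = comb_act Dop c w.
Proof. by move=> R w; exact: (irr_op_rule weight_mono Drule_decr Drule_confluent). Qed.

Definition generator_letter (x : generator) : letter :=
  match x with
  | Gen_x1 => X1 | Gen_x2 => X2 | Gen_u1 => U1 | Gen_u2 => U2 | Gen_g => G
  | Gen_ginv => G' | Gen_zeta => Zt
  end.

Definition Dact (w : V) : {linear {malg k[{fmonom generator}]} -> V} :=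
  free_act (fun x => Dop (generator_letter x)) w.

Lemma DactD w (a b : F) : Dact w (a + b) = Dact w a + Dact w b.
Proof. exact: linearD. Qed.

Lemma DactB w (a b : F) : Dact w (a - b) = Dact w a - Dact w b.
Proof. exact: linearB. Qed.

Lemma DactZ w c (a : F) : Dact w (c *: a) = c *: Dact w a.
Proof. exact: linearZ. Qed.

Lemma DactM w (a b : F) : Dact w (a * b) = Dact (Dact w b) a.
Proof. exact: free_actM. Qed.

Lemma Dact_neval w ex : Dact w (neval (letter_val v) ex) = nact Dop ex w.
Proof.
have var x u : Dact u (v x) = Dop (generator_letter x) u by exact: free_act_var.
have varM x y u : Dact u (v x * v y)
    = Dop (generator_letter x) (Dop (generator_letter y) u).
  by apply: etrans (DactM _ _ _) _; rewrite [LHS]var (var y).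
have reduceE := nact_check Dop_rule.
elim: ex w => [a||  |e1 IH1 e2 IH2|e1 IH1|e1 IH1 e2 IH2|e1 IH1 n] w.
- case: a; try exact: var.
    apply: etrans (DactD _ _ _) _.
    apply: etrans (congr2 +%R (varM Gen_x2 Gen_x1 w) (varM Gen_x1 Gen_x2 w)) _.
    by apply: (reduceE 4 (NAdd (NMul (NVar X2) (NVar X1)) (NMul (NVar X1) (NVar X2)))
                         (NVar X21)).
  apply: etrans (DactD _ _ _) _.
  apply: etrans (congr2 +%R (varM Gen_u1 Gen_u2 w) (varM Gen_u2 Gen_u1 w)) _.
  by apply: (reduceE 4 (NAdd (NMul (NVar U1) (NVar U2)) (NMul (NVar U2) (NVar U1)))
                       (NVar U21)).
- exact: free_act1.
- exact: linear0.
- by rewrite [LHS]DactD IH1 IH2.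
- by rewrite -[RHS]/(- nact Dop e1 w) -IH1; exact: linearN.
- by rewrite [LHS]DactM IH2 IH1.
- by rewrite -[RHS]/(nact Dop e1 w *+ n) -IH1; exact: linearMn.
Qed.

Lemma Dact_relation w l r : relation (v Gen_x1) (v Gen_x2) (v Gen_u1) (v Gen_u2)
    (v Gen_g) (v Gen_ginv) (v Gen_zeta) l r -> Dact w l = Dact w r.
Proof.
case/relation_reduce=> el [er [-> -> red]]; rewrite !Dact_neval.
by apply: (nact_check Dop_rule); exact: red.
Qed.

Lemma Dact_ideal w a : in_span (two_sided (@relator k)) a -> Dact w a = 0.
Proof.
elim=> [b [c [_ [d [[l r lr] ->]]]] | | b c _ h1 _ h2 | c b _ h].
- apply: etrans (DactM w (c * (l - r)) d) _.
  apply: etrans (DactM (Dact w d) c (l - r)) _.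
  have h : Dact (Dact w d) (l - r) = 0.
    by apply: etrans (DactB _ l r) _; rewrite (Dact_relation _ lr) subrr.
  exact: etrans (congr1 (fun u => Dact u c) h) (free_act0 _ c).
- exact: linear0.
- by apply: etrans (DactD w b c) _; rewrite h1 h2 addr0.
- by apply: etrans (DactZ w c b) _; rewrite h scaler0.
Qed.

Lemma Dgen_relations : satisfies_relations (Dgen k).
Proof. by move=> l r; exact: Dgen_relation. Qed.

Definition Dmodule_act (w : V) (d : Dtilde k) : V := Dact w (repr d).

Lemma Dmodule_actE w (a : F) : Dmodule_act w (Dproj a) = Dact w a.
Proof.
apply/eqP; rewrite -subr_eq0; apply/eqP; apply: etrans (esym (DactB w _ a)) _.
by apply: Dact_ideal; apply/apiE; exact: lpi_repr.
Qed.

Lemma Dproj_surj (d : Dtilde k) : exists a : F, Dproj a = d.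
Proof. by case: (api_surj d) => a <-; exists a. Qed.

Fact Dmodule_act_linear w : linear (Dmodule_act w).
Proof.
move=> c d1 d2; have [a1 <-] := Dproj_surj d1; have [a2 <-] := Dproj_surj d2.
have -> : c *: Dproj a1 + Dproj a2 = Dproj (c *: a1 + a2) by rewrite -linearP.
rewrite !Dmodule_actE; exact: linearP.
Qed.

HB.instance Definition _ w :=
  GRing.isLinear.Build k (Dtilde k) V *:%R (Dmodule_act w) (Dmodule_act_linear w).

Lemma Dmodule_act_word w u :
  Dmodule_act w (\prod_(a <- u) letter_val (Dgen k) a) = word_act Dop u w.
Proof.
apply: etrans (congr1 (Dmodule_act w) (@prod_letter_morph _ _ _ (@Dproj k) v u)) _.
apply: etrans (Dmodule_actE _ _) _.
have E := @neval_prod k F (letter_val v) u.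
apply: etrans (congr1 (fun a : F => Dact w a) (esym E)) _.
exact: etrans (Dact_neval _ _) (nact_prod _ _ _).
Qed.

Lemma Dproj_word (s : seq generator) :
  Dproj (<< FMonom s >> : F) = \prod_(x <- s) Dgen k x.
Proof.
elim: s => [|x s IH].
  rewrite big_nil -[RHS](@rmorph1 _ _ (@Dproj k)); congr (Dproj << _ >>).
  by apply: val_inj; rewrite /= fm1.
rewrite big_cons -IH.
apply: etrans (rmorphM (@Dproj k) (v x) << FMonom s >>); congr (Dproj _).
rewrite malgM_def fgmulUU mulr1; congr << _ >>.
by apply: val_inj; rewrite /= fmM fmU.
Qed.

Lemma Dgen_span (P : Dtilde k -> Prop) :
  P 0 -> (forall x y, P x -> P y -> P (x + y)) -> (forall c x, P x -> P (c *: x)) ->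
  (forall w, P (\prod_(x <- w) Dgen k x)) -> forall d, P d.
Proof.
move=> P0 PD PZ Pw d; have [a <-] := Dproj_surj d.
rewrite (malg_sum a).
have -> : Dproj (\sum_(i <- monalg.msupp a) a@_i *: << i >> : F)
    = \sum_(i <- monalg.msupp a) a@_i *: Dproj (<< i >> : F).
  rewrite (linear_sum (@Dproj k)); apply: eq_bigr => i _; exact: linearZ.
by elim/big_rec: _ => // i x _ Px; apply: PD => //; apply: PZ; case: i => i; rewrite Dproj_word.
Qed.

(** The irreducible words span because rewriting terminates.  They are independent
    because the algebra acts on the free module over them, and an irreducible word sends
    the empty word to itself. *)
Theorem irr_word_basis : bijective (lin_ext (fun u : irr_word Drule =>
  \prod_(a <- val u) letter_val (Dgen k) a)).
Proof.
pose phi : {linear V -> Dtilde k} :=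
  lin_ext (fun u : irr_word Drule => \prod_(a <- val u) letter_val (Dgen k) a).
change (bijective (phi : V -> Dtilde k)).
have actK : cancel phi (Dmodule_act (irr_mon Drule k [::])).
  pose act : {linear Dtilde k -> V} := Dmodule_act (irr_mon Drule k [::]).
  move=> w; rewrite -[LHS]/((act \o phi) w) -[RHS]/((idfun : {linear V -> V}) w).
  apply: eq_linear_malg => u; rewrite /= /phi lin_extU Dmodule_act_word.
  rewrite word_act_irr ?cats0 ?irr_monE //; exact: valP.
exists (Dmodule_act (irr_mon Drule k [::])) => // d.
suff [w <-] : exists w, phi w = d by rewrite actK.
elim/Dgen_span: d => [|x y [w <-] [u <-]|c x [w <-]|w].
- by exists 0; rewrite linear0.
- by exists (w + u); rewrite linearD.
- by exists (c *: w); rewrite linearZ.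
have -> : \prod_(x <- w) Dgen k x
    = \prod_(a <- [seq generator_letter x | x <- w]) letter_val (Dgen k) a.
  by rewrite big_map; apply: eq_bigr => -[].
apply: (irr_word_span weight_mono Drule_decr
  (P := fun d => exists w0, phi w0 = d) (Drules_hold Dgen_relations)).
- by exists 0; rewrite linear0.
- by move=> x y [u <-] [u' <-]; exists (u + u'); rewrite linearD.
- by move=> x n [u <-]; exists (u *~ n); rewrite raddfMz.
- by move=> u iu; exists << exist _ u iu >>; exact: lin_extU.
Qed.

End PBW.

(** * Irreducible words and their exponents *)

Section SortedWords.

Definition ordered_word (n : letter -> nat) : seq letter :=
  flatten [seq nseq (n a) a | a <- letters].

(** The only repetitions and pairs that an irreducible word excludes: x1 and u1 square to
    zero, and g cancels its inverse. *)
Definition admissible (n : letter -> nat) : bool :=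
  [&& n X1 <= 1, n U1 <= 1 & (n G == 0) || (n G' == 0)]%N.

Let good a b : bool := Drule a b == None.

Fact good_trans : transitive good.
Proof. by move=> b a c; case: a; case: b => //; case: c. Qed.

Lemma irreducible_pairwise w : irreducible Drule w = pairwise good w.
Proof.
rewrite -(sorted_pairwise good_trans); elim: w => // a [|b w] // IH.
by rewrite irreducible_cons IH.
Qed.

Lemma pairwise_nseq (T : Type) (r : rel T) n (a : T) : (n <= 1)%N || r a a ->
  pairwise r (nseq n a).
Proof.
case/orP=> [|raa]; first by case: n => // -[].
by elim: n => //= n IH; rewrite all_nseq raa orbT.
Qed.

Lemma pairwise_flatten_nseq (n : letter -> nat) s :
  all (fun a => (n a <= 1)%N || good a a) s ->
  pairwise (fun a b => (n a == 0)%N || (n b == 0)%N || good a b) s ->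
  pairwise good (flatten [seq nseq (n a) a | a <- s]).
Proof.
elim: s => //= a s IH /andP[na ns] /andP[ab ps].
rewrite pairwise_cat pairwise_nseq // IH // !andbT.
apply/allrelP => x y /nseqP[-> na0] /flattenP[l /mapP[b bs ->] /nseqP[-> nb0]].
by have /orP[/orP[/eqP z|/eqP z]|//] := allP ab b bs; rewrite z in na0 nb0.
Qed.

Lemma ordered_word_irreducible n : admissible n -> irreducible Drule (ordered_word n).
Proof.
case/and3P=> n1 n2 n3; rewrite irreducible_pairwise; apply: pairwise_flatten_nseq.
  by rewrite /= n1 n2 !orbT.
by rewrite /= n3 !orbT.
Qed.

Lemma count_ordered_word n a : count_mem a (ordered_word n) = n a.
Proof.
by rewrite /ordered_word /= !count_cat !count_nseq;
   case: a; rewrite /= ?mul0n ?mul1n ?addn0.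
Qed.

Lemma irreducible_ordered w : irreducible Drule w ->
  w = ordered_word (fun a => count_mem a w).
Proof.
rewrite irreducible_pairwise => pw.
pose le a b := (letter_code a <= letter_code b)%N.
have le_trans : transitive le by move=> b a c; exact: leq_trans.
have le_anti : antisymmetric le.
  by move=> a b; rewrite /le -eqn_leq => /eqP/(can_inj letter_codeK).
apply: (sorted_eq le_trans le_anti).
- rewrite (sorted_pairwise le_trans); apply: sub_pairwise pw => a b.
  by case: a; case: b.
- rewrite (sorted_pairwise le_trans) /ordered_word.
  have : pairwise le letters by [].
  elim: letters => //= a s IH /andP[la ls]; rewrite pairwise_cat IH // andbT.
  rewrite pairwise_nseq /le ?leqnn ?orbT // andbT.
  by apply/allrelP => x y /nseqP[-> _] /flattenP[l /mapP[b bs ->] /nseqP[-> _]];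
     exact: allP la b bs.
by apply/allP => a _ /=; rewrite count_ordered_word.
Qed.

Lemma irreducible_admissible w : irreducible Drule w ->
  admissible (fun a => count_mem a w).
Proof.
rewrite irreducible_pairwise => pw.
have le1 a : good a a = false -> (count_mem a w <= 1)%N.
  move=> ga; move: pw; elim: w => //= b w IH /andP[gb /IH].
  case: (b =P a) => // e; subst b; case: (posnP (count_mem a w)) => [->//|].
  by rewrite -has_count has_pred1 => /(allP gb); rewrite ga.
apply/and3P; split; try exact: le1.
apply/negPn; rewrite negb_or -!lt0n -!has_count !has_pred1; apply/negP.
case/andP=> gw gw'; move: pw gw gw'; elim: w {le1} => //= b w IH /andP[gb /IH{}IH].
rewrite !inE => /orP[/eqP e|gw]; first by subst b => /= /(allP gb).
by case/orP=> [/eqP e|]; [subst b; move/(allP gb): gw | exact: IH].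
Qed.

End SortedWords.

(** Exponents of x1, x21, x2, g; then of u1, u21, u2; then of zeta. *)
Definition pbw_index := ((bool * nat * nat * int) * (bool * nat * nat) * nat)%type.

(** The integral exponent of g is spread over the letters g and its inverse. *)
Definition exponent (t : pbw_index) (a : letter) : nat :=
  let: (i, b, c, m, (j, d, e), n) := t in
  match a with
  | X1 => i | X21 => b | X2 => c
  | G => if m is Posz m' then m' else 0
  | G' => if m is Negz m' then m'.+1 else 0
  | Zt => n | U1 => j | U21 => d | U2 => e
  end.

Fact exponent_admissible t : admissible (exponent t).
Proof.
case: t => [[[[[i b] c] m] [[j d] e]] n].
by case: i j m => [] [] [] m'; rewrite /admissible /= ?orbT.
Qed.

Definition pbw_word (t : pbw_index) : irr_word Drule :=
  exist (irreducible Drule) _ (ordered_word_irreducible (exponent_admissible t)).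

Definition word_index (w : irr_word Drule) : pbw_index :=
  let n a := count_mem a (val w) in
  ((n X1 == 1, n X21, n X2, if n G' is m.+1 then Negz m else Posz (n G)),
   (n U1 == 1, n U21, n U2), n Zt)%N.

Fact pbw_wordK : cancel pbw_word word_index.
Proof.
case=> [[[[[i b] c] m] [[j d] e]] n]; rewrite /word_index /= !count_ordered_word /=.
by case: i j m => [] [] [].
Qed.

Fact word_indexK : cancel word_index pbw_word.
Proof.
case=> w iw; apply: val_inj; rewrite [RHS](irreducible_ordered iw) /=.
congr flatten; apply: eq_map => a; congr nseq.
have /and3P[n1 n2 n3] := irreducible_admissible iw.
move: n1 n2 n3; rewrite /exponent /word_index /=.
case: a => //=.
- by case: (count_mem X1 w) => [|[]].
- by case: (count_mem G' w) => [|m] //; rewrite orbF => _ _ /eqP ->.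
- by case: (count_mem G' w).
- by case: (count_mem U1 w) => [|[]].
Qed.

(** * Bases, isomorphisms and free modules *)

Section Bases.
Variable k : fieldType.

Definition is_basis (I : choiceType) (W : lmodType k) (b : I -> W) : Prop :=
  injective (lin_ext b) /\ forall w, exists v, lin_ext b v = w.

Lemma linear_injective (U W : lmodType k) (f : {linear U -> W}) :
  (forall u, f u = 0 -> u = 0) -> injective f.
Proof.
move=> f0 u v fuv; apply/eqP; rewrite -subr_eq0; apply/eqP/f0.
by rewrite linearB fuv subrr.
Qed.

Lemma is_basis_comp (I J : choiceType) (W : lmodType k) (b : I -> W)
    (h : J -> {malg k[I]}) :
  is_basis b -> is_basis h -> is_basis (fun j => lin_ext b (h j)).
Proof.
move=> [bi bs] [hi hs].
have E v : lin_ext (fun j => lin_ext b (h j)) v = lin_ext b (lin_ext h v).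
  apply: (@eq_linear_malg _ _ _ (lin_ext _) (lin_ext b \o lin_ext h)) => j.
  by rewrite /= !lin_extU.
split=> [u v|w]; first by rewrite !E => /bi/hi.
by have [u <-] := bs w; have [v <-] := hs u; exists v.
Qed.

Lemma is_basis_reindex (I J : choiceType) (W : lmodType k) (b : I -> W) (h : J -> I) :
  bijective h -> is_basis b -> is_basis (b \o h).
Proof.
case=> g hg gh Bb.
have : is_basis (fun j => << h j >> : {malg k[I]}).
  have cancel_ext (K K' : choiceType) (f : K -> K') f' : cancel f f' ->
      cancel (lin_ext (fun j => << f j >> : {malg k[K']}))
             (lin_ext (fun j => << f' j >> : {malg k[K]})).
    move=> ff' v.
    apply: (@eq_linear_malg _ _ _ (lin_ext _ \o lin_ext _) idfun) => j.
    by rewrite /= !lin_extU ff'.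
  split; first by apply: can_inj; exact: cancel_ext hg.
  by move=> w; exists (lin_ext (fun i => << g i >>) w); apply: cancel_ext.
move/(is_basis_comp Bb); rewrite (_ : (fun j => _) = b \o h) //.
by apply/funext => j; rewrite lin_extU.
Qed.

(** Replacing the powers of a variable by monic polynomials of the same degrees. *)
Lemma is_basis_triangular (C : choiceType) (W : lmodType k)
    (b b' : (C * nat)%type -> W) (P : nat -> {poly k}) :
  (forall n, P n \is monic) -> (forall n, size (P n) = n.+1) ->
  (forall c n, b' (c, n) = \sum_(i < n.+1) (P n)`_i *: b (c, i : nat)) ->
  is_basis b -> is_basis b'.
Proof.
move=> Pm Ps b'E Bb.
pose h (cn : (C * nat)%type) : {malg k[(C * nat)%type]} :=
  \sum_(i < cn.2.+1) (P cn.2)`_i *: << (cn.1, i : nat) >>.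
suff Bh : is_basis h.
  rewrite (_ : b' = fun cn => lin_ext b (h cn)); first exact: is_basis_comp.
  apply/funext => -[c n]; rewrite b'E linear_sum; apply: eq_bigr => i _.
  by rewrite linearZ /= lin_extU.
have lead n : (P n)`_n = 1 by have /monicP := Pm n; rewrite lead_coefE Ps.
have coef_h c n j : (h j)@_(c, n) = (P j.2)`_n *+ (j.1 == c).
  rewrite /h raddf_sum /=; case: (ltnP n j.2.+1) => nj; last first.
    rewrite nth_default ?Ps // mul0rn big1 // => i _.
    rewrite mcoeffZ mcoeffU xpair_eqE [_ == n](_ : _ = false) ?andbF ?mulr0 //.
    by apply/eqP => e; move: nj; rewrite -e leqNgt ltn_ord.
  rewrite (bigD1 (Ordinal nj)) //= big1 ?addr0.
    by rewrite mcoeffZ mcoeffU xpair_eqE eqxx andbT mulr_natr.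
  move=> i ni; rewrite mcoeffZ mcoeffU xpair_eqE [_ == n](_ : _ = false) ?andbF ?mulr0 //.
  by apply/eqP => e; case/eqP: ni; apply: val_inj.
split.
  apply: (@linear_injective _ _ (lin_ext h)) => v hv0.
  have [v0|[j0 j0v]] := fset_0Vmem (monalg.msupp v).
    by rewrite [v]malg_sum v0 big_seq_fset0.
  (* The coefficient of a term of top degree in the last index cannot cancel. *)
  pose has_deg n := has (fun j : (C * nat)%type => j.2 == n) (monalg.msupp v).
  have deg_bound n : has_deg n -> (n <= \max_(j <- monalg.msupp v) j.2)%N.
    by case/hasP=> j jv /eqP <-; rewrite (big_rem j jv) /= leq_maxl.
  have deg_ex : exists n, has_deg n by exists j0.2; apply/hasP; exists j0.
  have [n /hasP[[c n'] jv /= /eqP e] nmax] := ex_maxnP deg_ex deg_bound.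
  subst n'; have := congr1 (mcoeff (c, n)) hv0.
  rewrite mcoeff0 /= lin_extE raddf_sum /= (bigD1_seq (c, n)) ?fset_uniq //= big_seq_cond.
  rewrite mcoeffZ coef_h lead eqxx mulr1 big1 ?addr0.
    by move/eqP; rewrite mcoeff_eq0 jv.
  case=> c' m /andP[jv' nj]; rewrite mcoeffZ coef_h /=.
  have : (m <= n)%N by apply: nmax; apply/hasP; exists (c', m).
  rewrite leq_eqVlt => /predU1P[e|mn]; last by rewrite nth_default ?Ps // mul0rn mulr0.
  by subst m; move: nj; rewrite xpair_eqE eqxx andbT => /negPf ->; rewrite mulr0.
have hsurj n c : exists v, lin_ext h v = << (c, n) >>.
  elim/ltn_ind: n => n IH.
  have [F FE] : exists F : nat -> {malg k[(C * nat)%type]},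
      forall i, (i < n)%N -> lin_ext h (F i) = << (c, i) >>.
    have H i : exists v, (i < n)%N -> lin_ext h v = << (c, i) >>.
      by case: (ltnP i n) => [/IH[v <-]|_]; [exists v | exists 0].
    by have [F FE] := boolp.choice H; exists F.
  exists (<< (c, n) >> - \sum_(i < n) (P n)`_i *: F i).
  have hE : h (c, n) = \sum_(i < n) (P n)`_i *: << (c, i : nat) >> + << (c, n) >>.
    by rewrite /h big_ord_recr /= lead scale1r.
  rewrite linearB linear_sum /= lin_extU hE.
  apply: (canLR (addrK _)); rewrite addrC; congr (_ + _).
  by apply: eq_bigr => i _; rewrite linearZ /= FE.
move=> w; rewrite [w]malg_sum.
elim/big_rec: _ => [|[c n] u _ [v <-]]; first by exists 0; rewrite linear0.
by have [v' <-] := hsurj n c; exists (w@_(c, n) *: v' + v); rewrite linearP.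
Qed.

Lemma is_basis_ind (I : choiceType) (W : lmodType k) (b : I -> W) :
  is_basis b -> forall P : W -> Prop, P 0 -> (forall c x y, P x -> P y -> P (c *: x + y)) ->
  (forall i, P (b i)) -> forall w, P w.
Proof.
case=> _ sb P P0 PD Pb w; have [v <-] := sb w; rewrite lin_extE.
by elim/big_rec: _ => // i x _ Px; exact: PD.
Qed.

Lemma is_basis_malg (I : choiceType) : is_basis (fun i : I => << i >> : {malg k[I]}).
Proof.
have idE v : lin_ext (fun i : I => << i >> : {malg k[I]}) v = v.
  by rewrite lin_extE -malg_sum.
by split=> [v w|w]; [rewrite !idE | exists w].
Qed.

Lemma is_basis_inv (I : choiceType) (W : lmodType k) (b : I -> W) : is_basis b ->
  exists g : {linear W -> {malg k[I]}}, cancel (lin_ext b) g /\ cancel g (lin_ext b).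
Proof.
case=> ib sb; have [g gK] := boolp.choice sb.
have Kg : cancel (lin_ext b) g by move=> v; apply: ib; rewrite gK.
have gl : linear g.
  by move=> c x y; apply: ib; rewrite linearP /= !gK.
pose G : {linear W -> {malg k[I]}} :=
  HB.pack g (GRing.isLinear.Build k W {malg k[I]} *:%R g gl).
by exists G.
Qed.

(** The isomorphisms from Z to the Laurent polynomials and to the regular functions on the
    group both come from bases of monomials. *)
Lemma monomial_basis_iso (A B : algType k) (Q : choiceType) (mul : Q -> Q -> Q)
    (one : Q) (a : Q -> A) (b : Q -> B) : is_basis a -> is_basis b ->
  (forall q r, a q * a r = a (mul q r)) -> (forall q r, b q * b r = b (mul q r)) ->
  a one = 1 -> b one = 1 ->
  exists2 f : {lrmorphism A -> B}, bijective f & forall q, f (a q) = b q.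
Proof.
move=> Ba Bb aM bM a1 b1.
have [g [Kg gK]] := is_basis_inv Ba; have [g' [Kg' gK']] := is_basis_inv Bb.
pose F : {linear A -> B} := lin_ext b \o g.
have Fa q : F (a q) = b q.
  by rewrite -(lin_extU a) /F /= Kg lin_extU.
have FM x y : F (x * y) = F x * F y.
  elim/(is_basis_ind Ba): x => [|c x x' IH IH'|q]; first by rewrite mul0r linear0 mul0r.
    by rewrite mulrDl -scalerAl !linearP IH IH' mulrDl scalerAl.
  elim/(is_basis_ind Ba): y => [|c y y' IH IH'|r]; first by rewrite mulr0 linear0 mulr0.
    by rewrite mulrDr -scalerAr !linearP IH IH' mulrDr scalerAr.
  by rewrite aM !Fa bM.
have F1 : F 1 = 1 by rewrite -a1 Fa.
pose F0 : A -> B := F.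
have F0l : linear F0 by move=> c x y; rewrite /F0 linearP.
have F0m : monoid_morphism F0 by split.
pose F' : {lrmorphism A -> B} := HB.pack F0 (GRing.isLinear.Build k A B *:%R F0 F0l)
  (GRing.isMonoidMorphism.Build A B F0 F0m).
exists F' => //.
exists (lin_ext a \o g') => x.
  exact: etrans (congr1 (lin_ext a) (Kg' _)) (gK x).
exact: etrans (congr1 (lin_ext b) (Kg _)) (gK' x).
Qed.

Lemma lin_ext_mul (A : algType k) (Q : choiceType) (mul : Q -> Q -> Q) (a : Q -> A) :
  (forall q r, a q * a r = a (mul q r)) ->
  forall w w', exists u, lin_ext a u = lin_ext a w * lin_ext a w'.
Proof.
move=> aM w w'.
elim/(is_basis_ind (is_basis_malg Q)): w => [|c u v [u' hu] [v' hv]|q].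
- by exists 0; rewrite !linear0 mul0r.
- by exists (c *: u' + v'); rewrite !linearP /= hu hv mulrDl scalerAl.
rewrite lin_extU.
elim/(is_basis_ind (is_basis_malg Q)): w' => [|c u v [u' hu] [v' hv]|r].
- by exists 0; rewrite !linear0 mulr0.
- by exists (c *: u' + v'); rewrite !linearP /= hu hv mulrDr scalerAr.
by exists << mul q r >>; rewrite !lin_extU aM.
Qed.

Lemma subalg_basis (A : algType k) (S : A -> Prop) (Q : choiceType) (zm : Q -> A)
    (zm_in : forall q, zm q \in subalg_of S) :
  (forall z, z \in subalg_of S -> exists w, lin_ext zm w = z) ->
  injective (lin_ext zm) -> is_basis (fun q => Subalg (zm_in q) : subalg S).
Proof.
move=> zm_span zm_inj.
have valE w : val (lin_ext (fun q => Subalg (zm_in q) : subalg S) w) = lin_ext zm w.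
  elim/(is_basis_ind (is_basis_malg Q)): w => [|c w w' IH IH'|q].
  - by rewrite !linear0.
  - by rewrite !linearP /= IH IH'.
  - by rewrite !lin_extU.
split=> [w w' /(congr1 val)|z]; first by rewrite !valE => /zm_inj.
by have [w wE] := zm_span _ (valP z); exists w; apply: val_inj; rewrite valE.
Qed.

Section FreeModule.
Variables (A : algType k) (S : A -> Prop) (Q : choiceType) (R : finType).
Variables (zm : Q -> A) (rm : R -> A).
Hypothesis zm_in : forall q, zm q \in subalg_of S.
Hypothesis zm_span : forall z, z \in subalg_of S -> exists w, lin_ext zm w = z.
Hypothesis basis : is_basis (fun qr : Q * R => zm qr.1 * rm qr.2).

Let embed (r : R) : {linear {malg k[Q]} -> {malg k[(Q * R)%type]}} :=
  lin_ext (fun q => << (q, r) >>).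

Let project (r : R) : {linear {malg k[(Q * R)%type]} -> {malg k[Q]}} :=
  lin_ext (fun qr => if qr.2 == r then << qr.1 >> else 0).

Let embedK r r' w : project r (embed r' w) = if r' == r then w else 0.
Proof.
elim/(is_basis_ind (is_basis_malg Q)): w => [|c w w' IH IH'|q].
- by rewrite !linear0 if_same.
- by rewrite !linearP IH IH'; case: ifP => // _; rewrite scaler0 addr0.
- by rewrite /embed /project /= !lin_extU.
Qed.

Let B : {linear {malg k[(Q * R)%type]} -> A} :=
  lin_ext (fun qr : Q * R => zm qr.1 * rm qr.2).

Let B_inj : injective B. Proof. exact: basis.1. Qed.

Let embedE r w : B (embed r w) = lin_ext zm w * rm r.
Proof.
elim/(is_basis_ind (is_basis_malg Q)): w => [|c w w' IH IH'|q].
- by rewrite !linear0 mul0r.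
- by rewrite !linearP IH IH' mulrDl scalerAl.
- by rewrite /B /embed /= !lin_extU.
Qed.

(** A basis of products, in which one factor runs through a basis of the subalgebra, makes
    the other factors a module basis; a finite function records the coordinates. *)
Lemma free_over_subalg d :
  exists! c : {ffun 'I_#|R| -> subalg S}, d = \sum_i val (c i) * rm (enum_val i).
Proof.
pose P d := exists c : {ffun 'I_#|R| -> subalg S},
  d = \sum_i val (c i) * rm (enum_val i).
have [c dE] : P d.
  elim/(is_basis_ind basis): d => [|a x y [c ->] [c' ->]|[q r]].
  - by exists [ffun => 0]; rewrite big1 // => i _; rewrite ffunE mul0r.
  - exists [ffun i => a *: c i + c' i]; rewrite scaler_sumr -big_split.
    by apply: eq_bigr => i _; rewrite ffunE /= mulrDl scalerAl.
  exists [ffun i => if i == enum_rank r then Subalg (zm_in q) else 0].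
  rewrite (bigD1 (enum_rank r)) //= ffunE eqxx enum_rankK big1 ?addr0 // => i ni.
  by rewrite ffunE (negPf ni) mul0r.
exists c; split=> // c' dE'; apply/ffunP => i; apply: val_inj => /=.
have coords (f : {ffun 'I_#|R| -> subalg S}) :
    exists w, forall j, lin_ext zm (w j) = val (f j).
  by have [w wE] := boolp.choice (fun j => zm_span (valP (f j))); exists w.
have [[w wE] [w' wE']] := (coords c, coords c').
rewrite -wE -wE'; congr (lin_ext zm).
have sumE f : B (\sum_j embed (enum_val j) (f j))
    = \sum_j lin_ext zm (f j) * rm (enum_val j).
  by rewrite linear_sum; apply: eq_bigr => j _; exact: embedE.
have : \sum_j embed (enum_val j) (w j) = \sum_j embed (enum_val j) (w' j).
  apply: B_inj; rewrite !sumE.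
  under eq_bigr do rewrite wE; under [RHS]eq_bigr do rewrite wE'.
  by rewrite -dE -dE'.
move/(congr1 (project (enum_val i))); rewrite !linear_sum.
have pick f : \sum_j project (enum_val i) (embed (enum_val j) (f j)) = f i.
  rewrite (bigD1 i) //= embedK eqxx big1 ?addr0 // => j nj.
  by rewrite embedK (inj_eq enum_val_inj) (negPf nj).
by rewrite !pick.
Qed.

(** If one of the module generators is 1, then the first factors are themselves independent. *)
Lemma free_factor_inj r0 : rm r0 = 1 -> injective (lin_ext zm).
Proof.
move=> rm1 w w' ww'; have : B (embed r0 w) = B (embed r0 w') by rewrite !embedE ww'.
by move/B_inj/(congr1 (project r0)); rewrite !embedK eqxx.
Qed.

End FreeModule.

End Bases.

(** * Derivations and p-th powers of sums *)

Section Derivations.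
Variable A : nzRingType.
Implicit Types a b c : A.

Definition ad a b : A := a * b - b * a.

Lemma ad_mul a b c : ad a (b * c) = ad a b * c + b * ad a c.
Proof. by rewrite /ad mulrBl mulrBr !mulrA addrA subrK. Qed.

Lemma ad0P a b : ad a b = 0 <-> a * b = b * a.
Proof. by rewrite /ad; split=> [/eqP|->]; rewrite ?subrr // subr_eq0 => /eqP. Qed.

Lemma adMn a b n : ad a (b *+ n) = ad a b *+ n.
Proof. by rewrite /ad mulrnAr mulrnAl mulrnBl. Qed.

Lemma adD a b c : ad a (b + c) = ad a b + ad a c.
Proof. by rewrite /ad mulrDr mulrDl opprD addrACA. Qed.

Lemma adN a b : ad a (- b) = - ad a b.
Proof. by rewrite /ad mulrN mulNr -opprD. Qed.

Lemma ad0 a : ad a 0 = 0.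
Proof. by rewrite /ad mulr0 mul0r subrr. Qed.

Lemma ad_sum a (I : Type) (r : seq I) (P : pred I) (F : I -> A) :
  ad a (\sum_(i <- r | P i) F i) = \sum_(i <- r | P i) ad a (F i).
Proof. by rewrite /ad mulr_sumr mulr_suml -sumrB. Qed.

(** Left multiplication by a + b sends x a ^ m to (b x + [a, x]) a ^ m + x a ^ m.+1, as the
    sum of two commuting operators on symbols; this is the binomial theorem for them. *)
Lemma leibniz_exp a b (P : nat -> A) n :
  (forall m, P m.+1 = b * P m + ad a (P m)) ->
  (a + b) ^+ n * P 0%N = \sum_(i < n.+1) (P i * a ^+ (n - i)) *+ 'C(n, i).
Proof.
move=> PS; elim: n => [|n IH].
  by rewrite big_ord1 expr0 mul1r mulr1.
rewrite exprS -mulrA {}IH mulr_sumr.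
have step (i : 'I_n.+1) : (a + b) * ((P i * a ^+ (n - i)) *+ 'C(n, i))
    = (P i * a ^+ (n.+1 - i)) *+ 'C(n, i) + (P i.+1 * a ^+ (n - i)) *+ 'C(n, i).
  rewrite -mulrnDl mulrnAr; congr (_ *+ _).
  have le_in : (i <= n)%N by rewrite -ltnS.
  rewrite PS subSn // exprS /ad !mulrDl mulNr !mulrA.
  by rewrite [RHS]addrC -addrA subrK addrC.
rewrite (eq_bigr _ (fun i _ => step i)) big_split /=.
rewrite [RHS]big_ord_recl [X in X + _ = _]big_ord_recl /= !bin0 -addrA; congr (_ + _).
rewrite [X in _ + X]big_ord_recr [RHS]big_ord_recr /= addrA !binn.
congr (_ + _).
rewrite -big_split; apply: eq_bigr => i _ /=.
by rewrite /bump /= add1n subSS -mulrnDr binS.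
Qed.

Variable p : nat.
Hypothesis charA : p \in [pchar A].

(** In characteristic p all binomial coefficients but the extreme ones vanish. *)
Lemma leibniz_expp a b (P : nat -> A) :
  (forall m, P m.+1 = b * P m + ad a (P m)) ->
  (a + b) ^+ p * P 0%N = P 0%N * a ^+ p + P p.
Proof.
move=> PS; have p_pr := pcharf_prime charA; have p_gt0 := prime_gt0 p_pr.
have n0 : (ord_max : 'I_p.+1) != ord0 by rewrite -val_eqE /= -lt0n.
rewrite (leibniz_exp p PS) (bigD1 ord0) //= (bigD1 ord_max) //=.
rewrite subn0 subnn bin0 binn !mulr1n mulr1 big1 ?addr0 // => i /andP[i0 im].
rewrite -mulr_natr bin_lt_pcharf_0 ?mulr0 // lt0n i0 ltn_neqAle im -ltnS ltn_ord //.
Qed.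

Lemma ad_expp_comm a b : iter p (ad a) b = 0 -> a ^+ p * b = b * a ^+ p.
Proof.
move=> h; have := @leibniz_expp a 0 (fun n => iter n (ad a) b).
by rewrite addr0 /= h addr0; apply=> m; rewrite mul0r add0r.
Qed.

(** As ad (a ^ p) = (ad a) ^ p in characteristic p. *)
Lemma ad_expp_nilp a b n : (n <= p)%N -> iter n (ad a) b = 0 ->
  a ^+ p * b = b * a ^+ p.
Proof.
move=> np h; apply: ad_expp_comm; rewrite -(subnK np) iterD h.
by elim: (p - n)%N => //= m ->; rewrite ad0.
Qed.

(** The computations below take place in algebras generated by elements a, T, B with
    ad a T = T ^ 2 and ad a B = r T B, as for a vector field T ^ 2 d/dT and a function
    B homogeneous of degree r in T. *)
Section Homogeneous.
Variables (a T B : A) (r : nat).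
Hypothesis adT : ad a T = T ^+ 2.
Hypothesis adB : ad a B = (T * B) *+ r.

Lemma ad_homogeneous_exp n : ad a (T ^+ n) = T ^+ n.+1 *+ n.
Proof.
elim: n => [|n IH]; first by rewrite expr0 /ad mulr1 mul1r subrr mulr0n.
by rewrite exprS ad_mul IH adT mulrnAr -exprS -exprD mulrS.
Qed.

Lemma ad_homogeneous n : ad a (T ^+ n * B) = (T ^+ n.+1 * B) *+ (n + r).
Proof.
rewrite ad_mul ad_homogeneous_exp adB mulrnAl mulrnAr mulrA -exprSr.
by rewrite -mulrnDr.
Qed.

(** Rising factorials are the coefficients of iterated derivations; in characteristic p they
    vanish as soon as the range of the factors meets p. *)
Definition rising (m n : nat) := (\prod_(i < n) (m + i))%N.

Lemma iter_ad_homogeneous n : iter n (ad a) B = (T ^+ n * B) *+ rising r n.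
Proof.
elim: n => [|n IH]; first by rewrite /rising big_ord0 mul1r.
by rewrite iterS IH adMn ad_homogeneous -mulrnA /rising big_ord_recr /= addnC mulnC.
Qed.

End Homogeneous.

Lemma rising_pchar m n : (m <= p < m + n)%N -> (rising m n)%:R = 0 :> A.
Proof.
move=> /andP[mp pn]; have h : (p - m < n)%N by rewrite ltn_subLR.
rewrite /rising (bigD1 (Ordinal h)) //= subnKC // natrM.
by rewrite (pcharf0 charA) mul0r.
Qed.

(** The coefficients, called Lah numbers, of the products T ^ (n - j) * B ^ j that arise when
    (a + B) ^ n is expanded. *)
Fixpoint lah (n j : nat) : nat :=
  match n, j with
  | 0, 0 => 1
  | n'.+1, j'.+1 => lah n' j' + (n' + j) * lah n' j
  | _, _ => 0
  end.

Lemma lah_small n j : (n < j)%N -> lah n j = 0%N.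
Proof.
elim: n j => [|n IH] [|j] //= nj; rewrite !IH ?muln0 //; exact: ltnW.
Qed.

Lemma lah_fact n j : (lah n.+1 j.+1 * j.+1`! = n.+1`! * 'C(n, j))%N.
Proof.
elim: n j => [|n IH] j; first by case: j => [|j] //=; rewrite !muln0.
rewrite -[lah _ _]/(lah n.+1 j + (n.+1 + j.+1) * lah n.+1 j.+1)%N mulnDl -mulnA IH.
case: j => [|j]; first by rewrite /= !bin0 mul0n !muln1 addn1 [in RHS]factS.
rewrite [j.+2`!]factS mulnCA IH [n.+2`!]factS.
rewrite binS; have E : (j.+2 * 'C(n, j) + (n.+1 + j.+2) * 'C(n, j.+1)
    = n.+2 * ('C(n, j.+1) + 'C(n, j)))%N.
  have [jn|nj] := leqP j n; last by rewrite !bin_small ?muln0 // ltnW.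
  by have := mul_bin_left n j; rewrite mulnBl; have := leq_mul2r 'C(n, j) j n; nia.
by rewrite -mulnA -[in RHS]mulnCA -E; ring.
Qed.

(** By the closed formula for Lah numbers, p divides all of them but the last. *)
Lemma lah_pchar j : (0 < j < p)%N -> (lah p j)%:R = 0 :> A.
Proof.
case: j => // j /andP[_ jp]; have p_pr := pcharf_prime charA.
apply/eqP; rewrite -(dvdn_pcharf charA).
have : (p %| lah p j.+1 * j.+1`!)%N.
  have := lah_fact p.-1 j; rewrite prednK ?prime_gt0 // => ->.
  by rewrite dvdn_mulr // dvdn_fact // prime_gt0 /=.
rewrite Euclid_dvdM // => /orP[//|]; rewrite fact_prod Euclid_dvd_prod //.
rewrite big_has => /hasP[i]; rewrite mem_index_iota ltnS => /andP[i0 ij] /dvdn_leq.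
by move/(_ i0); rewrite leqNgt (leq_ltn_trans ij jp).
Qed.

(** With ad a T = T ^ 2 and B of degree 2, the correction terms to the power of a + B are
    sums of products of T and B weighted by Lah numbers.  This is what makes the squares
    of x2 and u2, whose commutators do not vanish, additive after a p-th power. *)
Lemma expp_add_homogeneous a T B : T * B = B * T ->
  ad a T = T ^+ 2 -> ad a B = (T * B) *+ 2 -> (a + B) ^+ p = a ^+ p + B ^+ p.
Proof.
move=> TB adT adB; have p_gt0 := prime_gt0 (pcharf_prime charA).
have adBj j : ad a (B ^+ j) = (T * B ^+ j) *+ (2 * j).
  elim: j => [|j IH]; first by rewrite /ad mulr1 mul1r subrr muln0 mulr0n.
  rewrite exprS ad_mul IH adB mulrnAr mulrnAl !mulrA -TB -mulrnDr; congr (_ *+ _).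
  by rewrite mulnS.
(* The normally ordered coefficients of the expansion of (a + B) ^ n. *)
pose P n := \sum_(j < n.+1) (T ^+ (n - j) * B ^+ j) *+ lah n j.
have PS n : P n.+1 = B * P n + ad a (P n).
  have -> : ad a (P n) = \sum_(j < n.+1) (T ^+ (n - j.+1) * T * B ^+ j.+1)
      *+ ((n + j.+1) * lah n j.+1).
    rewrite /P ad_sum big_ord_recl [RHS]big_ord_recr /=.
    rewrite [lah n n.+1]lah_small // muln0 mulr0n addr0.
    rewrite adMn (ad_homogeneous adT (adBj 0)) -mulrnA muln0 addn0 subn0.
    have -> : (n * lah n 0 = 0)%N by case: (n) => //= m; rewrite muln0.
    rewrite mulr0n add0r; apply: eq_bigr => j _; rewrite /bump /= add1n.
    rewrite adMn (ad_homogeneous adT (adBj _)) -mulrnA -exprSr; congr (_ *+ (_ * _)).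
    by have := ltn_ord j; lia.
  rewrite /P big_ord_recl /= mulr0n add0r mulr_sumr -big_split.
  apply: eq_bigr => j _; rewrite /bump /= add1n subSS mulrnDr mulrnAr; congr (_ + _).
    rewrite exprS !mulrA; congr (_ * _ *+ _).
    by have /(commrX (n - j)) : GRing.comm B T by rewrite /GRing.comm TB.
  have [jn|nj] := ltnP j n; first by rewrite -exprSr; congr (_ ^+ _ * _ *+ _); lia.
  by rewrite lah_small ?muln0.
have := leibniz_expp PS; rewrite /P big_ord1 /= subn0 !mulr1 mul1r => ->.
congr (_ + _); rewrite big_ord_recr /= subnn mul1r.
have lahpp n : lah n n = 1%N by elim: n => //= n ->; rewrite lah_small // muln0.
rewrite lahpp big1 ?add0r // => j _.
have [j0|j0] := posnP j; last by rewrite -mulr_natr lah_pchar ?mulr0 // j0 ltn_ord.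
by rewrite j0; case: (p) p_gt0.
Qed.

End Derivations.

(** * Central elements *)

Section Center.
Variables (k : fieldType) (A : algType k) (e : generator -> A).
Hypothesis rel : satisfies_relations e.
Variable p : nat.
Hypothesis charA : p \in [pchar A].
Hypothesis p_gt2 : (2 < p)%N.

Let L := letter_val e.

Ltac normal_form :=
  rewrite ?/ad ?/L; match goal with |- ?l = ?r =>
    let el := quote_letters e l in let er := quote_letters e r in
    change (neval (letter_val e) el = neval (letter_val e) er);
    apply: (neval_check (n := 40) (Drules_hold rel)); by vm_compute
  end.

Definition commutes_with_letters (c : A) : Prop := forall a, c * L a = L a * c.

(** The letters x21 and u21 are polynomials in these, and what commutes with g commutes with
    its inverse. *)
Definition basic_letters := [:: X1; X2; U1; U2; G; Zt].

Lemma commutes_with_basic c :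
  {in basic_letters, forall a, c * L a = L a * c} -> commutes_with_letters c.
Proof.
move=> h; have h1 := h X1 isT; have h2 := h X2 isT; have h3 := h U1 isT.
have h4 := h U2 isT; have h5 := h G isT; have h6 := h Zt isT.
have gg' : L G * L G' = 1 by normal_form.
have g'g : L G' * L G = 1 by normal_form.
have hM (a b : A) : c * a = a * c -> c * b = b * c -> c * (a * b) = (a * b) * c.
  by move=> ha hb; rewrite mulrA ha -mulrA hb mulrA.
have hD (a b : A) : c * a = a * c -> c * b = b * c -> c * (a + b) = (a + b) * c.
  by move=> ha hb; rewrite mulrDr mulrDl ha hb.
case=> //.
- have -> : L X21 = L X2 * L X1 + L X1 * L X2 by [].
  by apply: hD; apply: hM.
- rewrite -[LHS]mul1r -g'g -[RHS]mulr1 -gg'.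
  by rewrite -!mulrA; congr (_ * _); rewrite !mulrA -h5 -!mulrA; congr (_ * _);
     rewrite gg' g'g.
- have -> : L U21 = L U1 * L U2 + L U2 * L U1 by [].
  by apply: hD; apply: hM.
Qed.

Let ad2_central a : {in basic_letters, forall b, ad a (ad a (L b)) = 0} ->
  commutes_with_letters (a ^+ p).
Proof.
move=> h; apply: commutes_with_basic => b /h ab.
by apply: (ad_expp_nilp charA (n := 2)) => //; apply: ltnW.
Qed.

Lemma x21p_central : commutes_with_letters (L X21 ^+ p).
Proof.
apply: ad2_central => b; rewrite !inE.
by do !(case/predU1P=> [->|]; first by normal_form); move/eqP=> ->; normal_form.
Qed.

Lemma u21p_central : commutes_with_letters (L U21 ^+ p).
Proof.
apply: ad2_central => b; rewrite !inE.
by do !(case/predU1P=> [->|]; first by normal_form); move/eqP=> ->; normal_form.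
Qed.

Lemma gp_central : commutes_with_letters (L G ^+ p).
Proof.
apply: ad2_central => b; rewrite !inE.
by do !(case/predU1P=> [->|]; first by normal_form); move/eqP=> ->; normal_form.
Qed.

Lemma ginvp_central : commutes_with_letters (L G' ^+ p).
Proof.
apply: ad2_central => b; rewrite !inE.
by do !(case/predU1P=> [->|]; first by normal_form); move/eqP=> ->; normal_form.
Qed.

(** Conjugation by the odd generators shifts zeta by 1, and z ^ p - z is invariant under the
    shift in characteristic p. *)
Lemma zetap_central : commutes_with_letters (L Zt ^+ p - L Zt).
Proof.
have frob : (L Zt + 1) ^+ p = L Zt ^+ p + 1.
  have comm1 : GRing.comm (L Zt) 1 by rewrite /GRing.comm mulr1 mul1r.
  by have := pFrobenius_autD_comm charA comm1; rewrite !pFrobenius_autE expr1n.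
have shift (a b : A) : a * b = b * (a + 1) -> forall n, a ^+ n * b = b * (a + 1) ^+ n.
  move=> ab; elim=> [|n IH]; first by rewrite mulr1 mul1r.
  by rewrite exprS -mulrA IH mulrA ab -mulrA -exprS.
have lower b : L Zt * b = b * (L Zt + 1) ->
    (L Zt ^+ p - L Zt) * b = b * (L Zt ^+ p - L Zt).
  by move=> h; rewrite mulrBl (shift _ _ h) frob h -mulrBr opprD addrACA subrr addr0.
have shift' (a b : A) : b * a = (a + 1) * b -> forall n, b * a ^+ n = (a + 1) ^+ n * b.
  move=> ab; elim=> [|n IH]; first by rewrite mulr1 mul1r.
  by rewrite exprSr mulrA IH -mulrA ab mulrA -exprSr.
have raise b : b * L Zt = (L Zt + 1) * b ->
    (L Zt ^+ p - L Zt) * b = b * (L Zt ^+ p - L Zt).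
  by move=> h; rewrite mulrBr (shift' _ _ h) frob h -mulrBl opprD addrACA subrr addr0.
apply: commutes_with_basic => b; rewrite !inE.
case/predU1P=> [->|]; first by apply: lower; normal_form.
case/predU1P=> [->|]; first by apply: lower; normal_form.
case/predU1P=> [->|]; first by apply: raise; normal_form.
case/predU1P=> [->|]; first by apply: raise; normal_form.
case/predU1P=> [->|/eqP ->].
  have zg : L Zt * L G = L G * L Zt by normal_form.
  rewrite mulrBl mulrBr zg; congr (_ - _).
  by have /(commrX p) : GRing.comm (L G) (L Zt) by exact: esym.
by rewrite mulrBl mulrBr -exprS -exprSr.
Qed.

Local Notation y := (L X2 * L X2).
Local Notation y' := (L U2 * L U2).

(** The iterated brackets of u2 ^ 2 with a generator either vanish after at most three
    steps, or are multiples of rising factorials divisible by p. *)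
Lemma u2pp_central : commutes_with_letters (y' ^+ p).
Proof.
have nilp n b : (n <= p)%N -> iter n (ad y') (L b) = 0 ->
    y' ^+ p * L b = L b * y' ^+ p by exact: ad_expp_nilp.
have p_gt1 : (1 < p)%N by exact: ltnW.
apply: commutes_with_basic => b; rewrite !inE.
case/predU1P=> [->|]; first by apply: (nilp 2) => //=; normal_form.
case/predU1P=> [->|]; first by apply: (nilp 3) => //=; normal_form.
case/predU1P=> [->|].
  have ads : ad y' (L U21) = L U21 ^+ 2 by normal_form.
  have adu1 : ad y' (L U1) = (L U21 * L U1) *+ 1 by normal_form.
  apply: (ad_expp_comm charA); rewrite (iter_ad_homogeneous ads adu1).
  by rewrite -mulr_natr (rising_pchar charA) ?mulr0 // (ltnW p_gt1) add1n ltnSn.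
case/predU1P=> [->|]; first by apply: (nilp 2) => //=; normal_form.
case/predU1P=> [->|/eqP ->]; first by apply: (nilp 2) => //=; normal_form.
by apply: (nilp 2) => //=; normal_form.
Qed.

(** As for u2, except for the bracket with u2 itself, where the iterated brackets fall into
    two families, both multiplied by a factorial that p divides at the last step. *)
Lemma x2pp_central : commutes_with_letters (y ^+ p).
Proof.
have nilp n b : (n <= p)%N -> iter n (ad y) (L b) = 0 ->
    y ^+ p * L b = L b * y ^+ p by exact: ad_expp_nilp.
have p_gt1 : (1 < p)%N by exact: ltnW.
have adt : ad y (L X21) = L X21 ^+ 2 by normal_form.
have homog b : ad y (L b) = (L X21 * L b) *+ 1 -> y ^+ p * L b = L b * y ^+ p.
  move=> adb; apply: (ad_expp_comm charA); rewrite (iter_ad_homogeneous adt adb).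
  by rewrite -mulr_natr (rising_pchar charA) ?mulr0 // (ltnW p_gt1) add1n ltnSn.
have adx1g : ad y (L X1 * L G) = (L X21 * (L X1 * L G)) *+ 2 by normal_form.
apply: commutes_with_basic => b; rewrite !inE.
case/predU1P=> [->|]; first by apply: homog; normal_form.
case/predU1P=> [->|]; first by apply: (nilp 2) => //=; normal_form.
case/predU1P=> [->|].
  apply: (ad_expp_comm charA); have -> : p = p.-1.+1 by rewrite prednK // ltnW.
  have adu1 : ad y (L U1) = - (L X1 * L G) by normal_form.
  have iterN n b1 : iter n (ad y) (- b1) = - iter n (ad y) b1.
    by elim: n => //= n ->; rewrite adN.
  rewrite iterSr adu1 iterN (iter_ad_homogeneous adt adx1g).
  rewrite -mulr_natr (rising_pchar charA) ?mulr0 ?oppr0 //.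
  by have := p_gt2; lia.
case/predU1P=> [->|].
  (* The bracket iterated n.+2 times, found from its first values. *)
  pose z n := (- (L X21 ^+ n * (L X1 * L G) * y) *+ 2
              + L X21 ^+ n.+1 * (L X1 * L G) * (L Zt - 1)) *+ n.+2`!.
  have zE n : iter n.+2 (ad y) (L U2) = z n.
    elim: n => [|n IH].
      rewrite /z expr0 expr1 mul1r /= !factS fact0 !mulnE; normal_form.
    have adz : ad y (L Zt - 1) = - (y *+ 2) by normal_form.
    have ady : ad y y = 0 by rewrite /ad subrr.
    rewrite iterS IH /z adMn adD adMn adN !(ad_mul _ (_ * _)) ady mulr0 addr0 adz.
    rewrite !(ad_homogeneous adt adx1g) [in RHS]factS [RHS]mulrnA; congr (_ *+ _).
    rewrite mulrN mulrnAr !mulrnAl [RHS]mulrnDl addrCA [RHS]addrC addn2.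
    congr (_ + _); rewrite !mulNrn -opprD -!mulrnA -mulrnDr; congr (- (_ *+ _)); lia.
  apply: (ad_expp_comm charA); have -> : p = (p - 2).+2 by have := p_gt2; lia.
  rewrite zE /z -mulr_natr; have -> : (p - 2).+2 = p by have := p_gt2; lia.
  have /eqP -> : (p`!)%:R == 0 :> A; last by rewrite mulr0.
  by rewrite -(dvdn_pcharf charA) dvdn_fact // leqnn andbT; exact: ltnW.
case/predU1P=> [->|/eqP ->]; first by apply: homog; normal_form.
by apply: (nilp 2) => //=; normal_form.
Qed.

End Center.

(** * Monomials in the central generators and freeness *)

Section IntegerPowers.
Variable A : nzRingType.

(** The inverse is an argument, since the rings at hand need not have decidable units. *)
Definition intpow (a a' : A) (m : int) : A :=
  match m with Posz n => a ^+ n | Negz n => a' ^+ n.+1 end.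

Variables a a' : A.
Hypotheses (aa' : a * a' = 1) (a'a : a' * a = 1).

Lemma intpow0 : intpow a a' 0 = 1. Proof. by []. Qed.

Lemma intpowS m : intpow a a' (m + 1) = intpow a a' m * a.
Proof.
case: m => n; first by rewrite -PoszD addn1 /= exprSr.
case: n => [|n]; first by rewrite /= a'a.
have -> : Negz n.+1 + 1 = Negz n by rewrite !NegzE; lia.
by rewrite /= [a' ^+ n.+2]exprSr -mulrA a'a mulr1.
Qed.

Lemma intpowP m : intpow a a' (m - 1) = intpow a a' m * a'.
Proof. by rewrite -[m in RHS](subrK 1) intpowS -mulrA aa' mulr1. Qed.

Lemma intpowD m n : intpow a a' (m + n) = intpow a a' m * intpow a a' n.
Proof.
elim/int_rec: n => [|n IH|n IH]; first by rewrite addr0 intpow0 mulr1.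
  by rewrite -addn1 PoszD addrA intpowS IH intpowS mulrA.
by rewrite -addn1 PoszD opprD addrA intpowP IH intpowP mulrA.
Qed.

Lemma intpowM m n : intpow a a' (m * n%:Z) = intpow (a ^+ n) (a' ^+ n) m.
Proof.
case: m => m; first by rewrite [RHS]/= -exprM mulnC -PoszM.
rewrite [RHS]/= -exprM; case: n => [|n]; first by rewrite mulr0 mul0n.
have -> : Negz m * n.+1%:Z = Negz (n.+1 * m.+1).-1 by rewrite !NegzE; nia.
by [].
Qed.

Lemma intpow_nat n : intpow a a' n%:Z = a ^+ n. Proof. by []. Qed.

End IntegerPowers.

(** Exponents of seven commuting elements, the third and fourth of which are inverse to each
    other and share an integral exponent. *)
Definition zexp := (nat * nat * int * nat * nat * nat)%type.

Definition zexp_add (q r : zexp) : zexp :=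
  let: (a, b, m, n, c, d) := q in let: (a', b', m', n', c', d') := r in
  ((a + a')%N, (b + b')%N, m + m', (n + n')%N, (c + c')%N, (d + d')%N).

Definition zexp0 : zexp := (0%N, 0%N, 0, 0%N, 0%N, 0%N).

Section Monomials.
Variable A : nzRingType.

Definition zmonomial (a b g g' z c d : A) (q : zexp) : A :=
  let: (i, j, m, n, l, h) := q in
  a ^+ i * (b ^+ j * (intpow g g' m * (z ^+ n * (c ^+ l * d ^+ h)))).

Lemma zmonomial0 a b g g' z c d : zmonomial a b g g' z c d zexp0 = 1.
Proof. by rewrite /= !mulr1. Qed.

Lemma zmonomialM a b g g' z c d q r : g * g' = 1 -> g' * g = 1 ->
  (forall x, [/\ a * x = x * a, b * x = x * b & g * x = x * g]
     /\ [/\ g' * x = x * g', z * x = x * z, c * x = x * c & d * x = x * d]) ->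
  zmonomial a b g g' z c d q * zmonomial a b g g' z c d r
  = zmonomial a b g g' z c d (zexp_add q r).
Proof.
move=> gg' g'g cen.
case: q r => [[[[[i j] m] n] l] h] [[[[[i' j'] m'] n'] l'] h'] /=.
have cenX (x : A) : (forall t, x * t = t * x) -> forall n t, t * x ^+ n = x ^+ n * t.
  by move=> hx n0 t; have /(commrX n0) : GRing.comm t x by rewrite /GRing.comm hx.
have CA (x : A) : (forall t, t * x = x * t) -> forall s t, s * (x * t) = x * (s * t).
  by move=> hx s t; rewrite !mulrA hx.
have ha n0 t : t * a ^+ n0 = a ^+ n0 * t by apply: cenX => x; case: (cen x) => -[].
have hb n0 t : t * b ^+ n0 = b ^+ n0 * t by apply: cenX => x; case: (cen x) => -[].
have hz n0 t : t * z ^+ n0 = z ^+ n0 * t.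
  by apply: cenX => x; case: (cen x) => _ [].
have hc n0 t : t * c ^+ n0 = c ^+ n0 * t.
  by apply: cenX => x; case: (cen x) => _ [].
have hd n0 t : t * d ^+ n0 = d ^+ n0 * t.
  by apply: cenX => x; case: (cen x) => _ [].
have hg n0 t : t * intpow g g' n0 = intpow g g' n0 * t.
  by case: n0 => n0; apply: cenX => x; case: (cen x) => [[_ _ ?] [? _ _ _]].
rewrite !exprD intpowD // -!mulrA.
rewrite !(CA _ (ha i')); congr (_ * (_ * _)).
rewrite !(CA _ (hb j')); congr (_ * (_ * _)).
rewrite !(CA _ (hg m')); congr (_ * (_ * _)).
rewrite !(CA _ (hz n')); congr (_ * (_ * _)).
by rewrite !(CA _ (hc l')).
Qed.

End Monomials.

Section MonomialSubalgebra.
Variables (k : fieldType) (A : algType k) (zgen : 'I_7 -> A).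
Hypothesis zgen_central : forall i x, zgen i * x = x * zgen i.

Local Notation zg i := (zgen (@Ordinal 7 i isT)).

Hypotheses (zgg' : zg 2 * zg 3 = 1).

Definition zmon : zexp -> A := zmonomial (zg 0) (zg 1) (zg 2) (zg 3) (zg 4) (zg 5) (zg 6).

Lemma zmonM q r : zmon q * zmon r = zmon (zexp_add q r).
Proof.
apply: zmonomialM; [exact: zgg' | by rewrite zgen_central zgg' | move=> x].
by do !split; exact: zgen_central.
Qed.

Lemma zmon0 : zmon zexp0 = 1.
Proof. exact: zmonomial0. Qed.

Definition zgen_exp (i : 'I_7) : zexp :=
  match val i with
  | 0%N => (1%N, 0%N, 0, 0%N, 0%N, 0%N) | 1%N => (0%N, 1%N, 0, 0%N, 0%N, 0%N)
  | 2%N => (0%N, 0%N, 1, 0%N, 0%N, 0%N) | 3%N => (0%N, 0%N, -1, 0%N, 0%N, 0%N)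
  | 4%N => (0%N, 0%N, 0, 1%N, 0%N, 0%N) | 5%N => (0%N, 0%N, 0, 0%N, 1%N, 0%N)
  | _ => (0%N, 0%N, 0, 0%N, 0%N, 1%N)
  end.

Lemma zmon_gen i : zmon (zgen_exp i) = zgen i.
Proof.
case: i => -[|[|[|[|[|[|[|//]]]]]]] i7; rewrite /zmon /= ?expr0 ?expr1 ?mulr1 ?mul1r;
  by congr zgen; apply: val_inj.
Qed.

Variable S : A -> Prop.
Hypothesis zgen_in : forall i, zgen i \in subalg_of S.
Hypothesis S_span : forall a, S a -> exists w, lin_ext zmon w = a.

Lemma zmon_in q : zmon q \in subalg_of S.
Proof.
case: q => [[[[[a b] m] n] c] d]; rewrite /zmon /zmonomial.
have intpow_in : intpow (zg 2) (zg 3) m \in subalg_of S.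
  by case: m => m; apply: rpredX; exact: zgen_in.
by do !(apply: rpredM; first by [exact: intpow_in | apply: rpredX; exact: zgen_in]);
   apply: rpredX; exact: zgen_in.
Qed.

Lemma zmon_span z : z \in subalg_of S -> exists w, lin_ext zmon w = z.
Proof.
move/subalg_ofP; elim=> [|| c _ _ [w <-]|_ _ _ [w <-] _ [w' <-]
  |_ _ _ [w <-] _ [w' <-]].
- exact: S_span.
- by exists << zexp0 >>; rewrite lin_extU zmon0.
- by exists (c *: w); rewrite linearZ.
- by exists (w + w'); rewrite linearD.
exact: lin_ext_mul zmonM w w'.
Qed.

Definition subalg_zmon (q : zexp) : subalg S := Subalg (zmon_in q).

Lemma subalg_zmonM q r : subalg_zmon q * subalg_zmon r = subalg_zmon (zexp_add q r).
Proof. by apply: val_inj; exact: zmonM. Qed.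

Lemma subalg_zmon0 : subalg_zmon zexp0 = 1.
Proof. by apply: val_inj; exact: zmon0. Qed.

Lemma subalg_zmon_basis : injective (lin_ext zmon) -> is_basis subalg_zmon.
Proof. exact: subalg_basis zmon_span. Qed.

End MonomialSubalgebra.

Section CentralSubalgebra.
Variables (k : fieldType) (A : algType k) (e : generator -> A).
Hypothesis rel : satisfies_relations e.
Hypothesis pbw : is_basis (fun u : irr_word Drule =>
  \prod_(a <- val u) letter_val e a).
Variable p : nat.
Hypothesis chark : p \in [pchar k].
Hypothesis p_gt2 : (2 < p)%N.

Let L := letter_val e.

Fact charA : p \in [pchar A]. Proof. by rewrite pchar_lalg. Qed.

Fact gg'1 : L G * L G' = 1.
Proof. by have := Drules_hold rel (erefl (Drule G G')); rewrite big_seq1 big_nil. Qed.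

Fact g'g1 : L G' * L G = 1.
Proof. by have := Drules_hold rel (erefl (Drule G' G)); rewrite big_seq1 big_nil. Qed.

Definition pbw_monomial (t : pbw_index) : A :=
  let: (i, b, c, m, (j, d, f), n) := t in
  (L X1 ^+ i * L X21 ^+ b * L X2 ^+ c * intpow (L G) (L G') m) * L Zt ^+ n
  * (L U1 ^+ j * L U21 ^+ d * L U2 ^+ f).

Lemma pbw_monomial_basis : is_basis pbw_monomial.
Proof.
have bij : bijective pbw_word.
  by exists word_index; [exact: pbw_wordK | exact: word_indexK].
have := is_basis_reindex bij pbw; rewrite (_ : _ \o _ = pbw_monomial) //.
apply/funext => -[[[[[i b] c] m] [[j d] f]] n] /=.
rewrite /ordered_word /= !big_cat /= !big_nseq.
have iterE n0 a : iter n0 ( *%R (letter_val e a)) 1 = L a ^+ n0.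
  by elim: n0 => //= n0 ->; rewrite exprS.
rewrite !iterE big_nil mulr1 /=.
by case: m => m; rewrite /= ?expr0 ?mul1r ?mulr1 !mulrA.
Qed.

(** Division with remainder by z ^ p - z, in the form of a basis of polynomials: the remainder
    part stays in the module basis and the powers of z ^ p - z go to Z. *)
Definition zeta_poly (n : nat) : {poly k} := 'X^(n %% p) * ('X^p - 'X) ^+ (n %/ p).

Fact zeta_poly_size n : zeta_poly n \is monic /\ size (zeta_poly n) = n.+1.
Proof.
have szX : (size ('X : {poly k}) < size ('X^p : {poly k}))%N.
  by rewrite size_polyX size_polyXn; lia.
have mon : ('X^p - 'X : {poly k}) \is monic.
  by rewrite monicE lead_coefDl ?size_polyN // lead_coefXn.
have sz : size ('X^p - 'X : {poly k}) = p.+1.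
  by rewrite size_polyDl ?size_polyN // size_polyXn.
split; first by rewrite monicMl ?monicXn // monic_exp.
rewrite size_monicM ?monicXn ?monic_neq0 ?monic_exp // size_polyXn.
have -> : size (('X^p - 'X) ^+ (n %/ p) : {poly k}) = (p * (n %/ p)).+1.
  by have := size_exp ('X^p - 'X : {poly k}) (n %/ p); rewrite sz /= => <-;
     rewrite prednK // lt0n size_poly_eq0 monic_neq0 ?monic_exp.
by rewrite /= addnS /= [in RHS](divn_eq n p) mulnC addnC.
Qed.

Definition pbw_monomial' (t : pbw_index) : A :=
  let: (i, b, c, m, (j, d, f), n) := t in
  (L X1 ^+ i * L X21 ^+ b * L X2 ^+ c * intpow (L G) (L G') m)
  * (L Zt ^+ (n %% p) * (L Zt ^+ p - L Zt) ^+ (n %/ p))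
  * (L U1 ^+ j * L U21 ^+ d * L U2 ^+ f).

Lemma pbw_monomial'_basis : is_basis pbw_monomial'.
Proof.
apply: (is_basis_triangular (P := zeta_poly) _ _ _ pbw_monomial_basis).
- by move=> n; case: (zeta_poly_size n).
- by move=> n; case: (zeta_poly_size n).
move=> [[[[i b] c] m] [[j d] f]] n; rewrite /pbw_monomial' /pbw_monomial.
set l := L X1 ^+ i * _ * _ * _; set r := _ * L U2 ^+ f.
have -> : L Zt ^+ (n %% p) * (L Zt ^+ p - L Zt) ^+ (n %/ p)
    = \sum_(i0 < n.+1) (zeta_poly n)`_i0 *: L Zt ^+ i0.
  have [_ sz] := zeta_poly_size n.
  transitivity (horner_alg (L Zt) (zeta_poly n)).
    by rewrite rmorphM rmorphXn /= rmorphXn /= rmorphB /= rmorphXn /= horner_algX.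
  rewrite /horner_alg /horner_morph /= horner_coef size_map_poly sz.
  by apply: eq_bigr => i0 _; rewrite coef_map /= -scalerAl mul1r.
rewrite mulr_sumr mulr_suml; apply: eq_bigr => i0 _.
by rewrite -scalerAr -scalerAl.
Qed.

Lemma commutes_central c : commutes_with_letters e c -> forall x, c * x = x * c.
Proof.
move=> hc; apply: (is_basis_ind pbw) => [|a x y IHx IHy|u].
- by rewrite mulr0 mul0r.
- by rewrite mulrDr mulrDl -scalerAr -scalerAl IHx IHy.
elim: (val u) => [|a w IH]; first by rewrite big_nil mulr1 mul1r.
by rewrite big_cons mulrA hc -!mulrA IH.
Qed.

Definition Zgen (i : 'I_7) : A :=
  match val i with
  | 0%N => L X21 ^+ p | 1%N => L X2 ^+ (2 * p) | 2%N => L G ^+ p | 3%N => L G' ^+ p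
  | 4%N => L Zt ^+ p - L Zt | 5%N => L U21 ^+ p | _ => L U2 ^+ (2 * p)
  end.

Lemma Zgen_central i x : Zgen i * x = x * Zgen i.
Proof.
apply: commutes_central; case: i => -[|[|[|[|[|[|[|//]]]]]]] i7; rewrite /Zgen /=.
- exact: x21p_central (charA) p_gt2.
- by rewrite exprM expr2; exact: x2pp_central (charA) p_gt2.
- exact: gp_central (charA) p_gt2.
- exact: ginvp_central (charA) p_gt2.
- exact: zetap_central (charA).
- exact: u21p_central (charA) p_gt2.
by rewrite exprM expr2; exact: u2pp_central (charA) p_gt2.
Qed.

Local Notation zg i := (Zgen (@Ordinal 7 i isT)).

(** Exponents that remain after division by those of the central generators. *)
Definition rexp := (bool * 'I_p * 'I_(2 * p) * 'I_p * 'I_p * bool * 'I_p * 'I_(2 * p))%type.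

Definition rmon (r : rexp) : A :=
  let: (i, b, c, m, n, j, d, f) := r in
  L X1 ^+ i * (L X21 ^+ b * (L X2 ^+ c * (L G ^+ m * (L Zt ^+ n *
    (L U1 ^+ j * (L U21 ^+ d * L U2 ^+ f)))))).

Definition exp_join (qr : zexp * rexp) : pbw_index :=
  let: (b', c', m', n', d', f') := qr.1 in
  let: (i, b, c, m, n, j, d, f) := qr.2 in
  ((i, (b' * p + b)%N, (c' * (2 * p) + c)%N, m' * p%:Z + m%:Z),
   (j, (d' * p + d)%N, (f' * (2 * p) + f)%N), (n' * p + n)%N).

Fact p_gt0 : (0 < p)%N. Proof. by lia. Qed.
Fact pp_gt0 : (0 < 2 * p)%N. Proof. by lia. Qed.

Fact modz_lt (m : int) : (`|(m %% p%:Z)%Z| < p)%N.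
Proof. by have := @ltz_pmod m p%:Z; have := @modz_ge0 m p%:Z; have := p_gt0; lia. Qed.

Definition exp_split (t : pbw_index) : zexp * rexp :=
  let: (i, b, c, m, (j, d, f), n) := t in
  (((b %/ p)%N, (c %/ (2 * p))%N, (m %/ p%:Z)%Z, (n %/ p)%N, (d %/ p)%N,
    (f %/ (2 * p))%N),
   (i, Ordinal (ltn_pmod b p_gt0), Ordinal (ltn_pmod c pp_gt0), Ordinal (modz_lt m),
    Ordinal (ltn_pmod n p_gt0), j, Ordinal (ltn_pmod d p_gt0),
    Ordinal (ltn_pmod f pp_gt0))).

Fact exp_join_bij : bijective exp_join.
Proof.
have divD (P a b : nat) : (b < P)%N -> ((a * P + b) %/ P = a)%N.
  by move=> bP; rewrite divnMDl ?divn_small ?addn0 // (leq_ltn_trans _ bP).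
exists exp_split.
  case=> [[[[[[b' c'] m'] n'] d'] f'] [[[[[[[i b] c] m] n] j] d] f]].
  rewrite /exp_split /exp_join /=.
  have mE : ((m' * p%:Z + m%:Z) %% p%:Z)%Z = m%:Z.
    by rewrite modzMDl modz_small // ltz_nat ltn_ord.
  congr (_, _).
    rewrite !divD ?ltn_ord // divzMDl; last by have := p_gt0; lia.
    by rewrite divz_small ?addr0 // ltz_nat ltn_ord.
  by do !congr (_, _); apply: val_inj; rewrite /= ?mE ?modnMDl ?modn_small.
case=> [[[[[i b] c] m] [[j d] f]] n] /=.
do ?congr (_, _); rewrite -?divn_eq //.
by rewrite gez0_abs ?modz_ge0 -?divz_eq //; have := p_gt0; lia.
Qed.

(** Quotient and remainder of each exponent separate a central factor from a module
    generator. *)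
Lemma exp_join_monomial qr : zmon Zgen qr.1 * rmon qr.2 = pbw_monomial' (exp_join qr).
Proof.
case: qr => [[[[[[b' c'] m'] n'] d'] f'] [[[[[[[i b] c] m] n] j] d] f]].
rewrite /zmon /exp_join /pbw_monomial' /zmonomial /rmon.
rewrite [fst _]/= [snd _]/=.
have cenX c0 n0 x : x * Zgen c0 ^+ n0 = Zgen c0 ^+ n0 * x.
  by have /(commrX n0) : GRing.comm x (Zgen c0) by rewrite /GRing.comm Zgen_central.
have CA (x : A) : (forall t, t * x = x * t) -> forall s t : A, s * (x * t) = x * (s * t).
  by move=> hx s t; rewrite !mulrA hx.
have ceng x : x * intpow (zg 2) (zg 3) m' = intpow (zg 2) (zg 3) m' * x.
  by case: m' => m'; apply: cenX.
rewrite modnMDl divnMDl ?p_gt0 // divn_small ?ltn_ord // addn0 modn_small ?ltn_ord //.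
rewrite intpowD ?gg'1 ?g'g1 // intpowM intpow_nat !exprD.
have expX x P0 n0 : x ^+ (n0 * P0) = (x ^+ P0) ^+ n0 :> A by rewrite mulnC exprM.
rewrite (expX (L X21) p) (expX (L X2)) (expX (L U21) p) (expX (L U2)).
rewrite -[L X21 ^+ p]/(zg 0) -[L X2 ^+ (2 * p)]/(zg 1) -[L G ^+ p]/(zg 2).
rewrite -[L G' ^+ p]/(zg 3) -[L Zt ^+ p - L Zt]/(zg 4) -[L U21 ^+ p]/(zg 5).
rewrite -[L U2 ^+ (2 * p)]/(zg 6) -!mulrA.
rewrite !(CA _ (cenX _ f')) !(CA _ (cenX _ d')) !(CA _ (cenX _ n')).
by rewrite !(CA _ ceng) !(CA _ (cenX _ c')) !(CA _ (cenX _ b')).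
Qed.

Fact Zgg' : zg 2 * zg 3 = 1.
Proof.
by rewrite /Zgen /= -exprMn_comm ?gg'1 ?expr1n // /GRing.comm gg'1 g'g1.
Qed.

Lemma zmon_basis : is_basis (fun qr : zexp * rexp => zmon Zgen qr.1 * rmon qr.2).
Proof.
have := is_basis_reindex exp_join_bij pbw_monomial'_basis.
rewrite (_ : _ \o _ = fun qr => zmon Zgen qr.1 * rmon qr.2) //.
by apply/funext => qr; rewrite exp_join_monomial.
Qed.

Definition rexp0 : rexp :=
  (false, Ordinal p_gt0, Ordinal pp_gt0, Ordinal p_gt0, Ordinal p_gt0, false,
   Ordinal p_gt0, Ordinal pp_gt0).

Fact rmon0 : rmon rexp0 = 1.
Proof. by rewrite /rmon /= !expr0 !mulr1. Qed.

Variable S : A -> Prop.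
Hypothesis S_zgen : forall a, S a <-> exists i, a = Zgen i.

Lemma Zgen_in i : Zgen i \in subalg_of S.
Proof. by apply/subalg_ofP/in_subalg_gen/S_zgen; exists i. Qed.

Lemma Zgen_span a : S a -> exists w, lin_ext (zmon Zgen) w = a.
Proof. by case/S_zgen=> i ->; exists << zgen_exp i >>; rewrite lin_extU zmon_gen. Qed.

Theorem free_over_center d : exists! c : {ffun 'I_#|{: rexp}| -> subalg S},
  d = \sum_i val (c i) * rmon (enum_val i).
Proof.
exact: free_over_subalg (zmon_in Zgen_in)
  (zmon_span Zgen_central Zgg' Zgen_span) zmon_basis d.
Qed.

Lemma Zmon_inj : injective (lin_ext (zmon Zgen)).
Proof. exact: (free_factor_inj zmon_basis (r0 := rexp0) rmon0). Qed.

End CentralSubalgebra.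

(** * Monomials as linearly independent functions *)

Section Independence.
Variable k : closedFieldType.

(** Independence as functions on a set of points; it passes to products of sets, which reduces
    monomials in several variables to powers of one variable. *)
Definition independent (X : Type) (I : choiceType) (phi : I -> X -> k) : Prop :=
  forall v : {malg k[I]},
    (forall x, lin_ext (fun i => phi i x : k^o) v = 0) -> v = 0.

Definition coef_lin (I : choiceType) (i : I) : {linear {malg k[I]} -> k^o} :=
  lin_ext (fun j => (j == i)%:R : k^o).

Lemma coef_linE (I : choiceType) (i : I) v : coef_lin i v = v@_i.
Proof.
rewrite [v in RHS]malg_sum raddf_sum /= lin_extE; apply: eq_bigr => j _.
by rewrite mcoeffZ mcoeffU.
Qed.

Lemma independent_prod (X Y : Type) (I J : choiceType) (phi : I -> X -> k)
    (psi : J -> Y -> k) : independent phi -> independent psi ->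
  independent (fun (ij : I * J) (xy : X * Y) => phi ij.1 xy.1 * psi ij.2 xy.2).
Proof.
move=> hphi hpsi v hv.
pose slice y : {linear {malg k[(I * J)%type]} -> {malg k[I]}} :=
  lin_ext (fun ij => psi ij.2 y *: << ij.1 >>).
pose row i : {linear {malg k[(I * J)%type]} -> {malg k[J]}} :=
  lin_ext (fun ij => if ij.1 == i then << ij.2 >> else 0).
have slice0 y : slice y v = 0.
  apply: hphi => x; rewrite -[RHS](hv (x, y)).
  apply: (@eq_linear_malg _ _ _ (lin_ext _ \o slice y) (lin_ext _)) => -[i j].
  by rewrite /slice /= !lin_extU linearZ /= lin_extU /= mulrC.
have row0 i : row i v = 0.
  apply: hpsi => y; transitivity (coef_lin i (slice y v)); last first.
    by rewrite slice0 linear0.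
  apply: (@eq_linear_malg _ _ _ (lin_ext _ \o row i) (coef_lin i \o slice y)).
  case=> i' j; rewrite /row /slice /= !lin_extU linearZ /= lin_extU /=.
  rewrite -[RHS]/(psi j y * _).
  by case: eqP => _; rewrite ?lin_extU ?linear0 ?mulr1 ?mulr0.
apply/malgP => -[i j]; rewrite mcoeff0 -coef_linE.
transitivity (coef_lin j (row i v)); last by rewrite row0 linear0.
apply: (@eq_linear_malg _ _ _ (coef_lin (i, j)) (coef_lin j \o row i)) => -[i' j'].
rewrite /row /= !lin_extU xpair_eqE /=.
by case: eqP => _; rewrite ?lin_extU ?linear0.
Qed.

(** A root of f X + 1, which exists over an algebraically closed field. *)
Lemma poly_nonroot (f : {poly k}) : f != 0 -> exists2 x, x != 0 & f.[x] != 0.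
Proof.
move=> f0; have sz : size (f * 'X + 1) = (size f).+1.
  rewrite size_polyDl ?size_mulX // size_poly1 ltnS lt0n size_poly_eq0 //.
have /closed_rootP[x /rootP] : size (f * 'X + 1) != 1%N.
  by rewrite sz eqSS size_poly_eq0.
rewrite !hornerE => /eqP; rewrite addr_eq0 => /eqP fx.
have fx0 : f.[x] * x != 0 by rewrite fx oppr_eq0 oner_eq0.
by exists x; apply: contraNneq fx0 => ->; rewrite ?mulr0 ?mul0r.
Qed.

Lemma independent_exp_unit :
  independent (fun (m : int) (x : {x : k | x != 0}) => intpow (val x) (val x)^-1 m).
Proof.
move=> v hv.
pose N := (\sum_(m <- monalg.msupp v) `|m|)%N.
have le_N m : m \in monalg.msupp v -> (`|m| <= N)%N.
  by move=> mv; rewrite /N (big_rem m mv) leq_addr.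
pose sh (m : int) : nat := absz (m + N%:Z).
pose f : {poly k} := \sum_(m <- monalg.msupp v) v@_m *: 'X^(sh m).
have f0 : f = 0.
  apply/eqP/contraT => /poly_nonroot[x x0]; case/eqP.
  have xN : x * x^-1 = 1 by rewrite mulfV.
  have Nx : x^-1 * x = 1 by rewrite mulVf.
  rewrite -[RHS](mul0r (x ^+ N)) -[X in X * _](hv (exist _ x x0)) lin_extE mulr_suml.
  rewrite /f horner_sum; apply: eq_big_seq => m mv; rewrite hornerZ hornerXn.
  rewrite -[LHS]/(v@_m * _) -[_ *: _]/(v@_m * intpow x x^-1 m) -mulrA; congr (_ * _).
  rewrite -(intpow_nat x x^-1) -(intpow_nat x x^-1) -intpowD //; congr intpow.
  by rewrite /sh gez0_abs //; have := le_N _ mv; lia.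
apply/malgP => m; rewrite mcoeff0; case: (boolP (m \in monalg.msupp v)) => [mv|]; last first.
  by move/mcoeff_outdom.
have := congr1 (fun g : {poly k} => g`_(sh m)) f0.
rewrite /f coef0 coef_sum (bigD1_seq m) ?fset_uniq //= coefZ coefXn eqxx mulr1.
rewrite big_seq_cond big1 ?addr0 // => m' /andP[mv' nm].
rewrite coefZ coefXn; case: eqP => [e|]; last by rewrite mulr0.
case/eqP: nm; move: e; rewrite /sh.
by have := le_N _ mv; have := le_N _ mv'; lia.
Qed.

Lemma independent_exp : independent (fun (n : nat) (x : k) => x ^+ n).
Proof.
move=> v hv.
pose f : {poly k} := \sum_(n <- monalg.msupp v) v@_n *: 'X^n.
have f0 : f = 0.
  apply/eqP/contraT => /poly_nonroot[x x0]; case/eqP.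
  rewrite -[RHS](hv x) lin_extE /f horner_sum; apply: eq_big_seq => n _.
  by rewrite hornerZ hornerXn.
apply/malgP => n; rewrite mcoeff0; case: (boolP (n \in monalg.msupp v)) => [nv|]; last first.
  by move/mcoeff_outdom.
have := congr1 (fun g : {poly k} => g`_n) f0.
rewrite /f coef0 coef_sum (bigD1_seq n) ?fset_uniq //= coefZ coefXn eqxx mulr1.
rewrite big1 ?addr0 // => m nm; by rewrite coefZ coefXn eq_sym (negPf nm) mulr0.
Qed.

(** Applied at the points of the group, and at those of the torus times affine space, this
    gives the independence of monomials both for regular functions and Laurent polynomials. *)
Lemma zmonomial_independent (v : {malg k[zexp]}) :
  (forall a b g c d h : k, g != 0 ->
     lin_ext (fun q => zmonomial a b g g^-1 c d h q : k^o) v = 0) -> v = 0.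
Proof.
have ind := independent_prod (independent_prod (independent_prod (independent_prod
  (independent_prod independent_exp independent_exp) independent_exp_unit)
  independent_exp) independent_exp) independent_exp.
move=> hv; apply: ind => -[[[[[a b] [g g0]] c] d] h].
rewrite -[RHS](hv a b g c d h g0).
apply: (@eq_linear_malg _ _ _ (lin_ext _) (lin_ext _)) => -[[[[[i j] m] n] l] q].
by apply: etrans (lin_extU _ _) (etrans _ (esym (lin_extU _ _))); rewrite /= !mulrA.
Qed.

End Independence.

(** * The coordinate ring of the group *)

Lemma rmorph_zmonomial (A B : nzRingType) (f : {rmorphism A -> B}) a b g g' z c d q :
  f (zmonomial a b g g' z c d q)
  = zmonomial (f a) (f b) (f g) (f g') (f z) (f c) (f d) q.
Proof.
case: q => [[[[[i j] m] n] l] h] /=; rewrite !rmorphM !rmorphXn.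
by case: m => m /=; rewrite rmorphXn.
Qed.

Section CoordinateRing.
Variable k : closedFieldType.
Local Notation F := (fun_algebra k (groupB k)).

Definition fun_eval (b : groupB k) (f : F) : k := f b.

Fact fun_eval_zmod b : zmod_morphism (fun_eval b). Proof. by []. Qed.
Fact fun_eval_monoid b : monoid_morphism (fun_eval b). Proof. by []. Qed.

HB.instance Definition _ b :=
  GRing.isZmodMorphism.Build F k (fun_eval b) (fun_eval_zmod b).
HB.instance Definition _ b :=
  GRing.isMonoidMorphism.Build F k (fun_eval b) (fun_eval_monoid b).

(** The sign of the last coordinate matches the sign in the coproduct of u2. *)
Definition OBgen (i : 'I_7) : F :=
  match val i with
  | 0%N => fun b => b.1.1.1 | 1%N => fun b => b.1.1.2
  | 2%N => fun b => val b.1.2 | 3%N => fun b => (val b.1.2)^-1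
  | 4%N => fun b => val b.2 (inord 0) (inord 1)
  | 5%N => fun b => val b.2 (inord 1) (inord 2)
  | _ => fun b => - val b.2 (inord 0) (inord 2)
  end.

Lemma OBgen_central i x : OBgen i * x = x * OBgen i.
Proof. by apply/funext => b; exact: mulrC. Qed.

Local Notation og i := (OBgen (@Ordinal 7 i isT)).

Lemma OBgg' : og 2 * og 3 = 1.
Proof. by apply/funext => b; exact: (mulfV (valP b.1.2)). Qed.

Lemma OBgen_in i : OBgen i \in subalg_of (coordB k).
Proof.
have gen a : coordB k a -> a \in subalg_of (coordB k).
  by move=> h; apply/subalg_ofP/in_subalg_gen.
case: i => -[|[|[|[|[|[|[|//]]]]]]] i7; rewrite /OBgen /=; try by apply: gen; constructor.
pose h02 : F := fun b => val b.2 (inord 0) (inord 2).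
have -> : (fun b : groupB k => - val b.2 (inord 0) (inord 2)) = -1 *: h02 :> F.
  by apply/funext => b; rewrite -[RHS]/(-1 * h02 b) mulN1r.
by apply: rpredZ; apply: gen; constructor.
Qed.

Lemma OBgen_span a : coordB k a -> exists w, lin_ext (zmon OBgen) w = a.
Proof.
have gen i : exists w, lin_ext (zmon OBgen) w = OBgen i.
  by exists << zgen_exp i >>; apply: etrans (lin_extU _ _) (zmon_gen _ _).
case=> [||||i j]; [exact: (gen (@Ordinal 7 0 isT)) | exact: (gen (@Ordinal 7 1 isT)) |
  exact: (gen (@Ordinal 7 2 isT)) | exact: (gen (@Ordinal 7 3 isT)) |].
have cst (c : k) : exists w, lin_ext (zmon OBgen) w = fun=> c.
  exists (c *: << zexp0 >>); rewrite linearZ; apply/funext => b.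
  rewrite -[LHS]/(c * (lin_ext (zmon OBgen) << zexp0 >> : F) b).
  by rewrite (lin_extU (zmon OBgen)) zmon0; exact: mulr1.
have [ji|ij] := leqP j i.
  have [w wE] := cst (i == j)%:R; exists w; rewrite wE; apply/funext => b.
  by rewrite (unitriangularP _ (valP b.2)).
case: i j ij => -[|[|[|//]]] i3 [[|[|[|//]]] j3] //= _.
- have [w wE] := gen (@Ordinal 7 4 isT); exists w; rewrite wE; apply/funext => b.
  by congr (val b.2 _ _); apply: val_inj; rewrite /= inordK.
- have [w wE] := gen (@Ordinal 7 6 isT); exists (- w); rewrite linearN /= wE.
  apply/funext => b; rewrite -[LHS]/(- - _) opprK.
  by congr (val b.2 _ _); apply: val_inj; rewrite /= inordK.
have [w wE] := gen (@Ordinal 7 5 isT); exists w; rewrite wE; apply/funext => b.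
by congr (val b.2 _ _); apply: val_inj; rewrite /= inordK.
Qed.

Lemma fun_eval_lin_ext (Q : choiceType) (a : Q -> F) b w :
  fun_eval b (lin_ext a w) = lin_ext (fun q => fun_eval b (a q) : k^o) w.
Proof. by rewrite !lin_extE /= raddf_sum. Qed.

Definition heis (x y z : k) : 'M[k]_3 := \matrix_(i, j)
  if (j <= i)%N then (i == j)%:R
  else if j == 1%N :> nat then x else if i == 1%N :> nat then y else z.

Fact heis_unitriangular x y z : unitriangular (heis x y z).
Proof. by apply/unitriangularP => i j ji; rewrite mxE ji. Qed.

Lemma zmon_OBgen_inj : injective (lin_ext (zmon OBgen)).
Proof.
apply: (@linear_injective _ _ _ (lin_ext (zmon OBgen))) => w w0.
apply: zmonomial_independent => a b g c d h g0.
pose pt : groupB k := (((a, b), MkGm g0), MkH3 (heis_unitriangular c d (- h))).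
have := congr1 (fun_eval pt) w0; rewrite fun_eval_lin_ext rmorph0 => <-.
rewrite !lin_extE; apply: eq_bigr => q _; congr (_ *: _).
rewrite [RHS]rmorph_zmonomial /=; congr zmonomial.
- by rewrite /fun_eval /OBgen /= mxE !inordK.
- by rewrite /fun_eval /OBgen /= mxE !inordK.
- by rewrite /fun_eval /OBgen /= mxE !inordK //= opprK.
Qed.

Definition OB_monomial : zexp -> regular (coordB k) := subalg_zmon OBgen_in.

Lemma OB_monomial_basis : is_basis OB_monomial.
Proof. exact: (subalg_zmon_basis OBgen_central OBgg' OBgen_in OBgen_span zmon_OBgen_inj). Qed.

End CoordinateRing.

(** * Tensor products *)

Section Tensors.
Variable k : fieldType.

Definition is_bilinear (A B W : lmodType k) (f : A -> B -> W) : Prop :=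
  (forall b, linear (f^~ b)) /\ (forall a, linear (f a)).

Lemma eq_tlift (A B W : lmodType k) (f g : A -> B -> W) t :
  (forall a b, f a b = g a b) -> tlift f t = tlift g t.
Proof. by move=> fg; congr tlift; apply/funext => a; apply/funext => b. Qed.

Section LinearFunctions.
Variables (U V : lmodType k) (f : U -> V).
Hypothesis fl : linear f.
Let F : {linear U -> V} := HB.pack f (GRing.isLinear.Build k U V *:%R f fl).

Lemma lin_D x y : f (x + y) = f x + f y. Proof. exact: linearD F x y. Qed.
Lemma lin_B x y : f (x - y) = f x - f y. Proof. exact: linearB F x y. Qed.
Lemma lin_Z c x : f (c *: x) = c *: f x. Proof. by rewrite -[f]/(F : U -> V) linearZ. Qed.
Lemma lin_0 : f 0 = 0. Proof. exact: linear0 F. Qed.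

End LinearFunctions.

Section Lift.
Variables (A B W : lmodType k) (f : A -> B -> W).
Hypothesis bf : is_bilinear f.

Lemma tliftE a b : tlift f (pure a b) = f a b.
Proof. by case: bf => fl fr; exact: tlift_pure. Qed.

Lemma tlift_is_linear : linear (tlift f).
Proof. by case: bf => fl fr; exact: tlift_linear. Qed.

Lemma tlift0 : tlift f 0 = 0.
Proof.
have := tlift_is_linear 1 0 0; rewrite !scale1r addr0 => /eqP.
by rewrite -[X in X == _]addr0 (inj_eq (addrI _)) => /eqP <-.
Qed.

Lemma tliftD s t : tlift f (s + t) = tlift f s + tlift f t.
Proof. by have := tlift_is_linear 1 s t; rewrite !scale1r. Qed.

Lemma tlift_sum (I : Type) (r : seq I) (P : pred I) (F : I -> tensor A B) :
  tlift f (\sum_(i <- r | P i) F i) = \sum_(i <- r | P i) tlift f (F i).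
Proof. exact: (big_morph _ tliftD tlift0). Qed.

End Lift.

Section Induction.
Variables A B : lmodType k.

Lemma pure0l b : pure (0 : A) b = 0 :> tensor A B.
Proof. by rewrite -(scale0r 0) pureZl scale0r. Qed.

Lemma pure0r a : pure a (0 : B) = 0 :> tensor A B.
Proof. by rewrite -(scale0r 0) pureZr scale0r. Qed.

Lemma tensor_ind (P : tensor A B -> Prop) :
  (forall a b, P (pure a b)) -> (forall s t, P s -> P t -> P (s + t)) ->
  forall t, P t.
Proof.
move=> Pp PD t; case: (lpi_surj t) => v <-.
have P0 : P 0 by have := Pp 0 0; rewrite pure0l.
rewrite [v]monalgE.
rewrite (big_morph (lpi (bilinear_relator (A := A) (B := B)))
  (@lpiD _ _ _) (linear0 _)).
elim/big_rec: _ => // -[a b] s _ Ps; apply: PD => //.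
have -> : << v@_(a, b) *g (a, b) >> = v@_(a, b) *: << (a, b) >> :> {malg k[(A * B)%type]}.
  by apply/malgP => j; rewrite mcoeffZ !mcoeffU mulr_natr.
by rewrite linearZ; have := Pp (v@_(a, b) *: a) b; rewrite pureZl.
Qed.

Lemma tensor_sum t : exists n (a : 'I_n -> A) (b : 'I_n -> B),
  t = \sum_i pure (a i) (b i).
Proof.
elim/tensor_ind: t => [a b|s t [n [a [b ->]]] [m [a' [b' ->]]]].
  by exists 1%N, (fun=> a), (fun=> b); rewrite big_ord1.
exists (n + m)%N, (fun i => match split i with inl j => a j | inr j => a' j end),
  (fun i => match split i with inl j => b j | inr j => b' j end).
rewrite big_split_ord; congr (_ + _); apply: eq_bigr => i _.
  by rewrite (unsplitK (inl _ i : 'I_n + 'I_m)).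
by rewrite (unsplitK (inr _ i : 'I_n + 'I_m)).
Qed.

Lemma eq_on_pure (W : lmodType k) (f g : tensor A B -> W) : linear f -> linear g ->
  (forall a b, f (pure a b) = g (pure a b)) -> f =1 g.
Proof.
move=> fl gl fg t; elim/tensor_ind: t => // s t hs ht.
by have := fl 1 s t; have := gl 1 s t; rewrite !scale1r => -> ->; rewrite hs ht.
Qed.

(** Write a tensor with as few terms as possible: a linear dependence between the right
    factors removes a term, and if they are independent, then the left factors vanish. *)
Lemma tensor_separated (X Y : Type) (phi : X -> {scalar A}) (psi : Y -> {scalar B}) :
  (forall a, (forall x, phi x a = 0) -> a = 0) ->
  (forall b, (forall y, psi y b = 0) -> b = 0) ->
  forall t : tensor A B,
    (forall x y, tlift (W := k^o) (fun a b => phi x a * psi y b) t = 0) -> t = 0.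
Proof.
move=> sepA sepB t; have [n [a [b ->]]] := tensor_sum t => {t} h.
have bl x y : is_bilinear (W := k^o) (fun a b => phi x a * psi y b).
  split=> [b0 c u v|a0 c u v]; rewrite linearP /= ?mulrDl ?mulrDr.
    by rewrite -mulrA.
  by rewrite mulrCA.
have {}h x y : \sum_i phi x (a i) * psi y (b i) = 0.
  by rewrite -[RHS](h x y) tlift_sum //; apply: eq_bigr => i _; rewrite tliftE.
elim: n a b h => [|n IH] a b h; first by rewrite big_ord0.
have [[c [j cj0] cb]|indep] := pselect (exists2 c : 'I_n.+1 -> k,
    exists j, c j != 0 & \sum_i c i *: b i = 0).
  have bj : b j = \sum_i (- (c j)^-1 * c (lift j i)) *: b (lift j i).
    move: cb; rewrite (bigD1_ord j) //= => /eqP; rewrite addr_eq0 => /eqP cb.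
    apply: (scalerI cj0); rewrite cb scaler_sumr -sumrN; apply: eq_bigr => i _.
    by rewrite scalerA mulrA mulrN mulfV // mulN1r scaleNr.
  pose a' i := a (lift j i) + (- (c j)^-1 * c (lift j i)) *: a j.
  transitivity (\sum_i pure (a' i) (b (lift j i))).
    rewrite (bigD1_ord j) //= addrC bj (big_morph _ (pureDr (a j)) (pure0r _)).
    rewrite -big_split; apply: eq_bigr => i _ /=.
    by rewrite pureZr -pureZl -pureDl.
  apply: IH.
  move=> x y; rewrite -[RHS](h x y) (bigD1_ord j) //= bj linear_sum mulr_sumr.
  rewrite -big_split; apply: eq_bigr => i _ /=.
  by rewrite /a' linearD !linearZ /= mulrDl addrC mulrCA !mulrA.
have a0 i : a i = 0.
  apply: sepA => x; apply/eqP/contraT => ai0; case: indep.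
  exists (fun i => phi x (a i)); first by exists i.
  apply: sepB => y; rewrite linear_sum -[RHS](h x y).
  by apply: eq_bigr => j _; rewrite linearZ.
by rewrite big1 // => i _; rewrite a0 pure0l.
Qed.

End Induction.

Lemma linear_tlift (A B W W' : lmodType k) (f : A -> B -> W) (L : W -> W') t :
  is_bilinear f -> linear L -> L (tlift f t) = tlift (fun a b => L (f a b)) t.
Proof.
move=> bf lL; have [fl fr] := bf.
have blf : is_bilinear (fun a b => L (f a b)).
  by split=> [b|a] c u v; rewrite ?fl ?fr lL.
apply: (eq_on_pure (f := fun t => L (tlift f t)) (g := tlift (fun a b => L (f a b)))).
- by move=> c u v; rewrite tlift_is_linear // lL.
- exact: tlift_is_linear.
by move=> a b; rewrite !tliftE.
Qed.

Lemma tmap_bilinear (A A' B B' : lmodType k) (f : A -> A') (g : B -> B') :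
  linear f -> linear g -> is_bilinear (fun a b => pure (f a) (g b)).
Proof.
move=> fl gl; split=> [b c u v|a c u v]; first by rewrite fl pureDl pureZl.
by rewrite gl pureDr pureZr.
Qed.

Lemma tmapE (A A' B B' : lmodType k) (f : A -> A') (g : B -> B') a b :
  linear f -> linear g -> tmap f g (pure a b) = pure (f a) (g b).
Proof. by move=> fl gl; rewrite /tmap tliftE //; exact: tmap_bilinear. Qed.

Lemma tmap_linear (A A' B B' : lmodType k) (f : A -> A') (g : B -> B') :
  linear f -> linear g -> linear (tmap f g).
Proof. by move=> fl gl; exact: tlift_is_linear (tmap_bilinear fl gl). Qed.

End Tensors.

(** * Hopf algebras from groups of points *)

Lemma sum_only1 (V : zmodType) (I : finType) (i : I) (F : I -> V) :
  (forall j, j != i -> F j = 0) -> \sum_j F j = F i.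
Proof. by move=> h; rewrite (bigD1 i) //= big1 ?addr0. Qed.

Section SuperMul.
Variable k : fieldType.

Lemma tlift_param_linear (U A B W : lmodType k) (F : U -> A -> B -> W) t :
  (forall x, is_bilinear (F x)) -> (forall a b, linear (fun x => F x a b)) ->
  linear (fun x => tlift (F x) t).
Proof.
move=> bF lF c x y; elim/tensor_ind: t => [a b|s t hs ht]; first by rewrite !tliftE // lF.
by rewrite !tliftD // hs ht scalerDr addrACA.
Qed.

Variables (A : algType k) (par : bool -> {linear A -> A}).

(** The sum that defines the product of two pure tensors, named so that its linearity in
    each argument can be used separately. *)
Definition super_term (a b c d : A) : tensor A A :=
  \sum_(i : bool) \sum_(j : bool)
    (-1) ^+ (i && j) *: pure (a * par j c) (par i b * d).

Lemma sum_linear (U W : lmodType k) (I : Type) (r : seq I) (F : I -> U -> W) :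
  (forall i, linear (F i)) -> linear (fun x => \sum_(i <- r) F i x).
Proof.
move=> lF c x y; rewrite scaler_sumr -big_split.
by apply: eq_bigr => i _; rewrite lF.
Qed.

Lemma super_term_linear_a b c d : linear (fun a => super_term a b c d).
Proof.
do 2!(apply: sum_linear => ?); move=> z x y.
by rewrite mulrDl -scalerAl pureDl pureZl scalerDr !scalerA mulrC.
Qed.

Lemma super_term_linear_b a c d : linear (fun b => super_term a b c d).
Proof.
do 2!(apply: sum_linear => ?); move=> z x y.
by rewrite linearP mulrDl -scalerAl pureDr pureZr scalerDr !scalerA mulrC.
Qed.

Lemma super_term_linear_c a b d : linear (fun c => super_term a b c d).
Proof.
do 2!(apply: sum_linear => ?); move=> z x y.
by rewrite linearP mulrDr -scalerAr pureDl pureZl scalerDr !scalerA mulrC.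
Qed.

Lemma super_term_linear_d a b c : linear (fun d => super_term a b c d).
Proof.
do 2!(apply: sum_linear => ?); move=> z x y.
by rewrite mulrDr -scalerAr pureDr pureZr scalerDr !scalerA mulrC.
Qed.

Lemma super_term_bilinear a b : is_bilinear (super_term a b).
Proof. by split=> ?; [exact: super_term_linear_c | exact: super_term_linear_d]. Qed.

Lemma super_mul_bilinear_l t : is_bilinear (fun a b => tlift (super_term a b) t).
Proof.
split=> ?; apply: tlift_param_linear => *; try exact: super_term_bilinear.
  exact: super_term_linear_a.
exact: super_term_linear_b.
Qed.

Lemma super_mul_pure_l a b t : super_mul par (pure a b) t = tlift (super_term a b) t.
Proof. exact: (tliftE (super_mul_bilinear_l t)). Qed.

Lemma super_mul_pure a b c d :
  super_mul par (pure a b) (pure c d) = super_term a b c d.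
Proof. by rewrite super_mul_pure_l (tliftE (super_term_bilinear a b)). Qed.

Lemma super_mul_linear_l t : linear (fun s => super_mul par s t).
Proof. exact: tlift_is_linear (super_mul_bilinear_l t). Qed.

Lemma super_mul_linear_r s : linear (super_mul par s).
Proof.
move=> c t t'; elim/tensor_ind: s => [a b|s s' hs hs'].
  by rewrite !super_mul_pure_l (tlift_is_linear (super_term_bilinear a b)).
have D x : super_mul par (s + s') x = super_mul par s x + super_mul par s' x.
  by have := super_mul_linear_l x 1 s s'; rewrite !scale1r.
by rewrite !D hs hs' scalerDr addrACA.
Qed.

Lemma super_mulDl s s' t : super_mul par (s + s') t = super_mul par s t + super_mul par s' t.
Proof. by have := super_mul_linear_l t 1 s s'; rewrite !scale1r. Qed.

Lemma super_mulDr s t t' : super_mul par s (t + t') = super_mul par s t + super_mul par s t'.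
Proof. by have := super_mul_linear_r s 1 t t'; rewrite !scale1r. Qed.

Lemma super_mul_homog i j a b c d :
  (forall i', par i' b = if i' == i then b else 0) ->
  (forall j', par j' c = if j' == j then c else 0) ->
  super_mul par (pure a b) (pure c d) = (-1) ^+ (i && j) *: pure (a * c) (b * d).
Proof.
move=> hb hc; rewrite super_mul_pure /super_term (@sum_only1 _ _ i).
  rewrite (@sum_only1 _ _ j); first by rewrite hb hc !eqxx.
  by move=> j' /negPf nj; rewrite hc nj mulr0 pure0l scaler0.
move=> i' /negPf ni; apply: big1 => j' _.
by rewrite hb ni mul0r pure0r scaler0.
Qed.

End SuperMul.

(** A commutative algebra of functions on a group, on which pullback along the product and
    along the inverse can be expressed in the algebra, is a Hopf algebra: each axiom is an
    identity between functions on a power of the group, where points separate elements. *)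
Section HopfFromPoints.
Variables (k : fieldType) (A : algType k) (Gr : groupType).
Variable ev : Gr -> A -> k.
Hypothesis ev_linear : forall g, linear (ev g : A -> k^o).
Hypothesis ev_monoid : forall g, monoid_morphism (ev g).
Hypothesis ev_sep : forall a, (forall g, ev g a = 0) -> a = 0.

Let evs g : {scalar A} := HB.pack (ev g : A -> k^o)
  (GRing.isLinear.Build k A k^o *%R (ev g : A -> k^o) (ev_linear g)).

Let evM g a b : ev g (a * b) = ev g a * ev g b. Proof. exact: (ev_monoid g).2. Qed.
Let ev1 g : ev g 1 = 1. Proof. exact: (ev_monoid g).1. Qed.

Let evZ g c a : ev g (c *: a) = c * ev g a.
Proof.
have := ev_linear g c a 0; rewrite !addr0 => ->.
by have -> : ev g 0 = 0 := linear0 (evs g); exact: addr0.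
Qed.

Definition ev2 (g h : Gr) (t : tensor A A) : k :=
  tlift (W := k^o) (fun a b => ev g a * ev h b) t.

Lemma ev2_bil g h : is_bilinear (W := k^o) (fun a b => ev g a * ev h b).
Proof.
split=> [b c x y|a c x y]; rewrite ev_linear ?mulrDl ?mulrDr; congr (_ + _).
  by rewrite -[LHS]/(c * ev g x * ev h b) -mulrA.
exact: (mulrCA (ev g a) c (ev h x)).
Qed.

Lemma ev2_pure g h a b : ev2 g h (pure a b) = ev g a * ev h b.
Proof. exact: (tliftE (ev2_bil g h)). Qed.

Lemma ev2_linear g h : linear (ev2 g h : tensor A A -> k^o).
Proof. exact: tlift_is_linear (ev2_bil g h). Qed.

Let ev2s (gh : Gr * Gr) : {scalar tensor A A} :=
  HB.pack (ev2 gh.1 gh.2 : tensor A A -> k^o)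
    (GRing.isLinear.Build k (tensor A A) k^o *%R (ev2 gh.1 gh.2 : tensor A A -> k^o)
       (ev2_linear gh.1 gh.2)).

Lemma ev2_sep t : (forall g h, ev2 g h t = 0) -> t = 0.
Proof. exact: (tensor_separated (phi := evs) (psi := evs) ev_sep ev_sep). Qed.

Lemma ev_inj a b : (forall g, ev g a = ev g b) -> a = b.
Proof.
move=> ab; apply/eqP; rewrite -subr_eq0; apply/eqP/ev_sep => g.
by rewrite -[LHS]/(evs g (a - b)) linearB /= ab subrr.
Qed.

Lemma ev2_inj s t : (forall g h, ev2 g h s = ev2 g h t) -> s = t.
Proof.
move=> st; apply/eqP; rewrite -subr_eq0; apply/eqP/ev2_sep => g h.
by rewrite -[LHS]/(ev2s (g, h) (s - t)) linearB /= st subrr.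
Qed.

Definition ev3 (g h l : Gr) (t : tensor A (tensor A A)) : k :=
  tlift (W := k^o) (fun a s => ev g a * ev2 h l s) t.

Let ev3_bil g h l : is_bilinear (W := k^o) (fun a s => ev g a * ev2 h l s).
Proof.
split=> [b c x y|a c x y]; rewrite ?ev_linear ?ev2_linear ?mulrDl ?mulrDr; congr (_ + _).
  by rewrite -[LHS]/(c * ev g x * ev2 h l b) -mulrA.
exact: (mulrCA (ev g a) c (ev2 h l x)).
Qed.

Lemma ev3_linear g h l : linear (ev3 g h l : tensor A (tensor A A) -> k^o).
Proof. exact: tlift_is_linear (ev3_bil g h l). Qed.

Lemma ev3_pure g h l a s : ev3 g h l (pure a s) = ev g a * ev2 h l s.
Proof. exact: (tliftE (ev3_bil g h l)). Qed.

Lemma ev3_inj s t : (forall g h l, ev3 g h l s = ev3 g h l t) -> s = t.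
Proof.
move=> st; apply/eqP; rewrite -subr_eq0; apply/eqP.
have sep2 u : (forall gh : Gr * Gr, ev2s gh u = 0) -> u = 0.
  by move=> h; apply: ev2_sep => g l; exact: h (g, l).
apply: (tensor_separated (phi := evs) (psi := ev2s) ev_sep sep2) => g [h l].
rewrite -[LHS]/(ev3 g h l (s - t)).
have e := ev3_linear g h l (-1) t s; rewrite scaleN1r in e.
by rewrite [s - t]addrC; apply: etrans e _; rewrite st scaleN1r addNr.
Qed.

Hypothesis comul_point : forall a, exists t, forall g h, ev2 g h t = ev (g * h)%g a.
Hypothesis antipode_point : forall a, exists b, forall g, ev g b = ev (g^-1)%g a.

Let choose_comul : {Delta : A -> tensor A A | forall a g h,
  ev2 g h (Delta a) = ev (g * h)%g a}.
Proof. by have [D DE] := boolp.choice comul_point; exists D. Qed.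

Let choose_antipode : {S : A -> A | forall a g, ev g (S a) = ev (g^-1)%g a}.
Proof. by have [S SE] := boolp.choice antipode_point; exists S. Qed.

Let Delta := sval choose_comul.
Let DeltaE a g h : ev2 g h (Delta a) = ev (g * h)%g a.
Proof. exact: (svalP choose_comul). Qed.

Let S := sval choose_antipode.
Let SE a g : ev g (S a) = ev (g^-1)%g a.
Proof. exact: (svalP choose_antipode). Qed.

Let Delta_linear : linear Delta.
Proof. by move=> c a b; apply: ev2_inj => g h; rewrite ev2_linear !DeltaE ev_linear. Qed.

Let S_linear : linear S.
Proof. by move=> c a b; apply: ev_inj => g; rewrite ev_linear !SE ev_linear. Qed.

Let Dl : {linear A -> tensor A A} :=
  HB.pack Delta (GRing.isLinear.Build k A (tensor A A) *:%R Delta Delta_linear).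
Let Sl : {linear A -> A} :=
  HB.pack S (GRing.isLinear.Build k A A *:%R S S_linear).

Definition even_part (i : bool) (a : A) : A := if i then 0 else a.

Fact even_part_linear i : linear (even_part i).
Proof. by move=> c a b; case: i; rewrite /even_part ?scaler0 ?addr0. Qed.

Definition even_parity (i : bool) : {linear A -> A} :=
  HB.pack (even_part i) (GRing.isLinear.Build k A A *:%R _ (even_part_linear i)).

Lemma super_mul_even a b c d :
  super_mul even_parity (pure a b) (pure c d) = pure (a * c) (b * d).
Proof.
by rewrite (super_mul_homog (i := false) (j := false)) ?scale1r //; case.
Qed.

Lemma ev2_super_mul g h s t :
  ev2 g h (super_mul even_parity s t) = ev2 g h s * ev2 g h t.
Proof.
have evD u v : ev2 g h (u + v) = ev2 g h u + ev2 g h v.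
  by have := ev2_linear g h 1 u v; rewrite !scale1r.
elim/tensor_ind: s => [a b|s s' IH IH']; last first.
  rewrite super_mulDl; apply: etrans (evD _ _) _.
  by apply: etrans (congr2 +%R IH IH') _; rewrite (evD s s') mulrDl.
elim/tensor_ind: t => [c d|t t' IH IH']; last first.
  rewrite super_mulDr; apply: etrans (evD _ _) _.
  by apply: etrans (congr2 +%R IH IH') _; rewrite (evD t t') mulrDr.
by rewrite super_mul_even !ev2_pure !evM mulrACA.
Qed.

Lemma even_tensor_parity i t :
  tensor_parity_part even_parity i t = if i then 0 else t.
Proof.
apply: (eq_on_pure (f := tensor_parity_part even_parity i)
  (g := fun t => if i then 0 else t)).
- apply: sum_linear => j; apply: tmap_linear => *; exact: linearP.
- by move=> c u v; case: i; rewrite ?scaler0 ?addr0.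
move=> a b; rewrite /tensor_parity_part big_bool !tmapE; try by move=> *; exact: linearP.
by case: i; rewrite /= /even_part ?pure0l ?pure0r ?addr0 ?add0r.
Qed.

Lemma point_comul_assoc a :
  tassoc (tmap Dl idfun (Dl a)) = tmap idfun Dl (Dl a).
Proof.
have idl : linear (idfun : A -> A) by [].
have Dlin : linear (Dl : A -> tensor A A) := Delta_linear.
apply: ev3_inj => g h l.
have bil3 c : is_bilinear (fun a' b' : A => pure a' (pure b' c) : tensor A (tensor A A)).
  by split=> [b z x y|b z x y]; rewrite ?pureDl ?pureZl ?pureDr ?pureZr.
have bilassoc : is_bilinear (fun (t : tensor A A) (c : A) =>
    tlift (fun a' b' => pure a' (pure b' c)) t : tensor A (tensor A A)).
  split=> [c|t]; first exact: tlift_is_linear (bil3 c).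
  apply: tlift_param_linear => // b c z x y.
  by rewrite !(pureDr, pureZr).
transitivity (ev2 (g * h)%g l (Delta a)).
  pose f1 (t : tensor A A) : k^o := ev3 g h l (tassoc (tmap Dl idfun t)).
  apply: (eq_on_pure (f := f1) (g := ev2 (g * h)%g l : _ -> k^o)).
  - move=> c u v; rewrite /f1 (tmap_linear Dlin idl).
    by rewrite /tassoc tlift_is_linear // ev3_linear.
  - exact: ev2_linear.
  move=> b c; rewrite /f1 (tmapE b c Dlin idl).
  rewrite /tassoc tliftE // ev2_pure /= -DeltaE.
  pose f2 (t : tensor A A) : k^o := ev3 g h l (tlift (fun a' b' => pure a' (pure b' c)) t).
  pose f3 (t : tensor A A) : k^o := ev2 g h t * ev l c.
  apply: (eq_on_pure (f := f2) (g := f3)).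
  - by move=> z u v; rewrite /f2 tlift_is_linear // ev3_linear.
  - move=> z u v; rewrite /f3 ev2_linear mulrDl; congr (_ + _).
    by rewrite -[LHS]/(z * ev2 g h u * ev l c) -mulrA.
  by move=> a' b'; rewrite /f2 /f3 tliftE // ev3_pure !ev2_pure mulrA.
rewrite DeltaE -mulgA -DeltaE.
pose f1 (t : tensor A A) : k^o := ev3 g h l (tmap idfun Dl t).
apply: (eq_on_pure (f := ev2 g (h * l)%g : _ -> k^o) (g := f1)).
- exact: ev2_linear.
- by move=> c u v; rewrite /f1 (tmap_linear idl Dlin) ev3_linear.
move=> b c; rewrite /f1 (tmapE b c idl Dlin).
by rewrite ev3_pure ev2_pure -DeltaE.
Qed.

Lemma ev_tlift g (f : A -> A -> A) t : is_bilinear f ->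
  ev g (tlift f t) = tlift (W := k^o) (fun a b => ev g (f a b)) t.
Proof.
move=> bf; exact: (linear_tlift (W := A) (W' := k^o) (L := ev g) t bf (ev_linear g)).
Qed.

Lemma point_counit_left a : tlift (fun b c => ev 1%g b *: c) (Dl a) = a.
Proof.
apply: ev_inj => g; rewrite ev_tlift.
  rewrite -[RHS]/(ev g a) -[X in ev X a]mul1g -DeltaE; apply: (@eq_tlift _ _ _ k^o) => b c.
  exact: evZ.
by split=> [b c x y|b c x y];
   rewrite ?ev_linear ?scalerDl ?scalerDr ?scalerA // mulrC.
Qed.

Lemma point_counit_right a : tlift (fun b c => ev 1%g c *: b) (Dl a) = a.
Proof.
apply: ev_inj => g; rewrite ev_tlift.
  rewrite -[RHS]/(ev g a) -[X in ev X a]mulg1 -DeltaE; apply: (@eq_tlift _ _ _ k^o) => b c.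
  by rewrite evZ mulrC.
split=> [c z x y|b z x y]; first by rewrite scalerDr !scalerA mulrC.
by rewrite ev_linear scalerDl -scalerA.
Qed.

Lemma point_antipode_left a : tlift (fun b c => Sl b * c) (Dl a) = ev 1%g a *: 1.
Proof.
apply: ev_inj => g; rewrite ev_tlift.
  transitivity (ev2 g^-1 g (Delta a)).
    by apply: (@eq_tlift _ _ _ k^o) => b c; rewrite evM SE.
  by rewrite DeltaE mulVg evZ ev1 mulr1.
split=> [c z x y|b z x y]; first by rewrite linearP mulrDl -scalerAl.
by rewrite mulrDr -scalerAr.
Qed.

Lemma point_antipode_right a : tlift (fun b c => b * Sl c) (Dl a) = ev 1%g a *: 1.
Proof.
apply: ev_inj => g; rewrite ev_tlift.
  transitivity (ev2 g g^-1 (Delta a)).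
    by apply: (@eq_tlift _ _ _ k^o) => b c; rewrite evM SE.
  by rewrite DeltaE mulgV evZ ev1 mulr1.
split=> [c z x y|b z x y]; first by rewrite mulrDl -scalerAl.
by rewrite linearP mulrDr -scalerAr.
Qed.

Theorem hopf_of_points : exists H : hopf_superalgebra A,
  [/\ purely_even H, forall a g h, ev2 g h (comul H a) = ev (g * h)%g a,
      forall a, counit H a = ev 1%g a
    & forall a g, ev g (antipode H a) = ev (g^-1)%g a].
Proof.
unshelve eexists (@HopfSuperalgebra k A even_parity Dl (evs 1%g) Sl
  _ _ _ _ _ _ _ _ _ _ _ point_comul_assoc point_counit_left point_counit_right
  point_antipode_left point_antipode_right).
- by move=> a; rewrite /= /even_part addr0.
- by move=> [] [] a.
- by [].
- by move=> [] [] a b; rewrite /= /even_part ?mulr0 ?mul0r.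
- by move=> i a; rewrite even_tensor_parity; case: i => //; exact: (linear0 Dl).
- by move=> a; exact: (linear0 (evs 1%g)).
- by move=> [] a //; exact: (linear0 Sl).
- by apply: ev2_inj => g h; rewrite ev2_pure [LHS]DeltaE !ev1 mulr1.
- move=> a b; apply: ev2_inj => g h; rewrite ev2_super_mul [LHS]DeltaE evM.
  by congr (_ * _); rewrite -DeltaE.
- exact: ev1.
- by move=> a b; exact: evM.
by split.
Qed.

End HopfFromPoints.

(** * The graded tensor square *)

(** Associativity of a distributive product is checked on additive generators. *)
Lemma assoc_ext (V : zmodType) (m : V -> V -> V) (E : V -> Prop) :
  left_distributive m +%R -> right_distributive m +%R ->
  (forall P : V -> Prop, (forall x, E x -> P x) ->
    (forall x y, P x -> P y -> P (x + y)) -> forall x, P x) ->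
  (forall x y z, E x -> E y -> E z -> m x (m y z) = m (m x y) z) -> associative m.
Proof.
move=> mDl mDr ind h.
apply: (ind (fun x => forall y z, m x (m y z) = m (m x y) z)) => [x Ex|x x' hx hx' y z].
  apply: (ind (fun y => forall z, m x (m y z) = m (m x y) z)) => [y Ey|y y' hy hy' z].
    apply: (ind (fun z => m x (m y z) = m (m x y) z)) => [z Ez|z z' hz hz'].
      exact: h.
    by rewrite !mDr hz hz'.
  by rewrite !(mDl, mDr) hy hy'.
by rewrite !mDl hx hx'.
Qed.

(** The structure is an argument, as the sign in the product depends on the grading. *)
Definition stensor (k : fieldType) (A : algType k) of hopf_superalgebra A := tensor A A.

Section SuperTensor.
Variables (k : fieldType) (A : algType k) (H : hopf_superalgebra A).
Local Notation par := (parity_part H).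

Definition homogeneous (i : bool) (a : A) : Prop := par i a = a.

Lemma homogeneousE i a : homogeneous i a ->
  forall i', par i' a = if i' == i then a else 0.
Proof. by move=> <- i'; rewrite parity_part_proj; case: eqP => // ->. Qed.

Lemma homogeneous_part i a : homogeneous i (par i a).
Proof. by rewrite /homogeneous parity_part_proj eqxx. Qed.

Lemma homogeneous1 : homogeneous false 1.
Proof. exact: parity_part_one. Qed.

Lemma homogeneousM i j a b : homogeneous i a -> homogeneous j b ->
  homogeneous (i (+) j) (a * b).
Proof. by move=> <- <-; exact: parity_part_mul. Qed.

Lemma homogeneousD i a b : homogeneous i a -> homogeneous i b -> homogeneous i (a + b).
Proof. by rewrite /homogeneous linearD => -> ->. Qed.

Lemma super_mul_homogeneous i j a b c d : homogeneous i b -> homogeneous j c ->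
  super_mul par (pure a b) (pure c d) = (-1) ^+ (i && j) *: pure (a * c) (b * d).
Proof. by move=> hb hc; apply: super_mul_homog; exact: homogeneousE. Qed.

Lemma homogeneous_tensor_ind (P : tensor A A -> Prop) :
  (forall i j a b, homogeneous i a -> homogeneous j b -> P (pure a b)) ->
  (forall s t, P s -> P t -> P (s + t)) -> forall t, P t.
Proof.
move=> Ph PD; apply: tensor_ind => // a b.
rewrite -(parity_part_sum H a) -(parity_part_sum H b) pureDl !pureDr.
by do 2!apply: (PD); try apply: PD; apply: Ph; exact: homogeneous_part.
Qed.

Lemma super_mulZl c s t : super_mul par (c *: s) t = c *: super_mul par s t.
Proof.
have z : super_mul par 0 t = 0 by exact: tlift0 (super_mul_bilinear_l par t).
by have := super_mul_linear_l par t c s 0; rewrite !addr0 z addr0.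
Qed.

Lemma super_mul0r s : super_mul par s 0 = 0.
Proof.
have := super_mulDr par s 0 0; rewrite addr0 => e.
by apply: (addrI (super_mul par s 0)); rewrite -e addr0.
Qed.

Lemma super_mulZr c s t : super_mul par s (c *: t) = c *: super_mul par s t.
Proof.
by have := super_mul_linear_r par s c t 0; rewrite super_mul0r !addr0.
Qed.

Local Notation ST := (stensor H).

HB.instance Definition _ := GRing.Lmodule.on ST.

Definition stensor_one : ST := pure 1 1.
Definition stensor_mul (s t : ST) : ST := super_mul par s t.

Fact stensor_mul1 : left_id stensor_one stensor_mul.
Proof.
apply: homogeneous_tensor_ind => [i j a b ha hb|s t hs ht].
  apply: etrans (super_mul_homogeneous _ _ homogeneous1 ha) _.
  by rewrite scale1r !mul1r.
by rewrite /stensor_mul super_mulDr -/(stensor_mul _ s) hs -/(stensor_mul _ t) ht.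
Qed.

Fact stensor_1mul : right_id stensor_one stensor_mul.
Proof.
apply: homogeneous_tensor_ind => [i j a b ha hb|s t hs ht].
  apply: etrans (super_mul_homogeneous _ _ hb homogeneous1) _.
  by rewrite andbF scale1r !mulr1.
by rewrite /stensor_mul super_mulDl -/(stensor_mul s _) hs -/(stensor_mul t _) ht.
Qed.

Fact stensor_mulDl : left_distributive stensor_mul +%R.
Proof. by move=> s t u; exact: super_mulDl. Qed.

Fact stensor_mulDr : right_distributive stensor_mul +%R.
Proof. by move=> s t u; exact: super_mulDr. Qed.

Fact stensor_mulA : associative stensor_mul.
Proof.
apply: (assoc_ext stensor_mulDl stensor_mulDr
  (E := fun t => exists i j a b, [/\ homogeneous i a, homogeneous j b & t = pure a b])).
  move=> P Ph PD; apply: homogeneous_tensor_ind => // i j a b ha hb.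
  by apply: Ph; exists i, j, a, b.
move=> _ _ _ [i [j [a [b [ha hb ->]]]]] [i' [j' [c [d [hc hd ->]]]]]
  [i'' [j'' [e [f [he hf ->]]]]].
rewrite /stensor_mul (super_mul_homogeneous _ _ hd he).
rewrite (super_mul_homogeneous _ _ hb hc) super_mulZr super_mulZl.
rewrite (super_mul_homogeneous _ _ hb (homogeneousM hc he)).
rewrite (super_mul_homogeneous _ _ (homogeneousM hb hd) he) !scalerA !mulrA.
congr (_ *: _); rewrite -!signr_addb; congr (_ ^+ nat_of_bool _).
by case: j hb; case: j' hd; case: i' hc; case: i'' he.
Qed.

HB.instance Definition _ := GRing.Zmodule_isPzRing.Build ST
  stensor_mulA stensor_mul1 stensor_1mul stensor_mulDl stensor_mulDr.

(** The counit on the left factor sends 1 to 1. *)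
Fact stensor_neq0 : (1 : ST) != 0.
Proof.
have bil : is_bilinear (fun b c : A => counit H b *: c).
  split=> [c z x y|b z x y]; first by rewrite linearP scalerDl -scalerA.
  by rewrite scalerDr !scalerA mulrC.
apply/eqP => /(congr1 (tlift (fun b c : A => counit H b *: c))).
have -> : tlift (fun b c : A => counit H b *: c) (1 : ST) = 1.
  by apply: etrans (tliftE bil 1 1) _; rewrite counit_one scale1r.
by rewrite (tlift0 bil); apply/eqP; exact: oner_neq0.
Qed.

HB.instance Definition _ := GRing.PzSemiRing_isNonZero.Build ST stensor_neq0.

Fact stensor_scaleAl (c : k) (s t : ST) : c *: (s * t) = (c *: s) * t.
Proof. exact: esym (super_mulZl _ _ _). Qed.

HB.instance Definition _ :=
  GRing.LSemiModule_isLSemiAlgebra.Build k ST stensor_scaleAl.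

Fact stensor_scaleAr (c : k) (s t : ST) : c *: (s * t) = s * (c *: t).
Proof. exact: esym (super_mulZr _ _ _). Qed.

HB.instance Definition _ :=
  GRing.LSemiAlgebra_isSemiAlgebra.Build k ST stensor_scaleAr.

Definition tleft (a : A) : ST := pure a 1.
Definition tright (a : A) : ST := pure 1 a.
Definition scomul (a : A) : ST := comul H a.

Lemma stensor_mulE i j a b c d : homogeneous i b -> homogeneous j c ->
  (pure a b : ST) * (pure c d : ST) = (-1) ^+ (i && j) *: pure (a * c) (b * d).
Proof. exact: super_mul_homogeneous. Qed.

Fact tleft_linear : linear tleft.
Proof. by move=> c a b; rewrite /tleft pureDl pureZl. Qed.

Fact tright_linear : linear tright.
Proof. by move=> c a b; rewrite /tright pureDr pureZr. Qed.

Lemma tleftM a c d : tleft a * (pure c d : ST) = pure (a * c) d.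
Proof.
have hom i c' : homogeneous i c' -> tleft a * (pure c' d : ST) = pure (a * c') d.
  move=> hc; apply: etrans (stensor_mulE _ _ homogeneous1 hc) _.
  by rewrite scale1r mul1r.
rewrite -(parity_part_sum H c).
apply: etrans (congr1 (fun t => tleft a * (t : ST)) (pureDl _ _ _)) _.
rewrite mulrDr mulrDr.
apply: etrans _ (esym (pureDl _ _ _)).
have e i : tleft a * (pure (par i c) d : ST) = pure (a * par i c) d.
  by apply: hom; exact: homogeneous_part.
exact: (f_equal2 (fun x y : ST => x + y) (e false) (e true)).
Qed.

Lemma mul_tright a b d : (pure a b : ST) * tright d = pure a (b * d).
Proof.
have hom i b' : homogeneous i b' -> (pure a b' : ST) * tright d = pure a (b' * d).
  move=> hb; apply: etrans (stensor_mulE _ _ hb homogeneous1) _.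
  by rewrite andbF scale1r mulr1.
rewrite -(parity_part_sum H b).
apply: etrans (congr1 (fun t => (t : ST) * tright d) (pureDr _ _ _)) _.
rewrite mulrDl mulrDl.
apply: etrans _ (esym (pureDr _ _ _)).
have e i : (pure a (par i b) : ST) * tright d = pure a (par i b * d).
  by apply: hom; exact: homogeneous_part.
exact: (f_equal2 (fun x y : ST => x + y) (e false) (e true)).
Qed.

Lemma tleft_tright a b : tleft a * tright b = pure a b.
Proof. by apply: etrans (tleftM _ _ _) _; rewrite mulr1. Qed.

Lemma tright_tleft i j a b : homogeneous i a -> homogeneous j b ->
  tright b * tleft a = (-1) ^+ (j && i) *: (tleft a * tright b).
Proof.
move=> ha hb; apply: etrans (stensor_mulE _ _ hb ha) _.
by rewrite tleft_tright mulr1 mul1r.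
Qed.

Fact tleft_monoid : monoid_morphism tleft.
Proof. by split=> // a b; exact: esym (tleftM _ _ _). Qed.

Fact tright_monoid : monoid_morphism tright.
Proof. by split=> // a b; exact: esym (mul_tright _ _ _). Qed.

Fact scomul_linear : linear scomul.
Proof. move=> c a b; exact: (linearP (comul H)). Qed.

Fact scomul_monoid : monoid_morphism scomul.
Proof. by split=> [|a b]; [exact: comul_one | exact: comul_mul]. Qed.

HB.instance Definition _ :=
  GRing.isLinear.Build k A ST *:%R tleft tleft_linear.
HB.instance Definition _ := GRing.isMonoidMorphism.Build A ST tleft tleft_monoid.
HB.instance Definition _ :=
  GRing.isLinear.Build k A ST *:%R tright tright_linear.
HB.instance Definition _ := GRing.isMonoidMorphism.Build A ST tright tright_monoid.
HB.instance Definition _ :=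
  GRing.isLinear.Build k A ST *:%R scomul scomul_linear.
HB.instance Definition _ := GRing.isMonoidMorphism.Build A ST scomul scomul_monoid.

Lemma stensor_addE (s t : tensor A A) : (s : ST) + (t : ST) = s + t.
Proof. by []. Qed.

Lemma stensor_subE (s t : tensor A A) : (s : ST) - (t : ST) = s - t.
Proof. by []. Qed.

End SuperTensor.

(** * p-th powers and falling factorials *)

Section FallingFactorials.
Variables (k : fieldType) (p : nat).
Hypothesis chark : p \in [pchar k].

(** The elements of the prime field are the roots of X ^ p - X. *)
Lemma prod_X_sub_nat : \prod_(i < p) ('X - (i%:R)%:P) = 'X^p - 'X :> {poly k}.
Proof.
have p_pr := pcharf_prime chark; have p_gt1 := prime_gt1 p_pr.
pose rs : seq k := [seq i%:R | i <- iota 0 p].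
have size_p : size ('X^p - 'X : {poly k}) = p.+1.
  by rewrite size_polyDl size_polyXn // size_polyN size_polyX.
have inj : {in iota 0 p &, injective (fun i : nat => i%:R : k)}.
  move=> i j; rewrite !mem_iota add0n /= => ip jp.
  wlog le : i j ip jp / (i <= j)%N.
    by move=> h ij; case: (leqP i j) => [le|/ltnW le]; [|apply/esym]; apply: h.
  move/eqP; rewrite eq_sym -subr_eq0 -natrB // -(dvdn_pcharf chark) => d.
  apply/eqP; rewrite eqn_leq le -subn_eq0 /=.
  by case: posnP d => // pos /(dvdn_leq pos); rewrite leqNgt (leq_ltn_trans (leq_subr _ _) jp).
have := @all_roots_prod_XsubC k ('X^p - 'X) rs.
rewrite size_p size_map size_iota => /(_ erefl) ->.
- rewrite (big_map _ predT (fun z : k => 'X - z%:P)) -[p in iota _ p]subn0 -/(index_iota 0 p) big_mkord.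
  rewrite lead_coefDl ?lead_coefXn ?scale1r //.
  by rewrite size_polyXn size_polyN size_polyX.
- apply/allP => _ /mapP[i _ ->]; rewrite rootE !hornerE.
  by rewrite -(pFrobenius_autE chark) rmorph_nat subrr.
- by rewrite uniq_rootsE (map_inj_in_uniq inj) iota_uniq.
Qed.

Variable A : algType k.
Implicit Type z : A.

Definition falling z n : A := \prod_(i < n) (z - i%:R).

Lemma fallingS z n : falling z n.+1 = falling z n * (z - n%:R).
Proof. by rewrite /falling big_ord_recr. Qed.

Lemma falling_pchar z : falling z p = z ^+ p - z.
Proof.
have := congr1 (horner_alg z) prod_X_sub_nat.
rewrite rmorphB rmorphXn rmorph_prod /= horner_algX => <-.
by apply: eq_bigr => i _; rewrite rmorphB /= horner_algX horner_algC scaler_nat.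
Qed.

Lemma falling_comm z c n : c * z = z * c -> c * falling z n = falling z n * c.
Proof.
move=> cz; elim: n => [|n IH]; first by rewrite /falling big_ord0 mulr1 mul1r.
rewrite fallingS mulrA IH -!mulrA; congr (_ * _).
by rewrite mulrBr mulrBl cz mulr_natr mulr_natl.
Qed.

(** Moving c across shifts z by 1. *)
Lemma falling_shift z c n : c * z = (z + 1) * c ->
  c * falling z n.+1 = (z + 1) * falling z n * c.
Proof.
move=> cz; elim: n => [|n IH].
  by rewrite fallingS /falling big_ord0 mul1r subr0 mulr1 cz.
rewrite fallingS mulrA IH [in RHS]fallingS -!mulrA; congr (_ * (_ * _)).
rewrite mulrBr cz mulrBl mulr_natr mulr_natl mulrDl mul1r.
by rewrite mulrS opprD addrA addrK.
Qed.

Section Exponential.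
Variables a T z c : A.
Hypotheses (Tz : T * z = z * T) (Tc : T * c = c * T) (cz : c * z = (z + 1) * c).
Hypotheses (c2 : c * c = 0) (adT : ad a T = T ^+ 2) (adz : ad a z = 0).
Hypothesis adc : ad a c = T * c.
Hypothesis charA : p \in [pchar A].
Hypothesis odd_p : odd p.

(** The element z T + c is not homogeneous for a, as c moves z.  Still its powers close up:
    the products of z - i appear in front of the powers of T, with one more term linear in
    c since c squares to zero; at step p the linear term has coefficient p and the product
    is z ^ p - z. *)
Lemma expp_sub_falling : (a - (z * T + c)) ^+ p = a ^+ p - (z ^+ p - z) * T ^+ p.
Proof.
(* At n = 0 the predecessor is harmless, the term being multiplied by 0. *)
pose P n := (-1) ^+ n * (falling z n * T ^+ n + (falling z n.-1 * T ^+ n.-1 * c) *+ n).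
have TnF m n : T ^+ m * falling z n = falling z n * T ^+ m.
  by apply: falling_comm; exact/esym/commrX/esym.
have adF n : ad a (falling z n) = 0.
  by apply/ad0P; apply: falling_comm; apply/ad0P.
have adTc n : ad a (T ^+ n * c) = (T ^+ n.+1 * c) *+ n.+1.
  by rewrite (ad_homogeneous adT (r := 1)) ?addn1.
have Tnc n : c * T ^+ n = T ^+ n * c by apply/commrX; exact/esym.
have zF n : z * falling z n = falling z n * z by exact: falling_comm.
have cFc n m : c * (falling z n * T ^+ m * c) = 0.
  rewrite -mulrA -Tnc mulrA; case: n => [|n].
    by rewrite [falling z 0]big_ord0 mulr1 mulrA c2 mul0r.
  by rewrite falling_shift // -mulrA [c * (c * _)]mulrA c2 mul0r mulr0.
have PS n : P n.+1 = - (z * T + c) * P n + ad a (P n).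
  case: n => [|m].
    rewrite /P expr1 !expr0 fallingS [falling z 0]big_ord0 !mul1r subr0 mulN1r expr1.
    by rewrite mulr0n addr0 mulr1 mulr1n /ad mulr1 mul1r subrr addr0.
  pose X := falling z m.+1 * T ^+ m.+2; pose Y := falling z m * T ^+ m.+1 * c.
  have adP : ad a (P m.+1) = (-1) ^+ m.+1 * (X *+ m.+1 + Y *+ (m.+1 * m.+1)).
    have adsgn b : ad a ((-1) ^+ m.+1 * b) = (-1) ^+ m.+1 * ad a b.
      by rewrite -signr_odd; case: odd; rewrite ?expr0 ?expr1 ?mul1r ?mulN1r ?adN.
    rewrite /P adsgn adD adMn /= -[falling z m * _ * _]mulrA !(ad_mul _ (falling _ _)).
    rewrite !adF !mul0r !add0r (ad_homogeneous_exp adT) adTc mulrnAr mulrnAr -mulrnA.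
    by rewrite /Y -[_ * _ * c]mulrA.
  have actP : (z * T + c) * (falling z m.+1 * T ^+ m.+1
      + (falling z m * T ^+ m * c) *+ m.+1) = z * X + ((z + 1) * Y + (z * Y) *+ m.+1).
    have TzF n i : z * T * (falling z n * T ^+ i) = z * (falling z n * T ^+ i.+1).
      by rewrite -!mulrA; congr (_ * _); rewrite mulrA -{1}[T]expr1 TnF expr1 -mulrA -exprS.
    rewrite mulrDl !mulrDr !mulrnAr cFc mul0rn addr0 [z * T * (_ * c)]mulrA !TzF -/X.
    rewrite [c * (_ * _)]mulrA falling_shift // -[_ * c * _]mulrA Tnc.
    by rewrite -addrA; congr (_ + _); rewrite [RHS]addrC /Y !mulrA.
  have XE : falling z m.+2 * T ^+ m.+2 = z * X - X *+ m.+1.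
    by rewrite fallingS mulrBr mulrBl -zF -!mulrA mulr_natl mulrnAr.
  have YE : falling z m.+1 * T ^+ m.+1 * c = z * Y - Y *+ m.
    by rewrite fallingS mulrBr !mulrBl -zF mulr_natr !mulrnAl !mulrA.
  rewrite adP /P -pred_Sn XE YE -pred_Sn exprS mulN1r !mulNr.
  rewrite [(_ + c) * _]mulrA [(_ + c) * (-1) ^+ _]commr_sign -[(-1) ^+ m.+1 * _ * _]mulrA actP.
  rewrite -!mulrN -mulrDr; congr (_ * _).
  have -> : (m.+1 * m.+1 = (m * m.+2).+1)%N by ring.
  rewrite mulrnBl -mulrnA [z * Y *+ m.+2]mulrS [Y *+ _.+1]mulrS mulrDl mul1r.
  rewrite !opprD !opprK -!addrA; congr (_ + _).
  rewrite [LHS]addrCA; congr (_ + _); rewrite [LHS]addrCA [RHS]addrCA; congr (_ + _).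
  by rewrite [RHS]addrCA addKr.
have := leibniz_expp charA PS.
rewrite /P falling_pchar [falling z 0]big_ord0 !expr0 !mulr1 mulr0n addr0 !mul1r !mulr1 => ->.
by rewrite -signr_odd odd_p expr1 mulN1r -mulr_natr (pcharf0 charA) mulr0 addr0.
Qed.

End Exponential.
End FallingFactorials.

(** * p-th powers of the coproducts *)

Definition letter_odd (a : letter) : bool :=
  match a with X1 | X2 | U1 | U2 => true | _ => false end.

Definition tag_combination (s : bool) (c : combination letter) :
    combination (letter * bool)%type :=
  [seq (x.1, [seq (a, s) | a <- x.2]) | x <- c].

(** Letters of the left factor (false) are moved before those of the right factor (true), at
    the cost of a sign when both are odd. *)
Definition Drule2 (a b : letter * bool) : option (combination (letter * bool)%type) :=
  match a, b with
  | (a, true), (b, false) =>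
      Some [:: ((-1) ^+ (letter_odd a && letter_odd b), [:: (b, false); (a, true)])]
  | (a, s), (b, s') =>
      if s == s' then omap (tag_combination s) (Drule a b) else None
  end.

Ltac quote_square v t :=
  lazymatch t with
  | v ?a => constr:(NVar a)
  | ?a + ?b => let x := quote_square v a in let y := quote_square v b in
               constr:(NAdd x y)
  | - ?a => let x := quote_square v a in constr:(NOpp x)
  | ?a ^+ 2 => let x := quote_square v a in constr:(NMul x x)
  | ?a *+ ?n => let x := quote_square v a in constr:(NMuln x n)
  | ?a * ?b => let x := quote_square v a in let y := quote_square v b in
               constr:(NMul x y)
  | 1 => constr:(@NOne (letter * bool)%type)
  | 0 => constr:(@NZero (letter * bool)%type)
  end.

Section CoproductPowers.
Variables (k : fieldType) (A B : algType k) (e : generator -> A) (D : {rmorphism A -> B}).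
Variable v : letter * bool -> B.
Hypothesis rel : satisfies_relations e.
Hypothesis vrule : rules_hold v Drule2.
Local Notation L := (letter_val e).
Local Notation l a := (v (a, false)).
Local Notation r a := (v (a, true)).

Hypothesis Dg : D (e Gen_g) = l G * r G.
Hypothesis Dz : D (e Gen_zeta) = l Zt + r Zt.
Hypothesis Du1 : D (e Gen_u1) = l U1 + r U1.
Hypothesis Dx1 : D (e Gen_x1) = l X1 + l G * r X1.
Hypothesis Dx2 : D (e Gen_x2) = l X2 + l G * r X2.
Hypothesis Du2 : D (e Gen_u2) = l U2 + r U2 - l Zt * r U1.

Variable p : nat.
Hypothesis charB : p \in [pchar B].
Hypothesis p_gt2 : (2 < p)%N.

Ltac normal_form :=
  rewrite ?/ad; match goal with |- ?x = ?y =>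
    let el := quote_square v x in let er := quote_square v y in
    change (neval v el = neval v er);
    apply: (neval_check (n := 40) vrule); by vm_compute
  end.

Let p_gt1 : (1 < p)%N. Proof. exact: prime_gt1 (pcharf_prime charB). Qed.

Lemma exppD_comm a b : a * b = b * a -> (a + b) ^+ p = a ^+ p + b ^+ p :> B.
Proof.
by move=> ab; have := pFrobenius_autD_comm charB ab; rewrite !pFrobenius_autE.
Qed.

Lemma expp_nil2 (c : B) : c ^+ 2 = 0 -> c ^+ p = 0.
Proof. by move=> c2; rewrite -(subnK p_gt1) exprD c2 mulr0. Qed.

Lemma exppD_nil2 a c : a * c = c * a -> c ^+ 2 = 0 -> (a + c) ^+ p = a ^+ p :> B.
Proof. by move=> ac c2; rewrite exppD_comm // (expp_nil2 c2) addr0. Qed.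

Lemma exppM_comm a b n : a * b = b * a -> (a * b) ^+ n = a ^+ n * b ^+ n :> B.
Proof. by move=> ab; exact: exprMn_comm. Qed.

Lemma comul_g' : D (e Gen_ginv) = l G' * r G'.
Proof.
have gg' : e Gen_ginv * e Gen_g = 1 by apply/rel/rel_g'g.
have h : D (e Gen_g) * (l G' * r G') = 1 by rewrite Dg; normal_form.
by rewrite -[LHS]mulr1 -h mulrA -rmorphM gg' rmorph1 mul1r.
Qed.

Lemma comul_gp : D (e Gen_g ^+ p) = l G ^+ p * r G ^+ p.
Proof. by rewrite rmorphXn Dg exppM_comm //; normal_form. Qed.

(** The coproduct of the inverse of g is forced, being an inverse of that of g. *)
Lemma comul_g'p : D (e Gen_ginv ^+ p) = l G' ^+ p * r G' ^+ p.
Proof. by rewrite rmorphXn /= comul_g' exppM_comm //; normal_form. Qed.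

Lemma comul_zetap : D (e Gen_zeta ^+ p - e Gen_zeta) =
  (l Zt ^+ p - l Zt) + (r Zt ^+ p - r Zt).
Proof.
rewrite rmorphB rmorphXn /= Dz exppD_comm; last by normal_form.
by rewrite opprD addrACA.
Qed.

Lemma comul_x21p : D (L X21 ^+ p) = l X21 ^+ p + l G ^+ (2 * p) * r X21 ^+ p.
Proof.
have -> : D (L X21 ^+ p) = (l X21 + l G * l G * r X21 + l X1 * l G * r X1) ^+ p.
  rewrite rmorphXn; congr (_ ^+ p); rewrite /= rmorphD !rmorphM Dx1 Dx2.
  by normal_form.
rewrite exppD_nil2; try by normal_form.
rewrite exppD_comm; last by normal_form.
by rewrite exppM_comm; [rewrite -expr2 -exprM | normal_form].
Qed.

(** The coproduct of x2 ^ 2 is a sum of x2 ^ 2 (x) 1 and of an element homogeneous of degree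
    2 with respect to it, which itself is the sum of two commuting terms, one of square
    zero. *)
Lemma comul_x2pp : D (e Gen_x2 ^+ (2 * p)) = l X2 ^+ (2 * p) + l G ^+ (2 * p) * r X2 ^+ (2 * p).
Proof.
have -> : D (e Gen_x2 ^+ (2 * p))
    = (l X2 * l X2 + (l G * l G * (r X2 * r X2) + l X1 * l G * r X2)) ^+ p.
  rewrite exprM rmorphXn; congr (_ ^+ p); rewrite expr2 rmorphM /= Dx2.
  by normal_form.
rewrite (expp_add_homogeneous charB (T := l X21)); try by normal_form.
rewrite exppD_nil2; try by normal_form.
by rewrite exppM_comm; [rewrite -!expr2 -!exprM | normal_form].
Qed.

Lemma comul_u21p : D (L U21 ^+ p) = l U21 ^+ p + r U21 ^+ p.
Proof.
have -> : D (L U21 ^+ p) = (l U21 + r U21 - l U1 * r U1) ^+ p.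
  rewrite rmorphXn; congr (_ ^+ p); rewrite /= rmorphD !rmorphM Du1 Du2.
  by normal_form.
rewrite exppD_nil2; try by normal_form.
by rewrite exppD_comm //; normal_form.
Qed.

(** Up to the term u2 ^ 2 (x) 1, handled as for x2, the coproduct of u2 ^ 2 is 1 (x) u2 ^ 2
    minus an element linear in zeta (x) 1; the powers of zeta produced on the way assemble
    to zeta ^ p - zeta, the commutator term of the Heisenberg group. *)
Lemma comul_u2pp : D (e Gen_u2 ^+ (2 * p)) =
  l U2 ^+ (2 * p) + r U2 ^+ (2 * p) - (l Zt ^+ p - l Zt) * r U21 ^+ p.
Proof.
have chark : p \in [pchar k] by rewrite -(pchar_lalg B).
have odd_p : odd p by case: (even_prime (pcharf_prime charB)) p_gt2 => [->|].
have expE : r U2 ^+ (2 * p) - (l Zt ^+ p - l Zt) * r U21 ^+ p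
    = (r U2 * r U2 - (l Zt * r U21 + l U2 * r U1)) ^+ p.
  rewrite (expp_sub_falling chark) //; try by normal_form.
  by rewrite -expr2 -exprM.
rewrite -addrA expE addrC.
have -> : D (e Gen_u2 ^+ (2 * p))
    = (r U2 * r U2 - (l Zt * r U21 + l U2 * r U1) + l U2 * l U2) ^+ p.
  rewrite exprM rmorphXn; congr (_ ^+ p); rewrite expr2 rmorphM /= Du2.
  by normal_form.
rewrite (expp_add_homogeneous charB (T := r U21)); try by normal_form.
by rewrite -[l U2 * l U2]expr2 -exprM.
Qed.

End CoproductPowers.

(** * Coproducts of the central generators *)

Lemma sum_tag_combination (B : nzRingType) (v : letter * bool -> B) s c :
  \sum_(x <- tag_combination s c) (\prod_(i <- x.2) v i) *~ x.1
  = \sum_(x <- c) (\prod_(i <- x.2) v (i, s)) *~ x.1.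
Proof. by rewrite big_map; apply: eq_bigr => x _; rewrite big_map. Qed.

Lemma rules_hold_morph (k : fieldType) (A B : algType k) (f : {rmorphism A -> B})
    (I : choiceType) (u : I -> A) rule : rules_hold u rule ->
  rules_hold (fun i => f (u i)) rule.
Proof.
move=> h a b c R; rewrite -rmorphM (h _ _ _ R) rmorph_sum.
by apply: eq_bigr => x _; rewrite -rmorph_prod raddfMz.
Qed.

(** The coproduct that the group law of the target group prescribes for its coordinate
    functions; the elements are numbered as the generators of Z. *)
Definition central_coproduct (k : fieldType) (Q : algType k) (q : 'I_7 -> Q) (i : 'I_7) :
    tensor Q Q :=
  let x j (j7 : (j < 7)%N) := q (Ordinal j7) in
  match val i with
  | 0%N => pure (x 0%N isT) 1 + pure (x 2%N isT ^+ 2) (x 0%N isT)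
  | 1%N => pure (x 1%N isT) 1 + pure (x 2%N isT ^+ 2) (x 1%N isT)
  | 2%N => pure (x 2%N isT) (x 2%N isT)
  | 3%N => pure (x 3%N isT) (x 3%N isT)
  | 4%N => pure (x 4%N isT) 1 + pure 1 (x 4%N isT)
  | 5%N => pure (x 5%N isT) 1 + pure 1 (x 5%N isT)
  | _ => pure (x 6%N isT) 1 + pure 1 (x 6%N isT) - pure (x 4%N isT) (x 5%N isT)
  end.

Section CentralCoproduct.
Variables (k : fieldType) (Q : algType k) (q : 'I_7 -> Q).
Local Notation z i := (q (@Ordinal 7 i isT)).

Lemma central_coproduct0 i7 : central_coproduct q (@Ordinal 7 0 i7)
  = pure (z 0) 1 + pure (z 2 ^+ 2) (z 0).
Proof. by []. Qed.

Lemma central_coproduct1 i7 : central_coproduct q (@Ordinal 7 1 i7)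
  = pure (z 1) 1 + pure (z 2 ^+ 2) (z 1).
Proof. by []. Qed.

Lemma central_coproduct2 i7 : central_coproduct q (@Ordinal 7 2 i7) = pure (z 2) (z 2).
Proof. by []. Qed.

Lemma central_coproduct3 i7 : central_coproduct q (@Ordinal 7 3 i7) = pure (z 3) (z 3).
Proof. by []. Qed.

Lemma central_coproduct4 i7 : central_coproduct q (@Ordinal 7 4 i7)
  = pure (z 4) 1 + pure 1 (z 4).
Proof. by []. Qed.

Lemma central_coproduct5 i7 : central_coproduct q (@Ordinal 7 5 i7)
  = pure (z 5) 1 + pure 1 (z 5).
Proof. by []. Qed.

Lemma central_coproduct6 i7 : central_coproduct q (@Ordinal 7 6 i7)
  = pure (z 6) 1 + pure 1 (z 6) - pure (z 4) (z 5).
Proof. by []. Qed.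

End CentralCoproduct.

Section GeneratorCoproducts.
Variables (k : fieldType) (A : algType k) (e : generator -> A).
Variable H : hopf_superalgebra A.
Hypothesis rel : satisfies_relations e.
Hypothesis homog_e : forall x, homogeneous H (generator_odd x) (e x).
Local Notation L := (letter_val e).
Local Notation T := (stensor H).

Lemma homogeneous_letter a : homogeneous H (letter_odd a) (L a).
Proof.
case: a; try by exact: homog_e.
  apply: homogeneousD; [exact: homogeneousM (homog_e Gen_x2) (homog_e Gen_x1) |
    exact: homogeneousM (homog_e Gen_x1) (homog_e Gen_x2)].
apply: homogeneousD; [exact: homogeneousM (homog_e Gen_u1) (homog_e Gen_u2) |
  exact: homogeneousM (homog_e Gen_u2) (homog_e Gen_u1)].
Qed.

Definition square_val (x : letter * bool) : T :=
  if x.2 then tright H (L x.1) else tleft H (L x.1).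

(** The two embeddings of the algebra transport its rules, and odd elements of different
    factors anticommute. *)
Lemma square_rules_hold : rules_hold square_val Drule2.
Proof.
have same s f : (forall a, square_val (a, s) = f (L a)) ->
    rules_hold (fun a => f (L a) : T) Drule ->
    forall a b c, omap (tag_combination s) (Drule a b) = Some c ->
    square_val (a, s) * square_val (b, s) = \sum_(x <- c) (\prod_(i <- x.2) square_val i) *~ x.1.
  move=> fE h a b c; case R: (Drule a b) => [d|//] [<-].
  rewrite sum_tag_combination !fE (h _ _ _ R); apply: eq_bigr => x _.
  by congr (_ *~ _); apply: eq_bigr => i _; rewrite fE.
move=> [a [|]] [b [|]] c.
- apply: (same true (tright H)) => //.
  exact: (rules_hold_morph (tright H) (Drules_hold rel)).
- case=> <-; rewrite big_seq1 !big_cons big_nil mulr1.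
  apply: etrans (tright_tleft (homogeneous_letter b) (homogeneous_letter a)) _.
  rewrite /square_val [fst _]/= [snd _]/=.
  by case: (_ && _); rewrite ?expr1 ?expr0 ?scaleN1r ?scale1r ?mulrN1z ?mulr1z.
- by [].
apply: (same false (tleft H)) => //.
exact: (rules_hold_morph (tleft H) (Drules_hold rel)).
Qed.

Hypothesis comul_g : comul H (e Gen_g) = pure (e Gen_g) (e Gen_g).
Hypothesis comul_zeta : comul H (e Gen_zeta) = pure (e Gen_zeta) 1 + pure 1 (e Gen_zeta).
Hypothesis comul_u1 : comul H (e Gen_u1) = pure (e Gen_u1) 1 + pure 1 (e Gen_u1).
Hypothesis comul_x1 : comul H (e Gen_x1) = pure (e Gen_x1) 1 + pure (e Gen_g) (e Gen_x1).
Hypothesis comul_x2 : comul H (e Gen_x2) = pure (e Gen_x2) 1 + pure (e Gen_g) (e Gen_x2).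
Hypothesis comul_u2 : comul H (e Gen_u2)
  = pure (e Gen_u2) 1 + pure 1 (e Gen_u2) - pure (e Gen_zeta) (e Gen_u1).
Variable p : nat.
Hypothesis chark : p \in [pchar k].
Hypothesis p_gt2 : (2 < p)%N.

Let tlr a b : tleft H a * tright H b = pure a b := tleft_tright H a b.

Lemma comul_Zgen i : comul H (Zgen e p i) = central_coproduct (Zgen e p) i.
Proof.
have charT : p \in [pchar T] by rewrite pchar_lalg.
pose v := square_val.
have Dg : scomul H (e Gen_g) = v (G, false) * v (G, true).
  exact: etrans comul_g (esym (tlr _ _)).
have Dz : scomul H (e Gen_zeta) = v (Zt, false) + v (Zt, true) := comul_zeta.
have Du1 : scomul H (e Gen_u1) = v (U1, false) + v (U1, true) := comul_u1.
have Dx1 : scomul H (e Gen_x1) = v (X1, false) + v (G, false) * v (X1, true).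
  exact: etrans comul_x1 (congr1 (fun t : T => v (X1, false) + t) (esym (tlr _ _))).
have Dx2 : scomul H (e Gen_x2) = v (X2, false) + v (G, false) * v (X2, true).
  exact: etrans comul_x2 (congr1 (fun t : T => v (X2, false) + t) (esym (tlr _ _))).
have Du2 : scomul H (e Gen_u2)
    = v (U2, false) + v (U2, true) - v (Zt, false) * v (U1, true).
  exact: etrans comul_u2
    (congr1 (fun t : T => v (U2, false) + v (U2, true) - t) (esym (tlr _ _))).
have hv := square_rules_hold.
have lX a n : v (a, false) ^+ n = tleft H (L a ^+ n) by rewrite rmorphXn.
have rX a n : v (a, true) ^+ n = tright H (L a ^+ n) by rewrite rmorphXn.
have lrX a b n m : v (a, false) ^+ n * v (b, true) ^+ m = pure (L a ^+ n) (L b ^+ m).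
  by apply: etrans (f_equal2 (fun s t : T => s * t) (lX a n) (rX b m)) _; exact: tlr.
pose z j (j7 : (j < 7)%N) : A := Zgen e p (Ordinal j7).
have z0 : L X21 ^+ p = z 0%N isT by [].
have z1 : L X2 ^+ (2 * p) = z 1%N isT by [].
have z2 : L G ^+ p = z 2%N isT by [].
have z3 : L G' ^+ p = z 3%N isT by [].
have z4 : L Zt ^+ p - L Zt = z 4%N isT by [].
have z5 : L U21 ^+ p = z 5%N isT by [].
have z6 : L U2 ^+ (2 * p) = z 6%N isT by [].
have g2 b m : v (G, false) ^+ (2 * p) * v (b, true) ^+ m = pure (z 2%N isT ^+ 2) (L b ^+ m).
  by apply: etrans (lrX _ _ _ _) _; rewrite mulnC exprM z2.
have lZ : v (Zt, false) ^+ p - v (Zt, false) = tleft H (z 4%N isT).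
  apply: etrans (f_equal2 (fun s t : T => s - t) (lX Zt p) (erefl _)) _.
  rewrite -z4; exact: esym (rmorphB (tleft H) _ _).
have rZ : v (Zt, true) ^+ p - v (Zt, true) = tright H (z 4%N isT).
  apply: etrans (f_equal2 (fun s t : T => s - t) (rX Zt p) (erefl _)) _.
  rewrite -z4; exact: esym (rmorphB (tright H) _ _).
have lx0 := lX X21 p; have lx1 := lX X2 (2 * p)%N; have lx5 := lX U21 p.
have lx6 := lX U2 (2 * p)%N; have rx5 := rX U21 p; have rx6 := rX U2 (2 * p)%N.
have gx0 := g2 X21 p; have gx1 := g2 X2 (2 * p)%N.
have gg2 := lrX G G p p; have gg3 := lrX G' G' p p.
rewrite z0 in lx0 gx0; rewrite z1 in lx1 gx1; rewrite z2 in gg2; rewrite z3 in gg3.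
rewrite z5 in lx5 rx5; rewrite z6 in lx6 rx6.
have tD (s s' t t' : T) : s = s' -> t = t' -> s + t = (s' : tensor A A) + (t' : tensor A A).
  by move=> -> ->; exact: stensor_addE.
have c0 := comul_x21p hv Dx1 Dx2 charT; rewrite z0 in c0.
have c1 := comul_x2pp hv Dx2 charT; rewrite -[e Gen_x2]/(L X2) z1 in c1.
have c2 := comul_gp hv Dg p; rewrite -[e Gen_g]/(L G) z2 in c2.
have c3 := comul_g'p rel hv Dg p; rewrite -[e Gen_ginv]/(L G') z3 in c3.
have c4 := comul_zetap hv Dz charT; rewrite -[e Gen_zeta]/(L Zt) z4 in c4.
have c5 := comul_u21p hv Du1 Du2 charT; rewrite z5 in c5.
have c6 := comul_u2pp hv Du2 charT p_gt2; rewrite -[e Gen_u2]/(L U2) z6 in c6.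
have ordE j (j7 : (j < 7)%N) : comul H (Zgen e p (Ordinal j7)) = scomul H (z j j7) by [].
case: i => -[|[|[|[|[|[|[|//]]]]]]] i7; rewrite ordE.
- rewrite central_coproduct0.
  exact: etrans c0 (tD _ _ _ _ lx0 gx0).
- rewrite central_coproduct1.
  exact: etrans c1 (tD _ _ _ _ lx1 gx1).
- rewrite central_coproduct2; exact: etrans c2 gg2.
- rewrite central_coproduct3; exact: etrans c3 gg3.
- rewrite central_coproduct4; exact: etrans c4 (tD _ _ _ _ lZ rZ).
- rewrite central_coproduct5; exact: etrans c5 (tD _ _ _ _ lx5 rx5).
rewrite central_coproduct6; apply: etrans c6 _.
have zu := etrans (f_equal2 (fun s t : T => s * t) lZ rx5) (tlr _ _).
apply: etrans (f_equal2 (fun s t : T => s - t) (tD _ _ _ _ lx6 rx6) zu) _.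
exact: stensor_subE.
Qed.

End GeneratorCoproducts.

(** * The Hopf algebra of regular functions *)

Section CoordinateHopf.
Variables (k : closedFieldType) (Q : algType k).
Local Notation OB := (regular (coordB k)).
Variable f : {lrmorphism Q -> OB}.
Hypothesis f_bij : bijective f.

(** The points of the group seen on an algebra Q isomorphic to the regular functions.  This
    generality gives the Hopf structures of the regular functions and of Z at
    once, and makes their isomorphism a comparison of values. *)
Definition point_eval (b : groupB k) (q : Q) : k :=
  fun_eval b (subalg_incl (coordB k) (f q)).

Fact point_eval_linear b : linear (point_eval b : Q -> k^o).
Proof.
move=> c x y; have E : f (c *: x + y) = c *: f x + f y by rewrite linearP.
have E2 (u v : OB) : subalg_incl (coordB k) (c *: u + v)
    = c *: subalg_incl (coordB k) u + subalg_incl (coordB k) v.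
  exact: (linearP (subalg_incl (coordB k))).
have E3 (u v : fun_algebra k (groupB k)) :
    fun_eval b (c *: u + v) = c * fun_eval b u + fun_eval b v by [].
exact: etrans (congr1 (fun u => fun_eval b (subalg_incl _ u)) E)
  (etrans (congr1 (fun_eval b) (E2 _ _)) (E3 _ _)).
Qed.

Fact point_eval_monoid b : monoid_morphism (point_eval b).
Proof.
split=> [|x y]; rewrite /point_eval.
  exact: etrans (congr1 (fun u => fun_eval b (subalg_incl _ u)) (rmorph1 f)) _.
exact: etrans (congr1 (fun u => fun_eval b (subalg_incl _ u)) (rmorphM f x y))
  (etrans (congr1 (fun_eval b) (rmorphM (subalg_incl _) _ _)) (rmorphM (fun_eval b) _ _)).
Qed.

Fact point_eval_sep q : (forall b, point_eval b q = 0) -> q = 0.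
Proof.
move=> h; apply: (bij_inj f_bij); rewrite linear0; apply: val_inj.
by apply/funext => b; exact: h.
Qed.

Local Notation F := (fun_algebra k (groupB k)).
Local Notation ev2 := (ev2 point_eval).

Fact point_eval_surj (u : F) : u \in subalg_of (coordB k) ->
  exists q, forall b, point_eval b q = u b.
Proof.
have [g _ fg] := f_bij => hu; exists (g (Subalg hu)) => b.
by rewrite /point_eval fg.
Qed.

Fact coord_in u : coordB k u -> u \in subalg_of (coordB k).
Proof. by move=> h; apply/subalg_ofP/in_subalg_gen. Qed.

Let evD b x y : point_eval b (x + y) = point_eval b x + point_eval b y.
Proof. by have := point_eval_linear b 1 x y; rewrite !scale1r. Qed.
Let ev2D b b' x y : ev2 b b' (x + y) = ev2 b b' x + ev2 b b' y.
Proof. by have := ev2_linear point_eval_linear b b' 1 x y; rewrite !scale1r. Qed.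
Let ev1 b : point_eval b 1 = 1. Proof. exact: (point_eval_monoid b).1. Qed.
Let evM b x y : point_eval b (x * y) = point_eval b x * point_eval b y.
Proof. exact: (point_eval_monoid b).2. Qed.
Let ev2p b b' x y : ev2 b b' (pure x y) = point_eval b x * point_eval b' y.
Proof. exact: (ev2_pure point_eval_linear). Qed.

Lemma coord_comul u : coordB k u ->
  exists t, forall b b', ev2 b b' t = u (b * b')%g.
Proof.
have get v (hv : coordB k v) := point_eval_surj (coord_in hv).
have [l lE] := get _ (coordB_l k); have [r1 r1E] := get _ (coordB_r1 k).
have [r2 r2E] := get _ (coordB_r2 k); have [l' l'E] := get _ (coordB_linv k).
case=> [||||i j].
- by exists (pure r1 1 + pure (l ^+ 2) r1) => b b';
    rewrite ev2D !ev2p expr2 evM ev1 mulr1 !lE !r1E -expr2.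
- by exists (pure r2 1 + pure (l ^+ 2) r2) => b b';
    rewrite ev2D !ev2p expr2 evM ev1 mulr1 !lE !r2E -expr2.
- by exists (pure l l) => b b'; rewrite ev2p !lE.
- by exists (pure l' l') => b b'; rewrite ev2p !l'E -[RHS]/((_ * _)^-1) invfM.
have [h hE] := boolp.choice (fun ij : 'I_3 * 'I_3 => get _ (coordB_h k ij.1 ij.2)).
exists (\sum_m pure (h (i, m)) (h (m, j))) => b b'.
rewrite !big_ord_recl big_ord0 addr0 !ev2D !ev2p !hE.
by rewrite -[RHS]/((val b.2 *m val b'.2) i j) mxE !big_ord_recl big_ord0 addr0.
Qed.

Let evZ b c x : point_eval b (c *: x) = c * point_eval b x.
Proof.
have e0 : point_eval b 0 = 0 by apply: (addrI (point_eval b 0)); rewrite -evD !addr0.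
by have := point_eval_linear b c x 0; rewrite !addr0 e0 => ->; exact: addr0.
Qed.

(** The inverse of a unitriangular matrix is polynomial in its entries. *)
Lemma coord_inv u : coordB k u -> exists q, forall b, point_eval b q = u (b^-1)%g.
Proof.
have get v (hv : coordB k v) := point_eval_surj (coord_in hv).
have [l lE] := get _ (coordB_l k); have [r1 r1E] := get _ (coordB_r1 k).
have [r2 r2E] := get _ (coordB_r2 k); have [l' l'E] := get _ (coordB_linv k).
case=> [||||i j].
- exists (l' ^+ 2 * (-1 *: r1)) => b; rewrite expr2 !evM evZ mulN1r !l'E r1E.
  by rewrite -expr2.
- exists (l' ^+ 2 * (-1 *: r2)) => b; rewrite expr2 !evM evZ mulN1r !l'E r2E.
  by rewrite -expr2.
- by exists l' => b; rewrite l'E.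
- by exists l => b; rewrite lE -[RHS]/((_^-1)^-1) invrK.
have [h hE] := boolp.choice (fun ij : 'I_3 * 'I_3 => get _ (coordB_h k ij.1 ij.2)).
pose n i j : Q := h (i, j) + (- (i == j)%:R : k) *: 1.
have nE b i' j' : point_eval b (n i' j') = (val b.2 - 1%:M) i' j'.
  by rewrite evD evZ ev1 mulr1 hE !mxE.
exists ((i == j)%:R *: 1 + (-1 *: n i j + (n i ord0 * n ord0 j + (n i 1 * n 1 j
  + n i 2%:R * n 2%:R j)))) => b.
rewrite !evD !evM !evZ ev1 mulr1 !nE mulN1r.
rewrite -[RHS]/(unitriangular_inv (val b.2) i j) /unitriangular_inv.
set N := val b.2 - 1%:M; rewrite [in RHS]mxE [X in _ = X + _]mxE -addrA.
clearbody N; congr (_ + (_ + _)); [by rewrite mxE | by rewrite mxE |].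
rewrite mxE !big_ord_recl big_ord0 addr0; congr (_ + (_ + _)).
  by congr (N _ _ * N _ _); apply: val_inj.
by congr (N _ _ * N _ _); apply: val_inj.
Qed.

Lemma comul_at_points q : exists t, forall b b', ev2 b b' t = point_eval (b * b')%g q.
Proof.
suff h (u : F) : in_subalg (coordB k) u -> exists t, forall b b', ev2 b b' t = u (b * b')%g.
  have /subalg_ofP hq := valP (f q); exact: h _ hq.
elim=> [v hv||c v _ [t tE]|v w _ [t tE] _ [s sE]|v w _ [t tE] _ [s sE]].
- exact: coord_comul.
- by exists (pure 1 1) => b b'; rewrite ev2p !ev1 mulr1.
- exists (c *: t) => b b'; rewrite -[RHS]/(c * v (b * b')%g) -tE.
  have e0 : ev2 b b' 0 = 0 by apply: (addrI (ev2 b b' 0)); rewrite -ev2D !addr0.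
  have := ev2_linear point_eval_linear b b' c t 0; rewrite !addr0 e0 => ->.
  exact: addr0.
- by exists (t + s) => b b'; rewrite ev2D tE sE.
exists (super_mul (even_parity Q) t s) => b b'.
by rewrite (ev2_super_mul point_eval_linear point_eval_monoid) tE sE.
Qed.

Lemma antipode_at_points q : exists q', forall b, point_eval b q' = point_eval (b^-1)%g q.
Proof.
suff h (u : F) : in_subalg (coordB k) u -> exists q', forall b, point_eval b q' = u (b^-1)%g.
  have /subalg_ofP hq := valP (f q); exact: h _ hq.
elim=> [v hv||c v _ [t tE]|v w _ [t tE] _ [s sE]|v w _ [t tE] _ [s sE]].
- exact: coord_inv.
- by exists 1 => b; rewrite ev1.
- by exists (c *: t) => b; rewrite evZ tE.
- by exists (t + s) => b; rewrite evD tE sE.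
by exists (t * s) => b; rewrite evM tE sE.
Qed.

Theorem coordinate_hopf_transport : exists H : hopf_superalgebra Q,
  [/\ purely_even H, forall q b b', ev2 b b' (comul H q) = point_eval (b * b')%g q,
      forall q, counit H q = point_eval 1%g q
    & forall q b, point_eval b (antipode H q) = point_eval (b^-1)%g q].
Proof.
exact: (hopf_of_points point_eval_linear point_eval_monoid point_eval_sep
  comul_at_points antipode_at_points).
Qed.

Section CoordinateGenerators.
Variable z : 'I_7 -> Q.
Hypothesis f_z : forall i, subalg_incl (coordB k) (f (z i)) = OBgen i :> F.
Variable H : hopf_superalgebra Q.
Hypothesis comul_points : forall q b b', ev2 b b' (comul H q) = point_eval (b * b')%g q.

Let zE b i : point_eval b (z i) = OBgen i b.
Proof. by rewrite /point_eval f_z. Qed.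

Lemma heisenberg_mul (x y : H3 k) :
  [/\ val (x * y)%g (inord 0) (inord 1) = val x (inord 0) (inord 1) + val y (inord 0) (inord 1),
      val (x * y)%g (inord 1) (inord 2) = val x (inord 1) (inord 2) + val y (inord 1) (inord 2)
    & val (x * y)%g (inord 0) (inord 2) = val x (inord 0) (inord 2) + val y (inord 0) (inord 2)
        + val x (inord 0) (inord 1) * val y (inord 1) (inord 2)].
Proof.
have o0 : inord 0 = ord0 :> 'I_3 by apply: val_inj; rewrite /= inordK.
have o1 : inord 1 = lift ord0 ord0 :> 'I_3 by apply: val_inj; rewrite /= inordK.
have o2 : inord 2 = lift ord0 (lift ord0 ord0) :> 'I_3 by apply: val_inj; rewrite /= inordK.
have hx := unitriangularP _ (valP x); have hy := unitriangularP _ (valP y).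
rewrite -[val (x * y)%g]/(val x *m val y) !mxE !big_ord_recl !big_ord0 !addr0 o0 o1 o2.
split; rewrite ?(hx ord0 ord0) ?(hx (lift ord0 _) ord0) ?(hx (lift ord0 ord0) (lift ord0 ord0)) //.
all: rewrite ?(hy (lift ord0 (lift ord0 ord0)) _) ?(hy (lift ord0 ord0) (lift ord0 ord0)) //=.
all: rewrite /= ?mul1r ?mul0r ?mulr1 ?mulr0 ?addr0 ?add0r.
- by rewrite addrC.
- by rewrite addrC.
by rewrite addrA addrC addrA.
Qed.

(** Evaluating at a pair of points turns the formula into the group law in coordinates. *)
Lemma comul_coordinate i : comul H (z i) = central_coproduct z i.
Proof.
apply: (ev2_inj point_eval_linear point_eval_sep) => b b'.
have ev2B x y : ev2 b b' (x - y) = ev2 b b' x - ev2 b b' y.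
  by rewrite -[in RHS](subrK y x) [in RHS]ev2D addrK.
rewrite comul_points zE; have [h01 h12 h02] := heisenberg_mul b.2 b'.2.
case: i => -[|[|[|[|[|[|[|//]]]]]]] i7.
- by rewrite central_coproduct0 ev2D !ev2p expr2 evM ev1 mulr1 !zE -expr2.
- by rewrite central_coproduct1 ev2D !ev2p expr2 evM ev1 mulr1 !zE -expr2.
- by rewrite central_coproduct2 ev2p !zE.
- by rewrite central_coproduct3 ev2p !zE -[LHS]/((_ * _)^-1) invfM.
- by rewrite central_coproduct4 ev2D !ev2p !ev1 mulr1 mul1r !zE.
- by rewrite central_coproduct5 ev2D !ev2p !ev1 mulr1 mul1r !zE.
rewrite central_coproduct6 ev2B ev2D !ev2p !ev1 mulr1 mul1r !zE.
by rewrite -[LHS]/(- val (b.2 * b'.2)%g (inord 0) (inord 2)) h02 !opprD.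
Qed.

End CoordinateGenerators.
End CoordinateHopf.

(** * Injective morphisms and antipodes *)

Lemma purely_evenE (k : fieldType) (A : algType k) (H : hopf_superalgebra A) :
  purely_even H -> forall i a, parity_part H i a = if i then 0 else a.
Proof.
move=> ev [] a; last exact: ev.
by have := parity_part_sum H a; rewrite ev => /(canRL (addKr _)); rewrite addNr.
Qed.

Section TensorMaps.
Variables (k : fieldType).

Lemma tlift_tmap (A A' B B' W : lmodType k) (f : A -> A') (g : B -> B')
    (h : A' -> B' -> W) t : linear f -> linear g -> is_bilinear h ->
  tlift h (tmap f g t) = tlift (fun a b => h (f a) (g b)) t.
Proof.
move=> fl gl hb; rewrite /tmap.
rewrite (linear_tlift _ (tmap_bilinear fl gl) (tlift_is_linear hb)).
by apply: eq_tlift => a b; exact: (tliftE hb).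
Qed.

End TensorMaps.

Section InjectiveMorphism.
Variables (k : fieldType) (A B : algType k).
Variables (HA : hopf_superalgebra A) (HB : hopf_superalgebra B) (f : {lrmorphism A -> B}).
Hypothesis f_comul : forall a, comul HB (f a) = tmap f f (comul HA a).

Let fl : linear f. Proof. by move=> c x y; rewrite linearP. Qed.

(** Restrict the left counit axiom to the source, where injectivity allows f to be
    cancelled, and apply the counit of the source. *)
Lemma morphism_counit : injective f -> forall a, counit HB (f a) = counit HA a.
Proof.
move=> finj a.
have bil : is_bilinear (fun b c : A => counit HB (f b) *: c).
  split=> [c z x y|b z x y]; first by rewrite !linearP scalerDl -scalerA.
  by rewrite scalerDr !scalerA mulrC.
have bilB : is_bilinear (fun b c : B => counit HB b *: c).
  split=> [c z x y|b z x y]; first by rewrite linearP scalerDl -scalerA.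
  by rewrite scalerDr !scalerA mulrC.
have left_counit : tlift (fun b c => counit HB (f b) *: c) (comul HA a) = a.
  apply: finj; rewrite (linear_tlift _ bil fl) -[RHS](counit_left HB) f_comul.
  rewrite (tlift_tmap _ fl fl bilB); apply: eq_tlift => b c; exact: linearZ.
have bilr : is_bilinear (fun b c : A => counit HA c *: b).
  split=> [c z x y|b z x y]; first by rewrite scalerDr !scalerA mulrC.
  by rewrite linearP scalerDl -scalerA.
have el : linear (counit HA : A -> k^o) by move=> c x y; rewrite linearP.
have fel : linear (fun x => counit HB (f x) : k^o) by move=> c x y; rewrite !linearP.
rewrite -[in RHS]left_counit (linear_tlift (W' := k^o) _ bil el).
rewrite -[in LHS](counit_right HA a) (linear_tlift (W' := k^o) _ bilr fel).
apply: (@eq_tlift k A A k^o) => b c; rewrite !linearZ /=; exact: mulrC.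
Qed.

(** Both the restriction of the antipode of the target and the image of the antipode of
    the source are convolution inverses of f. *)
Lemma morphism_antipode : (forall a, counit HB (f a) = counit HA a) ->
  forall a, antipode HB (f a) = f (antipode HA a).
Proof.
move=> f_counit a.
have idl : linear (idfun : A -> A) by [].
have Dl : linear (comul HA) by move=> c x y; rewrite linearP.
pose S1 (x : A) := antipode HB (f x); pose S2 (x : A) := f (antipode HA x).
have S1l c x y : S1 (c *: x + y) = c *: S1 x + S1 y by rewrite /S1 !linearP.
have S2l c x y : S2 (c *: x + y) = c *: S2 x + S2 y by rewrite /S2 !linearP.
have flin c x y : f (c *: x + y) = c *: f x + f y by exact: fl.
have bil2 : is_bilinear (fun y z : A => f y * S2 z).
  split=> [z c u v|y c u v]; first by rewrite flin mulrDl scalerAl.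
  by rewrite S2l mulrDr scalerAr.
have bil3 : is_bilinear (fun (x : A) (t : tensor A A) => S1 x * tlift (fun y z => f y * S2 z) t).
  split=> [t c u v|x c u v]; first by rewrite S1l mulrDl scalerAl.
  by rewrite (tlift_is_linear bil2) mulrDr scalerAr.
have := congr1 (tlift (fun x t => S1 x * tlift (fun y z => f y * S2 z) t)) (comul_assoc HA a).
have -> : tlift (fun x t => S1 x * tlift (fun y z => f y * S2 z) t)
    (tmap idfun (comul HA) (comul HA a)) = S1 a.
  rewrite (tlift_tmap _ idl Dl bil3).
  transitivity (tlift (fun x w => counit HA w *: S1 x) (comul HA a)).
    apply: eq_tlift => x w /=.
    have mulbil : is_bilinear (fun b c : A => b * antipode HA c).
      split=> [z c u v|y c u v]; first by rewrite mulrDl scalerAl.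
      by rewrite linearP mulrDr scalerAr.
    have -> : tlift (fun y z => f y * S2 z) (comul HA w) = counit HA w *: 1.
      transitivity (f (tlift (fun b c => b * antipode HA c) (comul HA w))).
        by rewrite (linear_tlift _ mulbil fl); apply: eq_tlift => y z; rewrite rmorphM.
      by rewrite antipode_right linearZ /= rmorph1.
    by rewrite -scalerAr mulr1.
  have bilr : is_bilinear (fun b c : A => counit HA c *: b).
    split=> [c z x y|b z x y]; first by rewrite scalerDr !scalerA mulrC.
    by rewrite linearP scalerDl -scalerA.
  rewrite -[in RHS](counit_right HA a) (linear_tlift (L := S1) _ bilr S1l).
  by apply: eq_tlift => x w; rewrite /S1 !linearZ.
move=> assoc; rewrite -[LHS]/(S1 a) -[RHS]/(S2 a) -assoc.
have bil1 : is_bilinear (fun x y : A => S1 x * f y).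
  split=> [z c u v|y c u v]; first by rewrite S1l mulrDl scalerAl.
  by rewrite flin mulrDr scalerAr.
have bilS : is_bilinear (fun (t : tensor A A) c => tlift (fun x y => S1 x * f y) t * S2 c).
  split=> [t c u v|x c u v]; first by rewrite (tlift_is_linear bil1) mulrDl scalerAl.
  by rewrite S2l mulrDr scalerAr.
have bilp c : is_bilinear (fun x y : A => pure x (pure y c) : tensor A (tensor A A)).
  by split=> [b z x y|b z x y]; rewrite ?pureDl ?pureZl ?pureDr ?pureZr.
have bila : is_bilinear (fun (t : tensor A A) (c : A) =>
    tlift (fun x y => pure x (pure y c)) t : tensor A (tensor A A)).
  split=> [c|t]; first exact: tlift_is_linear (bilp c).
  by apply: tlift_param_linear => // b c z x y; rewrite !(pureDr, pureZr).
rewrite /tassoc (linear_tlift _ bila (tlift_is_linear bil3)).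
transitivity (tlift (fun (t : tensor A A) c => tlift (fun x y => S1 x * f y) t * S2 c)
    (tmap (comul HA) idfun (comul HA a))).
  apply: eq_tlift => t c; rewrite (linear_tlift _ (bilp c) (tlift_is_linear bil3)).
  have mull : linear (fun x : B => x * S2 c) by move=> z x y; rewrite mulrDl scalerAl.
  rewrite (linear_tlift _ bil1 mull); apply: eq_tlift => x y.
  by rewrite (tliftE bil3) (tliftE bil2) mulrA.
rewrite (tlift_tmap _ Dl idl bilS).
have bill : is_bilinear (fun b c : A => counit HA b *: c).
  split=> [c z x y|b z x y]; first by rewrite linearP scalerDl -scalerA.
  by rewrite scalerDr !scalerA mulrC.
rewrite -[in RHS](counit_left HA a) (linear_tlift (L := S2) _ bill S2l).
apply: eq_tlift => w c; rewrite -[idfun c]/c.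
have mulbil : is_bilinear (fun b c : B => antipode HB b * c).
  split=> [z d u v|y d u v]; first by rewrite linearP mulrDl scalerAl.
  by rewrite mulrDr scalerAr.
have -> : tlift (fun x y => S1 x * f y) (comul HA w) = counit HA w *: 1.
  by rewrite -f_counit -(antipode_left HB) f_comul (tlift_tmap _ fl fl mulbil).
by rewrite -scalerAl mul1r /S2 !linearZ.
Qed.

(** For an injective algebra map, respecting coproducts suffices. *)
Theorem hopf_morphism_of_comul : injective f ->
  (forall i a, f (parity_part HA i a) = parity_part HB i (f a)) -> hopf_morphism HA HB f.
Proof.
move=> finj f_par; have ec := morphism_counit finj; split=> //.
exact: morphism_antipode.
Qed.

End InjectiveMorphism.

(** * Laurent polynomials *)

From mathcomp Require Import mpoly monalg.

(** This is g ^ N times a Laurent monomial, written without negative exponents when N is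
    large; it clears denominators in the fraction field. *)
Definition shifted_monomial (A : nzRingType) (a b g z c d : A) (N : nat) (q : zexp) :=
  let: (i, j, m, n, l, h) := q in
  a ^+ i * (b ^+ j * (g ^+ absz (m + N%:Z) * (z ^+ n * (c ^+ l * d ^+ h)))).

Lemma rmorph_shifted_monomial (A B : nzRingType) (f : {rmorphism A -> B}) a b g z c d N q :
  f (shifted_monomial a b g z c d N q)
  = shifted_monomial (f a) (f b) (f g) (f z) (f c) (f d) N q.
Proof. by case: q => [[[[[i j] m] n] l] h] /=; rewrite !rmorphM !rmorphXn. Qed.

Lemma shifted_monomialE (A : comNzRingType) (a b g g' z c d : A) N (q : zexp) :
  g * g' = 1 -> (absz q.1.1.1.2 <= N)%N ->
  shifted_monomial a b g z c d N q = g ^+ N * zmonomial a b g g' z c d q.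
Proof.
case: q => [[[[[i j] m] n] l] h] /= gg' mN.
have -> : g ^+ absz (m + N%:Z) = g ^+ N * intpow g g' m.
  rewrite -(intpow_nat g g') -(intpow_nat g g' N) -intpowD // 1?mulrC //.
  by congr intpow; lia.
by rewrite (mulrCA (g ^+ N)) (mulrCA (g ^+ N)) -!mulrA.
Qed.

Section LaurentMonomials.
Variable k : closedFieldType.
Local Notation K := (rational_functions k).

Definition laurent_index (i : 'I_7) : 'I_6 := inord (nth 0 [:: 1; 2; 0; 0; 3; 4; 5] i)%N.

Definition Lgen (i : 'I_7) : K :=
  if i == 3%N :> nat then (rf_var k ord0)^-1 else rf_var k (laurent_index i).

Lemma Lgen_central i x : Lgen i * x = x * Lgen i.
Proof. exact: mulrC. Qed.

Local Notation lg i := (Lgen (@Ordinal 7 i isT)).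

Fact laurent_index2 : laurent_index (@Ordinal 7 2 isT) = ord0.
Proof. by apply: val_inj; rewrite /= inordK. Qed.

Fact mpolyX_neq0 i : mpoly.mpolyX k (mpoly.mnm1 i) != 0 :> mpoly.mpoly 6 k.
Proof.
apply/eqP => /(congr1 (mpoly.meval (fun=> 1))).
by rewrite mpoly.mevalXU mpoly.meval0; move/eqP; rewrite oner_eq0.
Qed.

Lemma Lgg' : lg 2 * lg 3 = 1.
Proof.
by rewrite /Lgen /= laurent_index2 mulfV // /rf_var /rf_poly tofrac_eq0 mpolyX_neq0.
Qed.

Lemma Lgen_in i : Lgen i \in subalg_of (@laurent_gen k).
Proof.
apply/subalg_ofP/in_subalg_gen; rewrite /Lgen.
by case: eqP => _; [exact: laurent_inv | exact: laurent_var].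
Qed.

Lemma Lgen_span a : laurent_gen a -> exists w, lin_ext (zmon Lgen) w = a.
Proof.
have gen i : exists w, lin_ext (zmon Lgen) w = Lgen i.
  by exists << zgen_exp i >>; apply: etrans (lin_extU _ _) (zmon_gen _ _).
have var i j : laurent_index i = j -> (i == 3%N :> nat) = false ->
    exists w, lin_ext (zmon Lgen) w = rf_var k j.
  by move=> <- i3; have := gen i; rewrite /Lgen i3.
have ordE i j (i7 : (i < 7)%N) : nth 0%N [:: 1; 2; 0; 0; 3; 4; 5]%N i = val j ->
    laurent_index (Ordinal i7) = j.
  by move=> e; rewrite /laurent_index e inord_val.
case=> [j|]; last exact: (gen (@Ordinal 7 3 isT)).
case: j => -[|[|[|[|[|[|//]]]]]] j6.
- by apply: (var (@Ordinal 7 2 isT)) => //; apply: ordE.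
- by apply: (var (@Ordinal 7 0 isT)) => //; apply: ordE.
- by apply: (var (@Ordinal 7 1 isT)) => //; apply: ordE.
- by apply: (var (@Ordinal 7 4 isT)) => //; apply: ordE.
- by apply: (var (@Ordinal 7 5 isT)) => //; apply: ordE.
- by apply: (var (@Ordinal 7 6 isT)) => //; apply: ordE.
Qed.

Lemma zmon_Lgen_inj : injective (lin_ext (zmon Lgen)).
Proof.
apply: (@linear_injective _ _ _ (lin_ext (zmon Lgen))) => w w0'.
have w0 : lin_ext (zmon Lgen) w = 0 := w0'.
pose N := (\sum_(q <- monalg.msupp w) absz q.1.1.1.2)%N.
have le_N q : q \in monalg.msupp w -> (absz q.1.1.1.2 <= N)%N.
  by move=> qw; rewrite /N (big_rem q qw) leq_addr.
pose X i : mpoly.mpoly 6 k := mpoly.mpolyX k (mpoly.mnm1 (laurent_index i)).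
pose x i := X (inord i).
pose P := shifted_monomial (x 0%N) (x 1%N) (x 2%N) (x 4%N) (x 5%N) (x 6%N) N.
have xE i (i7 : (i < 7)%N) : (i == 3)%N = false -> tofrac (x i) = Lgen (Ordinal i7).
  move=> i3; rewrite /Lgen /= i3 -[RHS]/(tofrac (X _)); congr (tofrac (X _)).
  by apply: val_inj; rewrite /= inordK.
have P0 : \sum_(q <- monalg.msupp w) mpoly.mpolyC 6 (monalg.mcoeff q w) * P q = 0.
  apply/eqP; rewrite -(tofrac_eq0 (R := mpoly.mpoly 6 k)) rmorph_sum /=; apply/eqP.
  rewrite -[RHS](mulr0 (lg 2 ^+ N)) -[X in _ = _ * X]w0 lin_extE mulr_sumr.
  apply: eq_big_seq => q /le_N qN; rewrite rmorphM /=.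
  rewrite -[X in _ = _ * X]/(tofrac (mpoly.mpolyC 6 (monalg.mcoeff q w)) * zmon Lgen q).
  rewrite mulrCA; congr (_ * _).
  transitivity (shifted_monomial (lg 0) (lg 1) (lg 2) (lg 4) (lg 5) (lg 6) N q).
    by rewrite -!xE //; exact: (rmorph_shifted_monomial (@tofrac (mpoly.mpoly 6 k))).
  exact: shifted_monomialE Lgg' qN.
apply: zmonomial_independent => a b g c d h g0.
pose v (i : 'I_6) : k := nth 0 [:: g; a; b; c; d; h] i.
have := congr1 (mpoly.meval v) P0; rewrite mpoly.meval0 raddf_sum /= => P0v.
have gN0 : g ^+ N != 0 by rewrite expf_neq0.
apply: (mulfI gN0); rewrite mulr0 -[RHS]P0v lin_extE mulr_sumr.
apply: eq_big_seq => q /le_N qN; rewrite mpoly.mevalM mpoly.mevalC.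
rewrite -[_ *: _]/(monalg.mcoeff q w * zmonomial a b g g^-1 c d h q) mulrCA.
congr (_ * _); rewrite /P rmorph_shifted_monomial -(shifted_monomialE _ _ _ _ _ _ qN);
  last by rewrite mulfV.
by congr shifted_monomial; rewrite /x /X /= mpoly.mevalXU /v /laurent_index !inordK.
Qed.

Definition laurent_monomial : zexp -> laurent k := subalg_zmon Lgen_in.

Lemma laurent_monomial_basis : is_basis laurent_monomial.
Proof. exact: (subalg_zmon_basis Lgen_central Lgg' Lgen_in Lgen_span zmon_Lgen_inj). Qed.

End LaurentMonomials.

(** * The central Hopf subalgebra *)

(** Even maps induce multiplicative maps on the graded tensor squares. *)
Lemma tmap_super_mul (k : fieldType) (A B : algType k)
    (parA : bool -> {linear A -> A}) (parB : bool -> {linear B -> B})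
    (f : {lrmorphism A -> B}) s t :
  (forall i a, f (parA i a) = parB i (f a)) ->
  tmap f f (super_mul parA s t) = super_mul parB (tmap f f s) (tmap f f t).
Proof.
move=> f_par; have fl : linear f by move=> c x y; rewrite linearP.
have tD := lin_D (tmap_linear fl fl); have tZ := lin_Z (tmap_linear fl fl).
have t0 := lin_0 (tmap_linear fl fl).
pose M x y := tmap f f (super_mul parA x y); pose N x y := super_mul parB (tmap f f x) (tmap f f y).
have MDl x x' y : M (x + x') y = M x y + M x' y.
  exact: etrans (congr1 (tmap f f) (super_mulDl parA x x' y)) (tD _ _).
have MDr x y y' : M x (y + y') = M x y + M x y'.
  exact: etrans (congr1 (tmap f f) (super_mulDr parA x y y')) (tD _ _).
have NDl x x' y : N (x + x') y = N x y + N x' y.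
  exact: etrans (congr1 (fun u => super_mul parB u _) (tD x x')) (super_mulDl parB _ _ _).
have NDr x y y' : N x (y + y') = N x y + N x y'.
  exact: etrans (congr1 (super_mul parB _) (tD y y')) (super_mulDr parB _ _ _).
rewrite -[LHS]/(M s t) -[RHS]/(N s t).
elim/tensor_ind: s => [a b|s s' IH IH']; last by rewrite MDl NDl IH IH'.
elim/tensor_ind: t => [c d|t t' IH IH']; last by rewrite MDr NDr IH IH'.
have -> : M (pure a b) (pure c d) = tmap f f (super_term parA a b c d).
  by rewrite /M (@super_mul_pure k A parA a b c d).
have -> : N (pure a b) (pure c d) = super_term parB (f a) (f b) (f c) (f d).
  exact: etrans (f_equal2 (super_mul parB) (tmapE _ _ fl fl) (tmapE _ _ fl fl))
    (@super_mul_pure k B parB _ _ _ _).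
rewrite /super_term (big_morph (tmap f f) tD t0); apply: eq_bigr => i _.
rewrite (big_morph (tmap f f) tD t0); apply: eq_bigr => j _.
apply: etrans (tZ _ _) _; apply: (congr1 (fun u => _ *: u)).
by apply: etrans (tmapE _ _ fl fl) _; rewrite !rmorphM /= !f_par.
Qed.

(** Compatibility with the coproducts needs to be checked on algebra generators only. *)
Section CompatibleElements.
Variables (k : fieldType) (A B : algType k).
Variables (HA : hopf_superalgebra A) (HB : hopf_superalgebra B) (f : {lrmorphism A -> B}).
Hypothesis f_par : forall i a, f (parity_part HA i a) = parity_part HB i (f a).

Definition comul_compatible (a : A) : Prop := comul HB (f a) = tmap f f (comul HA a).

Let fl : linear f. Proof. by move=> c x y; rewrite linearP. Qed.

Lemma comul_compatible1 : comul_compatible 1.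
Proof.
rewrite /comul_compatible rmorph1 !comul_one; apply: esym.
by apply: etrans (tmapE _ _ fl fl) _; rewrite rmorph1.
Qed.

Lemma comul_compatibleZ c a : comul_compatible a -> comul_compatible (c *: a).
Proof.
rewrite /comul_compatible => h.
have -> : f (c *: a) = c *: f a by rewrite linearZ.
have -> : comul HB (c *: f a) = c *: comul HB (f a) by rewrite linearZ.
have -> : comul HA (c *: a) = c *: comul HA a by rewrite linearZ.
by rewrite h; exact: esym (lin_Z (tmap_linear fl fl) _ _).
Qed.

Lemma comul_compatibleD a b :
  comul_compatible a -> comul_compatible b -> comul_compatible (a + b).
Proof.
rewrite /comul_compatible => h h'.
have -> : f (a + b) = f a + f b by rewrite linearD.
have -> : comul HB (f a + f b) = comul HB (f a) + comul HB (f b) by rewrite linearD.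
have -> : comul HA (a + b) = comul HA a + comul HA b by rewrite linearD.
by rewrite h h'; exact: esym (lin_D (tmap_linear fl fl) _ _).
Qed.

Lemma comul_compatibleM a b :
  comul_compatible a -> comul_compatible b -> comul_compatible (a * b).
Proof.
rewrite /comul_compatible => h h'; rewrite rmorphM !comul_mul h h'.
exact: esym (tmap_super_mul _ _ f_par).
Qed.

End CompatibleElements.

Section CentralHopfSubalgebra.
Variables (k : closedFieldType) (A : algType k) (e : generator -> A).
Hypothesis rel : satisfies_relations e.
Hypothesis pbw : is_basis (fun u : irr_word Drule => \prod_(a <- val u) letter_val e a).
Variable p : nat.
Hypothesis chark : p \in [pchar k].
Hypothesis p_gt2 : (2 < p)%N.
Variable S : A -> Prop.
Hypothesis S_zgen : forall a, S a <-> exists i, a = Zgen e p i.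
Variable H : hopf_superalgebra A.
Hypothesis homog_e : forall x, homogeneous H (generator_odd x) (e x).
Hypothesis comul_zgen : forall i, comul H (Zgen e p i) = central_coproduct (Zgen e p) i.

Local Notation Z := (subalg S).
Local Notation OB := (regular (coordB k)).
Local Notation incl := (subalg_incl S).

Let zin := Zgen_in S_zgen.
Let central := Zgen_central rel pbw chark p_gt2.
Let zz' := Zgg' rel p.

Lemma subalg_central (z : Z) a : val z * a = a * val z.
Proof.
have /subalg_ofP := valP z; elim=> [_ /S_zgen[i ->]||c x _ IH|x y _ IHx _ IHy|x y _ IHx _ IHy].
- exact: central.
- by rewrite mul1r mulr1.
- by rewrite -scalerAl IH scalerAr.
- by rewrite mulrDl mulrDr IHx IHy.
by rewrite -mulrA IHy mulrA IHx mulrA.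
Qed.

Definition central_monomial : zexp -> Z := subalg_zmon zin.

Lemma central_monomial_basis : is_basis central_monomial.
Proof.
apply: (subalg_zmon_basis central zz' zin (Zgen_span S_zgen)).
exact: (Zmon_inj rel pbw chark p_gt2).
Qed.

Lemma central_iso_laurent : exists2 f : {lrmorphism Z -> laurent k}, bijective f &
  forall q, f (central_monomial q) = laurent_monomial k q.
Proof.
apply: (monomial_basis_iso (mul := zexp_add) (one := zexp0) central_monomial_basis
  (laurent_monomial_basis k)).
- exact: (subalg_zmonM central zz').
- exact: (subalg_zmonM (@Lgen_central k) (@Lgg' k)).
- exact: subalg_zmon0.
exact: subalg_zmon0.
Qed.

Lemma central_iso_coordinate : exists2 f : {lrmorphism Z -> OB}, bijective f &
  forall q, f (central_monomial q) = OB_monomial k q.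
Proof.
apply: (monomial_basis_iso (mul := zexp_add) (one := zexp0) central_monomial_basis
  (OB_monomial_basis k)).
- exact: (subalg_zmonM central zz').
- exact: (subalg_zmonM (@OBgen_central k) (@OBgg' k)).
- exact: subalg_zmon0.
exact: subalg_zmon0.
Qed.

(** The Laurent polynomials lie in a field. *)
Lemma subalg_domain (y z : Z) : y * z = 0 -> y = 0 \/ z = 0.
Proof.
have [f fb _] := central_iso_laurent => yz.
have inj := inj_comp (@val_inj _ _ _) (bij_inj fb).
have v0 : val (f 0) = 0 by rewrite rmorph0.
have : val (f y) * val (f z) = 0 by rewrite -rmorphM -rmorphM yz rmorph0 rmorph0.
move/eqP; rewrite mulf_eq0 => /orP[] /eqP h; [left|right]; apply: inj; exact: etrans h (esym v0).
Qed.

Definition central_gen i : Z := Subalg (zin i).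

Lemma central_monomial_gen i : central_monomial (zgen_exp i) = central_gen i.
Proof. by apply: val_inj; exact: zmon_gen. Qed.

Lemma homogeneous_Zgen i : homogeneous H false (Zgen e p i).
Proof.
have hX n a : homogeneous H false a -> homogeneous H false (a ^+ n).
  move=> ha; elim: n => [|n IH]; first exact: homogeneous1.
  by rewrite exprS; exact: homogeneousM ha IH.
have hl a := homogeneous_letter homog_e a.
case: i => -[|[|[|[|[|[|[|//]]]]]]] i7; rewrite /Zgen /=.
- by apply: hX; exact: hl X21.
- by rewrite exprM; apply: hX; exact: homogeneousM (hl X2) (hl X2).
- by apply: hX; exact: hl G.
- by apply: hX; exact: hl G'.
- rewrite -scaleN1r; apply: homogeneousD; first by apply: hX; exact: hl Zt.
  by rewrite /homogeneous linearZ; congr (_ *: _); exact: hl Zt.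
- by apply: hX; exact: hl U21.
by rewrite exprM; apply: hX; exact: homogeneousM (hl U2) (hl U2).
Qed.

Lemma subalg_even (z : Z) : parity_part H false (incl z) = incl z.
Proof.
have /subalg_ofP := valP z; rewrite -[val z]/(incl z).
elim=> [_ /S_zgen[i ->]||c x _ IH|x y _ IHx _ IHy|x y _ IHx _ IHy].
- exact: homogeneous_Zgen.
- exact: homogeneous1.
- by rewrite linearZ IH.
- by rewrite linearD IHx IHy.
exact: (homogeneousM (i := false) (j := false)).
Qed.

(** Both sides are multiplicative and agree on generators, the coproduct of Z having
    been read off from the group law. *)
Lemma incl_comul (HZ : hopf_superalgebra Z) : purely_even HZ ->
  (forall i, comul HZ (central_gen i) = central_coproduct central_gen i) ->
  forall z, comul H (incl z) = tmap incl incl (comul HZ z).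
Proof.
move=> evZ DZ z; have il : linear incl by move=> c x y; rewrite linearP.
have tD := lin_D (tmap_linear il il).
have tE (x y : Z) : tmap incl incl (pure x y) = pure (incl x) (incl y) := tmapE x y il il.
have tB := lin_B (tmap_linear il il); have tZ := lin_Z (tmap_linear il il).
have parE i x : incl (parity_part HZ i x) = parity_part H i (incl x).
  rewrite (purely_evenE evZ); case: i; last by rewrite subalg_even.
  by have := homogeneousE (subalg_even x) true; rewrite linear0 => ->.
have gen i : tmap incl incl (central_coproduct central_gen i)
    = central_coproduct (Zgen e p) i.
  have i2 (x y : Z) : tmap incl incl (pure (x ^+ 2) y) = pure (incl x ^+ 2) (incl y).
    apply: etrans (tE _ _) _; have E : incl (x ^+ 2) = incl x ^+ 2 by exact: rmorphXn.
    by rewrite E.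
  have addE u v u' v' : tmap incl incl u = u' -> tmap incl incl v = v' ->
      tmap incl incl (u + v) = u' + v' by move=> <- <-; exact: tD.
  have subE u v u' v' : tmap incl incl u = u' -> tmap incl incl v = v' ->
      tmap incl incl (u - v) = u' - v' by move=> <- <-; exact: tB.
  case: i => -[|[|[|[|[|[|[|//]]]]]]] i7.
  - by rewrite !central_coproduct0; apply: addE (tE _ _) (i2 _ _).
  - by rewrite !central_coproduct1; apply: addE (tE _ _) (i2 _ _).
  - by rewrite !central_coproduct2; apply: tE.
  - by rewrite !central_coproduct3; apply: tE.
  - by rewrite !central_coproduct4; apply: addE (tE _ _) (tE _ _).
  - by rewrite !central_coproduct5; apply: addE (tE _ _) (tE _ _).
  by rewrite !central_coproduct6; apply: subE (addE _ _ _ _ (tE _ _) (tE _ _)) (tE _ _).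
suff h x : in_subalg S x -> exists2 w : Z, incl w = x &
    comul H (incl w) = tmap incl incl (comul HZ w).
  have [w wz] : exists2 w : Z, incl w = incl z & comul H (incl w) = tmap incl incl (comul HZ w).
    by apply: h; apply/subalg_ofP; exact: (valP z).
  by have -> : w = z by exact: val_inj.
elim=> {x} [_ /S_zgen[i ->]||c _ _ [x <- IH]|_ _ _ [x <- IHx] _ [y <- IHy]
  |_ _ _ [x <- IHx] _ [y <- IHy]].
- exists (central_gen i) => //; rewrite DZ gen; exact: comul_zgen.
- by exists 1; last exact: (comul_compatible1 HZ H incl).
- exists (c *: x); first exact: linearZ.
  exact: (comul_compatibleZ c IH).
- exists (x + y); first exact: linearD.
  exact: (comul_compatibleD IHx IHy).
exists (x * y); first exact: rmorphM.
exact: (comul_compatibleM parE IHx IHy).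
Qed.

(** The Hopf structure of Z is pulled back from the group along the isomorphism of
    algebras that sends generators to coordinates. *)
Lemma central_hopf_iso : exists (HZ : hopf_superalgebra Z) (HO : hopf_superalgebra OB)
    (f : {lrmorphism Z -> OB}),
  [/\ hopf_morphism HZ H incl, coordinate_hopf HO, bijective f & hopf_morphism HZ HO f].
Proof.
have [f fb fE] := central_iso_coordinate.
have [HZ [evZ DZ eZ SZ]] := coordinate_hopf_transport fb.
have idb : bijective (idfun : OB -> OB) by exists idfun.
have [HO [evO DO eO SO]] := coordinate_hopf_transport (f := idfun) idb.
exists HZ, HO, f; split=> //.
- apply: hopf_morphism_of_comul.
  + apply: (incl_comul evZ) => i.
    apply: (comul_coordinate fb _ DZ) => j.
    by rewrite -central_monomial_gen fE; exact: zmon_gen.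
  + exact: val_inj.
  move=> i x; rewrite (purely_evenE evZ); case: i; last by rewrite subalg_even.
  by have := homogeneousE (subalg_even x) true; rewrite linear0 => ->.
apply: hopf_morphism_of_comul.
- move=> a; apply: (ev2_inj (point_eval_linear idfun) (point_eval_sep idb)) => b b'.
  rewrite DO; apply: etrans (esym (DZ a b b')) _.
  have fl : linear f by move=> c x y; rewrite linearP.
  exact: esym (tlift_tmap (W := k^o) _ fl fl (ev2_bil (point_eval_linear idfun) b b')).
- exact: bij_inj.
by move=> i x; rewrite (purely_evenE evZ) (purely_evenE evO); case: i; rewrite ?linear0.
Qed.

End CentralHopfSubalgebra.

(** * The theorem *)

Lemma Z_gen_Zgen (k : fieldType) p a :
  Z_gen k p a <-> exists i, a = Zgen (Dgen k) p i.
Proof.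
split=> [[]|[[[|[|[|[|[|[|[|//]]]]]]] i7] ->]].
- by exists (@Ordinal 7 0 isT).
- by exists (@Ordinal 7 1 isT).
- by exists (@Ordinal 7 5 isT).
- by exists (@Ordinal 7 6 isT).
- by exists (@Ordinal 7 2 isT).
- by exists (@Ordinal 7 3 isT).
- by exists (@Ordinal 7 4 isT).
- exact: Z_gen_x21.
- exact: Z_gen_x2.
- exact: Z_gen_g.
- exact: Z_gen_ginv.
- exact: Z_gen_zeta.
- exact: Z_gen_u21.
exact: Z_gen_u2.
Qed.

Lemma Dtilde_pbw (k : fieldType) :
  is_basis (fun u : irr_word Drule => \prod_(a <- val u) letter_val (Dgen k) a).
Proof.
have [g gK Kg] := irr_word_basis k; split; first exact: can_inj gK.
by move=> d; exists (g d).
Qed.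

Theorem theorem3p7 (k : closedFieldType) (p : nat)
    (charp : p \in [pchar k]) (p_gt2 : (2 < p)%N)
    (H : hopf_superalgebra (Dtilde k)) (HD : Dtilde_hopf H) :
  let Z := subalg (Z_gen k p) in
  let OB := regular (coordB k) in
  [/\ (forall (z : Z) (d : Dtilde k), val z * d = d * val z)
        /\ hopf_subalgebra H (Z_gen k p),
      exists (n : nat) (b : 'I_n -> Dtilde k), forall d : Dtilde k,
        exists! c : {ffun 'I_n -> Z}, d = \sum_(i < n) val (c i) * b i,
      (exists f : {lrmorphism Z -> laurent k}, bijective f)
        /\ (forall y z : Z, y * z = 0 -> y = 0 \/ z = 0)
    & exists (HZ : hopf_superalgebra Z) (HO : hopf_superalgebra OB)
             (f : {lrmorphism Z -> OB}),
        [/\ hopf_morphism HZ H (subalg_incl (Z_gen k p)),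
            coordinate_hopf HO,
            bijective f
          & hopf_morphism HZ HO f]].
Proof.
have rel := @Dgen_relations k; have pbw := @Dtilde_pbw k.
have S_zgen := @Z_gen_Zgen k p.
have [homog_e Dg [Dz Du1] [Dx1 Dx2] Du2] := HD.
have DZ := comul_Zgen rel homog_e Dg Dz Du1 Dx1 Dx2 Du2 charp p_gt2.
have [HZ [HO [f [inclP HOP fb fP]]]] :=
  central_hopf_iso rel pbw charp p_gt2 S_zgen homog_e DZ.
have [par_incl comul_incl _ antipode_incl] := inclP.
split.
- split; first by move=> z d; exact: (subalg_central rel pbw charp p_gt2 S_zgen).
  split=> [i z|z|z] zZ.
  + have E := par_incl i (Subalg zZ); rewrite -[z]/(subalg_incl _ (Subalg zZ)) -E.
    exact: valP.
  + by exists (comul HZ (Subalg zZ)); exact: comul_incl (Subalg zZ).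
  have E := antipode_incl (Subalg zZ); rewrite -[z]/(subalg_incl _ (Subalg zZ)) E.
  exact: valP.
- exists #|{: rexp p}|, (fun i => rmon (Dgen k) (enum_val i)).
  exact: (free_over_center rel pbw charp p_gt2 S_zgen).
- split; last by move=> y z; exact: (subalg_domain rel pbw charp p_gt2 S_zgen).
  by have [fL fLb _] := central_iso_laurent rel pbw charp p_gt2 S_zgen; exists fL.
by exists HZ, HO, f.
Qed.
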